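(* Let $k,\ell,m,n$ be nonnegative integers with $n\ge2$, $m$ even and $k+\ell+m=n$. Let $V\in\mathrm{Gr}_{\ge m}(k,n)$ and $W\in\mathrm{Gr}^{\perp}_{>0}(k+m,n)$. (i) We have $\mathrm{stack}(V,W)\in\mathrm{Mat}^\circ(k+\ell,n)$, and thus $\theta(V,W)=(\tilde W,\tilde V)$ is well defined. (ii) We have $\tilde W\in\mathrm{Gr}^{\perp}_{>0}(\ell+m,n)$ and $\tilde V\in\mathrm{Gr}_{\ge m}(\ell,n)$. (iii) Let $f\in\tilde S_n(-k,\ell)$ be the unique affine permutation such that $V\in\Pi^{>0}_{k+f}$. Then $\tilde V\in\Pi^{>0}_{\ell+f^{-1}}$.
   Context: For integers $a,b\ge0$, $\tilde S_n(-a,b)$ is the set of bijections $f:\mathbb Z\to\mathbb Z$ with $f(i+n)=f(i)+n$ for all $i$, $\sum_{i=1}^n(f(i)-i)=0$, and $i-a\le f(i)\le i+b$ for all $i$. $\mathrm{Gr}(r,n)$ is the Grassmannian of $r$-dimensional subspaces of $\mathbb R^n$, represented as row spans of full rank $r\times n$ matrices. $\mathrm{Gr}_{\ge0}(r,n)$ (resp. $\mathrm{Gr}_{>0}(r,n)$) is the set of elements representable by a matrix with all maximal minors $\ge0$ (resp. $>0$). For $f\in\tilde S_n(-r,n-r)$, the positroid cell $\Pi^{>0}_{r+f}$ is the set of $V\in\mathrm{Gr}_{\ge0}(r,n)$ such that for all integers $a<b$ the rank of the matrix with columns $V(a),\dots,V(b-1)$ (indices modulo $n$) equals $\#\{i<a\mid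 a\le f(i)+r<b\}$; these cells partition $\mathrm{Gr}_{\ge0}(r,n)$. For $0\le m\le n-r$, $\mathrm{Gr}_{\ge m}(r,n):=\bigsqcup_{f\in\tilde S_n(-r,n-r-m)}\Pi^{>0}_{r+f}$. Also $\mathrm{Gr}^{\perp}_{>0}(r,n):=\{Z^\perp\mid Z\in\mathrm{Gr}_{>0}(r,n)\}\subset\mathrm{Gr}(n-r,n)$, with $Z^\perp$ the orthogonal complement for the standard inner product. Stacked twist map: for a $k\times n$ matrix $V$ and an $\ell\times n$ matrix $W$, $U=\mathrm{stack}(V,W)$ is the $(k+\ell)\times n$ matrix with $V$ on top of $W$. Extend its columns $U(1),\dots,U(n)$ to all $j\in\mathbb Z$ by $U(j+n)=(-1)^{k-1}U(j)$. Write $U\in\mathrm{Mat}^\circ(k+\ell,n)$ if for all $j\in\mathbb Z$ the vectors $U(j-\ell),U(j-\ell+1),\dots,U(j+k-1)$ form a basis of $\mathbb R^{k+\ell}$. In that case let $\tilde U=\tau(U)$ be the $(k+\ell)\times n$ matrix with columns $\tilde U(j)$, $1\le j\le n$, where for $j\in\mathbb Z$, $\tilde U(j)\in\mathbb R^{k+\ell}$ is the unique vector with $\langle\tilde U(j),U(j-\ell)\rangle=(-1)^j$ and $\langle\tilde U(j),U(i)\rangle=0$ for $j-\ell+1\le i\le j+k-1$ (then $\tilde U(j+n)=(-1)^{\ell-1}\tilde U(j)$). Let $\tilde W$ be the matrix of the first $k$ rows and $\tilde V$ the matrix of the last $\ell$ rows of $\tilde U$, and set $\theta(V,W):=(\tilde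 W,\tilde V)$. The row spans of $\tilde W$ and $\tilde V$ depend only on those of $V$ and $W$, so $\theta$ is regarded as a rational map $\mathrm{Gr}(k,n)\times\mathrm{Gr}(\ell,n)\dashrightarrow\mathrm{Gr}(k,n)\times\mathrm{Gr}(\ell,n)$ (and membership of $\mathrm{stack}(V,W)$ in $\mathrm{Mat}^\circ(k+\ell,n)$ depends only on the row spans). *)

(* Defs.v *)
From mathcomp Require Import all_boot all_order all_algebra.
From mathcomp Require Import boolp classical_sets cardinality reals.

Set Implicit Arguments.
Unset Strict Implicit.
Unset Printing Implicit Defensive.

Import Order.TTheory GRing.Theory Num.Theory.
Local Open Scope classical_set_scope.
Local Open Scope ring_scope.

(* The set S~_n(-a, b) of bounded affine permutations. *)
Definition affine_perm (n a b : nat) (f : int -> int) : Prop :=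
  [/\ bijective f,
      forall i, f (i + n%:Z) = f i + n%:Z,
      \sum_(1 <= i < n.+1) (f i%:Z - i%:Z) = 0
    & forall i, i - a%:Z <= f i <= i + b%:Z].

(* Columns are numbered 1, ..., n and extended n-periodically to all of int;
   column j is the mathcomp column (j - 1) mod n.  The default 0 is only used
   when n = 0. *)
Definition colz (R : realType) (p n : nat) (A : 'M[R]_(p, n)) (j : int) :
    'cV[R]_p :=
  if insub `|((j - 1) %% n%:Z)%Z|%N is Some c then col c A else 0.

(* Points of Gr(r, n) are given by full rank r x n matrices, up to the equality
   of row spaces (_ :=: _)%MS; all the predicates below are invariant under it.
   The maximal minors are the determinants of the column selections along
   strictly increasing maps 'I_r -> 'I_n. *)
Definition Gr (R : realType) (r n : nat) (V : 'M[R]_(r, n)) : Prop :=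
  row_free V.

Definition Gr_ge0 (R : realType) (r n : nat) (V : 'M[R]_(r, n)) : Prop :=
  Gr V /\ exists A : 'M[R]_(r, n), (A :=: V)%MS /\
    forall g : 'I_r -> 'I_n, {homo g : i j / (i < j)%N} ->
      0 <= \det (colsub g A).

Definition Gr_gt0 (R : realType) (r n : nat) (V : 'M[R]_(r, n)) : Prop :=
  Gr V /\ exists A : 'M[R]_(r, n), (A :=: V)%MS /\
    forall g : 'I_r -> 'I_n, {homo g : i j / (i < j)%N} ->
      0 < \det (colsub g A).

(* The rows of kermx Z^T span {u | u *m Z^T = 0}, the orthogonal complement of
   the row space of Z. *)
Definition Gr_perp_gt0 (R : realType) (r q n : nat) (W : 'M[R]_(q, n)) : Prop :=
  Gr W /\ exists Z : 'M[R]_(r, n), Gr_gt0 Z /\ (W :=: kermx Z^T)%MS.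

(* The r x (b - a) matrix with columns V(a), ..., V(b - 1), for a <= b. *)
Definition col_window (R : realType) (r n : nat) (V : 'M[R]_(r, n))
    (a b : int) : 'M[R]_(r, `|b - a|%N) :=
  \matrix_(i, t) colz V (a + (t : nat)%:Z) i 0.

(* The positroid cell Pi^{>0}_{r + f}. *)
Definition positroid_cell (R : realType) (r n : nat) (f : int -> int)
    (V : 'M[R]_(r, n)) : Prop :=
  [/\ affine_perm n r (n - r)%N f,
      Gr_ge0 V
    & forall a b : int, a < b ->
        ([set i : int | (i < a) && (a <= f i + r%:Z < b)]
           #= `I_(\rank (col_window V a b)))%card].

(* Gr_{>= m}(r, n), for m <= n - r. *)
Definition Gr_ge (R : realType) (m r n : nat) (V : 'M[R]_(r, n)) : Prop :=
  exists f : int -> int,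
    affine_perm n r (n - r - m)%N f /\ positroid_cell f V.

Definition dotv (R : realType) (p : nat) (x y : 'cV[R]_p) : R :=
  \sum_i x i 0 * y i 0.

Definition stack (R : realType) (k l n : nat)
    (V : 'M[R]_(k, n)) (W : 'M[R]_(l, n)) : 'M[R]_(k + l, n) :=
  col_mx V W.

(* U(j), with U(j + n) = (-1)^(k - 1) U(j); here j - 1 = q n + c, 0 <= c < n,
   and the exponents are integers, as k may be 0. *)
Definition colU (R : realType) (k l n : nat)
    (U : 'M[R]_(k + l, n)) (j : int) : 'cV[R]_(k + l) :=
  ((-1) ^ ((k%:Z - 1) * ((j - 1) %/ n%:Z)%Z)) *: colz U j.

Definition Mat_circ (R : realType) (k l n : nat)
    (U : 'M[R]_(k + l, n)) : Prop :=
  forall j : int,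
    basis_of fullv [seq colU U (j - l%:Z + t%:Z) | t <- iota 0 (k + l)].

(* x is a possible value of U~(j).  The conditions at i = j - l and at
   j - l < i <= j + k - 1 are merged into one; this only makes a difference
   for k + l = 0, where there is no condition at all and U~(j) is the only
   vector of R^0. *)
Definition is_twist_col (R : realType) (k l n : nat)
    (U : 'M[R]_(k + l, n)) (j : int) (x : 'cV[R]_(k + l)) : Prop :=
  forall i : int, j - l%:Z <= i <= j + k%:Z - 1 ->
    dotv x (colU U i) = if i == j - l%:Z then (-1) ^ j else 0.

Definition twist_col (R : realType) (k l n : nat)
    (U : 'M[R]_(k + l, n)) (j : int) : 'cV[R]_(k + l) :=
  xget 0 [set x | is_twist_col U j x].

Definition tau (R : realType) (k l n : nat)
    (U : 'M[R]_(k + l, n)) : 'M[R]_(k + l, n) :=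
  \matrix_(i, c) twist_col U ((c : nat)%:Z + 1) i 0.

Definition theta (R : realType) (k l n : nat)
    (V : 'M[R]_(k, n)) (W : 'M[R]_(l, n)) :
    'M[R]_(k, n) * 'M[R]_(l, n) :=
  (usubmx (tau (stack V W)), dsubmx (tau (stack V W))).

(* Main.v *)
(* Let Z represent the orthogonal complement of W, so that Z has positive
   maximal minors, and let p_j = Ut(j)^T U.  The entry p_j(i) vanishes for
   j - l < i < j + k, hence Z p_j = Z V^T Wt(j) lies both in the span Y of Z V^T
   and in the span of the m + 1 consecutive columns Z(j + k), ..., Z(j + k + m).
   Thus, up to positive factors and the sign (-1)^j, Wt(j) is the column of a
   matrix T(V, Z) which is rational in (V, Z).  Dually Vt is T(alt W, alt V^perp)
   up to positive factors and a global sign, where alt multiplies the column j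
   by (-1)^j and exchanges, by complementary minors, a totally positive space
   with the orthogonal complement of a totally positive space.

   It remains to see that T(V, Z) is totally positive when V and Z are; the
   boundary cases follow by taking limits.  The cyclically consecutive maximal
   minors of T(V, Z) never vanish, and a totally nonnegative matrix with this
   property is totally positive.  So total positivity of T cannot be lost along
   a path of totally positive pairs.  Such a path, polynomial in its parameter
   and built from the totally positive kernel q^((i-j)^2), joins any (V, Z) to
   the cyclically symmetric point, where T commutes with the rotation and has
   the same row span as V.

   The positroid cell of Vt is read off from the fact that Ut(a), ..., Ut(b - 1)
   span the orthogonal complement of U(b - l), ..., U(a + k - 1). *)

Require Import Defs.
From mathcomp Require Import all_boot all_order all_fingroup all_algebra.
From mathcomp Require Import boolp classical_sets cardinality reals trigo.
From mathcomp Require Import zify ring lra.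

Set Implicit Arguments.
Unset Strict Implicit.
Unset Printing Implicit Defensive.

Import Order.TTheory GRing.Theory Num.Theory.
Local Open Scope ring_scope.

(** * Cauchy-Binet positivity and the Gaussian kernel *)

(** Away from the symmetric point no minor of T is computed; only vanishing is controlled. A form
    killing k consecutive columns of T lifts to a form killing k + m consecutive columns of Z, hence
    is zero. This needs nonzero pivot determinants but no strict positivity of V, so the same
    criterion serves along the paths and after the limit. The bound defining Gr_{>= m} enters here:
    it gives rank k to every window of k + l columns of V, the complement of the window of m columns
    of Z in a pivot.

    The parity of m makes the signs (-1)^(k-1) and (-1)^(k+m-1) of the quasi-periodic extensions of
    V and Z agree, so both rotate together.

    Row operations bring in determinants of unknown sign. Positivity of T is therefore stated for
    products of two minors, and a representative with positive minors is chosen only at the end.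

    Paths are polynomial so that continuity reduces to the least root of a polynomial and the
    intermediate value theorem. *)

Definition incr (k n : nat) (g : 'I_k -> 'I_n) := {homo g : i j / (i < j)%N}.

Lemma incr_inj k n (g : 'I_k -> 'I_n) : incr g -> injective g.
Proof.
move=> gi i j eqg; apply: val_inj; apply/eqP; rewrite eqn_leq.
case: ltngtP => // /gi; rewrite eqg ltnn //.
Qed.

Lemma injective_sort (k n : nat) (f : 'I_k -> 'I_n) : injective f ->
  exists s : 'S_k, incr (f \o s).
Proof.
move=> finj.
pose le (x y : 'I_n) := (x <= y)%N.
have sz : size (sort le (codom f)) == k by rewrite size_sort size_codom card_ord.
have /tuple_permP[s sE] : perm_eq (Tuple sz) [tuple f i | i < k].
  rewrite /= perm_sort.
  by rewrite codomE.
exists s => i j ltij /=.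
have srt : sorted (fun x y : 'I_n => (x < y)%N) (Tuple sz).
  have -> : sorted (fun x y : 'I_n => (x < y)%N) (Tuple sz) =
    sorted ltn (map val (Tuple sz)) by rewrite sorted_map.
  rewrite ltn_sorted_uniq_leq; apply/andP; split.
    rewrite (map_inj_uniq val_inj) /= sort_uniq /codom /image_mem.
    by rewrite map_inj_uniq // enum_uniq.
  rewrite sorted_map /=; apply: sort_sorted => x y; exact: leq_total.
have /(_ (f i)) nthE : forall x0 (a : 'I_k), nth x0 (Tuple sz) a = f (s a).
  by move=> x0 a; rewrite sE -tnth_nth tnth_mktuple tnth_mktuple.
rewrite -[f (s i)]nthE -[f (s j)]nthE.
apply: (sorted_ltn_nth _ _ srt) => //.
- by move=> x y z; apply: ltn_trans.
- by rewrite inE /= size_sort size_codom card_ord.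
- by rewrite inE /= size_sort size_codom card_ord.
Qed.

Section CauchyBinet.
Variables (R : comNzRingType) (k n : nat).
Implicit Types (A : 'M[R]_(k, n)) (B : 'M[R]_(n, k)).

(** Multilinearity in the columns of the product, without grouping the maps by their image. This
    form is used on its own when the factors [B (f t) t] are zero or one and select increasing
    maps. *)
Lemma det_mulmx_ffun A B :
  \det (A *m B) =
    \sum_(f : {ffun 'I_k -> 'I_n}) (\prod_t B (f t) t) * \det (colsub f A).
Proof.
rewrite -det_tr /determinant.
transitivity (\sum_(s : 'S_k) \sum_(f : {ffun 'I_k -> 'I_n})
   (-1) ^+ s * \prod_t (A (s t) (f t) * B (f t) t)).
  apply: eq_bigr => s _; rewrite -big_distrr /=; congr (_ * _).
  rewrite -(bigA_distr_bigA (fun t u => A (s t) u * B u t)) /=.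
  by apply: eq_bigr => t _; rewrite !mxE.
rewrite exchange_big /=; apply: eq_bigr => f _.
rewrite -[\sum_(s : 'S_k) _ in RHS]/(\det (colsub f A)) -det_tr big_distrr /=.
apply: eq_bigr => s _; rewrite big_split /= mulrA [RHS]mulrC; congr (_ * _ * _).
by apply: eq_bigr => t _; rewrite !mxE.
Qed.

Lemma det_colsub_perm A (f : 'I_k -> 'I_n) (s : 'S_k) :
  \det (colsub (f \o s) A) = (-1) ^+ s * \det (colsub f A).
Proof.
rewrite colsub_comp -col_permEsub col_permE det_mulmx det_perm mulrC.
by rewrite odd_permV.
Qed.

Lemma det_rowsub_perm B (f : 'I_k -> 'I_n) (s : 'S_k) :
  \det (rowsub (f \o s) B) = (-1) ^+ s * \det (rowsub f B).
Proof. by rewrite rowsub_comp -row_permEsub row_permE det_mulmx det_perm. Qed.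

Lemma det_colsub_noninj A (f : 'I_k -> 'I_n) :
  ~~ injectiveb f -> \det (colsub f A) = 0.
Proof.
case/injectivePn => i [j neij eqf].
rewrite -det_tr; apply: (determinant_alternate neij) => t.
by rewrite !mxE eqf.
Qed.

(* Symmetrized over all maps, so that no sorting of index sets is needed. *)
Lemma cauchy_binet_ffun A B :
  \det (A *m B) *+ k`! =
  \sum_(f : {ffun 'I_k -> 'I_n}) \det (colsub f A) * \det (rowsub f B).
Proof.
transitivity (\sum_(s : 'S_k) \sum_(f : {ffun 'I_k -> 'I_n})
    ((-1) ^+ s * \prod_t B (f (s t)) t) * \det (colsub f A)).
  rewrite -card_Sn -sumr_const (eq_bigl xpredT); last by move=> s; rewrite inE.
  apply: eq_bigr => s _; rewrite det_mulmx_ffun.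
  rewrite (reindex_onto (fun f : {ffun 'I_k -> 'I_n} => [ffun t => f (s t)])
     (fun f => [ffun t => f (s^-1%g t)])) /=; last first.
    by move=> f _; apply/ffunP => t; rewrite !ffunE permK.
  rewrite (eq_bigl xpredT) /=; last first.
    move=> f; apply/eqP/ffunP => t; by rewrite !ffunE permKV.
  apply: eq_bigr => f _.
  have -> : colsub [ffun t => f (s t)] A = colsub (f \o s) A.
    by apply/matrixP => a b; rewrite !mxE ffunE.
  rewrite det_colsub_perm mulrA [X in X * _ = _]mulrC; congr (_ * _ * _).
  by apply: eq_bigr => t _; rewrite ffunE.
rewrite exchange_big /=; apply: eq_bigr => f _.
rewrite -big_distrl /= mulrC; congr (_ * _).
rewrite -det_tr /determinant; apply: eq_bigr => s _; congr (_ * _).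
by apply: eq_bigr => t _; rewrite !mxE.
Qed.

End CauchyBinet.

Section Positivity.
Variables (R : realDomainType).

Definition minors_ge0 (k n : nat) (A : 'M[R]_(k, n)) :=
  forall g : 'I_k -> 'I_n, incr g -> 0 <= \det (colsub g A).
Definition minors_gt0 (k n : nat) (A : 'M[R]_(k, n)) :=
  forall g : 'I_k -> 'I_n, incr g -> 0 < \det (colsub g A).

Lemma minors_gt0W k n (A : 'M[R]_(k, n)) : minors_gt0 A -> minors_ge0 A.
Proof. by move=> pA g /pA/ltW. Qed.

(** Sorting an index map changes the two minors by the same sign, so all terms of the symmetrized
    formula are nonnegative as soon as the sorted ones are; one nonzero term then gives strict
    positivity. *)
Lemma det_mulmx_ge0 k n (A : 'M[R]_(k, n)) (B : 'M[R]_(n, k)) :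
  (forall g : 'I_k -> 'I_n, incr g ->
     0 <= \det (colsub g A) * \det (rowsub g B)) ->
  0 <= \det (A *m B) /\
  forall g : 'I_k -> 'I_n, incr g ->
    \det (colsub g A) * \det (rowsub g B) != 0 -> 0 < \det (A *m B).
Proof.
move=> pAB.
have term_ge0 (f : {ffun 'I_k -> 'I_n}) :
    0 <= \det (colsub f A) * \det (rowsub f B).
  case: (boolP (injectiveb f)) => [/injectiveP/injective_sort[s si]|ninj]; last first.
    by rewrite det_colsub_noninj // mul0r.
  have := pAB _ si; rewrite det_colsub_perm det_rowsub_perm mulrACA -expr2.
  by rewrite sqrr_sign mul1r.
have cb := cauchy_binet_ffun A B.
have k0 : (0 < k`!)%N by rewrite fact_gt0.
split.
  by rewrite -(pmulrn_lge0 _ k0) cb sumr_ge0.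
move=> g gi gn0; rewrite -(pmulrn_lgt0 _ k0) cb.
rewrite (bigD1 [ffun t => g t]) //= ltr_pwDl ?sumr_ge0 //.
have -> : colsub [ffun t => g t] A = colsub g A.
  by apply/matrixP => a b; rewrite !mxE ffunE.
have -> : rowsub [ffun t => g t] B = rowsub g B.
  by apply/matrixP => a b; rewrite !mxE ffunE.
by rewrite lt_def gn0 pAB.
Qed.

End Positivity.

(* Subtracting consecutive columns turns the determinant into a positive
   multiple of a sum of generalized Vandermonde determinants of smaller size. *)
Lemma det_gen_vandermonde_gt0 (R : realFieldType) (q : R) : 1 < q ->
  forall (k : nat) (e j : 'I_k -> nat),
  {homo e : a b / (a < b)%N} -> {homo j : a b / (a < b)%N} ->
  0 < \det (\matrix_(s, t) q ^+ (e s * j t)).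
Proof.
move=> q1; have q0 : 0 < q := lt_trans ltr01 q1.
elim=> [|k IHk] e j he hj; first by rewrite det_mx00.
set A := \matrix_(s, t) _.
(* Dividing column t by [q ^+ (e ord0 * j t)] makes the first row constantly 1, so that column
   differences leave only its first entry. *)
pose d (s : 'I_k.+1) := (e s - e ord0)%N.
have e0 s : (e ord0 <= e s)%N.
  by case: (unliftP ord0 s) => [s' ->|-> //]; apply/ltnW/he.
pose A' := \matrix_(s < k.+1, t < k.+1) q ^+ (d s * j t).
have AE : A = A' *m diag_mx (\row_t q ^+ (e ord0 * j t)).
  apply/matrixP => s t; rewrite mul_mx_diag !mxE -exprD -mulnDl.
  by rewrite subnK.
pose U := \matrix_(u < k.+1, t < k.+1) (((u == t)%:R - (u.+1 == t :> nat)%:R) : R).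
have detU : \det U = 1.
  rewrite -det_tr det_trig.
    by rewrite big1 // => i _; rewrite !mxE eqxx gtn_eqF ?subr0.
  apply/is_trig_mxP => a b ltab; rewrite !mxE.
  rewrite (gtn_eqF (ltnW _)) // subr0.
  by rewrite -val_eqE /= gtn_eqF.
have A'U s (t : 'I_k) : (A' *m U) s (lift ord0 t) =
    q ^+ (d s * j (lift ord0 t)) - q ^+ (d s * j (widen_ord (leqnSn k) t)).
  rewrite mxE; under eq_bigr do rewrite !mxE mulrBr.
  rewrite sumrB; congr (_ - _).
    rewrite (bigD1 (lift ord0 t)) //= eqxx mulr1 big1 ?addr0 // => u /negbTE ->.
    by rewrite mulr0.
  rewrite (bigD1 (widen_ord (leqnSn k) t)) //= eqxx mulr1 big1 ?addr0 // => u.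
  by rewrite -val_eqE /= /bump /= add1n eqSS => /negbTE ->; rewrite mulr0.
have d0 : d ord0 = 0%N by rewrite /d subnn.
have -> : \det A = \det A' * \prod_t q ^+ (e ord0 * j t).
  by rewrite AE det_mulmx det_diag; congr (_ * _); apply: eq_bigr => t _; rewrite mxE.
rewrite pmulr_lgt0; last by apply: prodr_gt0 => t _; rewrite exprn_gt0.
rewrite -[\det A']mulr1 -detU -det_mulmx (expand_det_row _ ord0) big_ord_recl.
rewrite big1 ?addr0; last first.
  by move=> t _; rewrite A'U d0 !mul0n subrr mul0r.
have -> : (A' *m U) ord0 ord0 = 1.
  rewrite mxE (bigD1 ord0) //= big1 ?addr0.
    by rewrite !mxE eqxx d0 mul0n subr0 mulr1.
  by move=> u /negbTE u0; rewrite !mxE u0 subrr mulr0.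
rewrite mul1r /cofactor addn0 expr0 mul1r.
set D := row' _ _.
pose N := j ord_max.
have jN t : (j t <= N)%N.
  case: (ltngtP t (@ord_max k)) => [/hj/ltnW //||/val_inj -> //].
  by rewrite ltnNge -ltnS ltn_ord.
pose wid t := widen_ord (leqnSn k) t.
pose C := \matrix_(s < k, y < N) q ^+ (d (lift ord0 s) * y).
pose I := \matrix_(y < N, t < k) (j (wid t) <= y < j (lift ord0 t))%N%:R : 'M[R]_(N, k).
have jlt t : (j (wid t) < j (lift ord0 t))%N by apply: hj.
(* Each entry x^j' - x^j is x - 1 times the geometric sum over the exponents y with j <= y < j';
   this factors the block through the interval matrix [I]. *)
have DE : D = diag_mx (\row_s (q ^+ d (lift ord0 s) - 1)) *m (C *m I).
  apply/matrixP => s t; rewrite /D [LHS]mxE [LHS]mxE A'U mul_diag_mx 3!mxE.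
  set x := q ^+ d (lift ord0 s).
  under eq_bigr do rewrite !mxE exprM -/x.
  rewrite !exprM -/x.
  transitivity ((x - 1) * \sum_(j (wid t) <= y < j (lift ord0 t)) x ^+ y).
    have geom n : (x - 1) * (\sum_(0 <= y < n) x ^+ y) = x ^+ n - 1.
      by rewrite [RHS]subrX1 big_mkord.
    have := geom (j (lift ord0 t)).
    rewrite (big_cat_nat (n := j (wid t))) //=; last exact: ltnW.
    rewrite mulrDr geom => h; apply: (addrI (x ^+ j (wid t) - 1)).
    by rewrite h /wid; ring.
  congr (_ * _).
  rewrite (big_nat_widen _ _ N) // -(big_mkord (fun _ => true)
    (fun y => x ^+ y * (j (wid t) <= y < j (lift ord0 t))%N%:R)).
  rewrite [in RHS](big_cat_nat (n := j (wid t))) //=.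
  rewrite [X in _ = X + _]big_nat_cond [X in _ = X + _]big1 ?add0r; last first.
    by move=> i /andP[/andP[_ lti] _]; rewrite leqNgt lti mulr0.
  rewrite big_mkcond /= big_nat_cond [RHS]big_nat_cond; apply: eq_bigr => i.
  move=> /andP[/andP[lei _] _]; rewrite lei /=.
  by case: ifP; rewrite ?mulr1 ?mulr0.
rewrite DE det_mulmx det_diag mulr_gt0 //.
  apply: prodr_gt0 => s _; rewrite mxE subr_gt0 exprn_egt1 // -lt0n subn_gt0.
  exact: he.
rewrite det_mulmx_ffun.
(* A nonzero term picks one exponent in each interval. The intervals are disjoint and ordered, so
   the choice is strictly increasing and the induction hypothesis applies. *)
have term f : 0 <= \prod_t I (f t) t * \det (colsub f C) /\
    ((forall t, j (wid t) <= f t < j (lift ord0 t))%N ->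
      0 < \prod_t I (f t) t * \det (colsub f C)).
  case: (boolP [forall t, (j (wid t) <= f t < j (lift ord0 t))%N]).
    move=> /forallP ft.
    suff pos : 0 < \prod_t I (f t) t * \det (colsub f C) by split=> //; apply: ltW.
    rewrite big1 ?mul1r; last by move=> t _; rewrite mxE ft.
    have -> : colsub f C = \matrix_(s, t) q ^+ (d (lift ord0 s) * f t).
      by apply/matrixP => a b; rewrite !mxE.
    apply: IHk => a b ltab.
      by rewrite /d ltn_sub2r ?he // (leq_ltn_trans (e0 (lift ord0 a))) ?he.
    have /andP[_ h1] := ft a; have /andP[h2 _] := ft b.
    apply: leq_trans h1 (leq_trans _ h2).
    case: (ltngtP (lift ord0 a) (wid b)) => [/hj/ltnW //||/val_inj -> //].
    by rewrite /= /bump /= add1n ltnS leqNgt ltab.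
  rewrite negb_forall => /existsP[t tn]; split.
    by rewrite (bigD1 t) //= mxE (negbTE tn) !mul0r.
  by move=> /(_ t) h; rewrite h in tn.
have jf t : (j (wid t) < N)%N by apply: leq_trans (jlt t) (jN _).
rewrite (bigD1 [ffun t => Ordinal (jf t)]) //= ltr_pwDl ?sumr_ge0 //.
  by apply: (term _).2 => t; rewrite ffunE /= leqnn jlt.
by move=> f _; apply: (term f).1.
Qed.

(** Truncated subtraction makes the base of the exponent equal to |i - j|. *)
Definition gauss_mx (R : nzRingType) (q : R) n : 'M[R]_n :=
  \matrix_(i, j) q ^+ (((i - j) + (j - i)) ^ 2).

Lemma gauss_mx0 (R : nzRingType) n : gauss_mx (0 : R) n = 1%:M.
Proof.
apply/matrixP => i j; rewrite !mxE -val_eqE /= expr0n; congr (_%:R).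
by rewrite expn_eq0 andbT addn_eq0 !subn_eq0 -eqn_leq.
Qed.

(** Since (i - j)^2 = i^2 + j^2 - 2ij, diagonal scalings turn the minor into a generalized
    Vandermonde determinant with base q^(-2) > 1. *)
Lemma gauss_mx_minor_gt0 (R : realFieldType) (q : R) n k (f g : 'I_k -> 'I_n) :
  0 < q < 1 -> incr f -> incr g -> 0 < \det (mxsub f g (gauss_mx q n)).
Proof.
move=> /andP[q0 q1] fi gi.
have -> : mxsub f g (gauss_mx q n) =
  diag_mx (\row_s q ^+ (f s ^ 2)) *m
   (\matrix_(s, t) (q^-1 ^+ 2) ^+ (f s * g t)) *m diag_mx (\row_t q ^+ (g t ^ 2)).
  apply/matrixP => s t; rewrite mul_mx_diag [RHS]mxE mul_diag_mx !mxE.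
  rewrite -exprM exprVn mulrAC -exprD; apply: (canRL (mulfK _)).
    by rewrite expf_neq0 // gt_eqF.
  rewrite -exprD; congr (_ ^+ _).
  by move: (f s : nat) (g t : nat) => a b; nia.
rewrite !det_mulmx !det_diag; apply: mulr_gt0; last first.
  by apply: prodr_gt0 => i _; rewrite mxE exprn_gt0.
apply: mulr_gt0; first by apply: prodr_gt0 => i _; rewrite mxE exprn_gt0.
apply: det_gen_vandermonde_gt0 => //.
by rewrite exprn_egt1 // invf_gt1.
Qed.

Lemma row_free_minorP (F : fieldType) k n (A : 'M[F]_(k, n)) :
  reflect (exists2 f : 'I_k -> 'I_n, incr f & \det (colsub f A) != 0) (row_free A).
Proof.
apply: (iffP idP) => [fA|[f _ fn0]]; last first.
  rewrite -row_leq_rank -[leqLHS](_ : \rank (colsub f A) = k).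
    by rewrite -[A in colsub _ A]mulmx1 -mulmx_colsub mxrankM_maxl.
  by apply: mxrank_unit; rewrite unitmxE unitfE.
have fT : row_full A^T by rewrite /row_full mxrank_tr.
pose f : 'I_k -> 'I_n := fullrankfun fT.
have [s si] := injective_sort (@fullrankfun_inj _ _ _ _ fT : injective f).
exists (f \o s) => //.
rewrite det_colsub_perm mulf_neq0 ?signr_eq0 // -det_tr trmx_mxsub.
by have := fullrowsub_unit fT; rewrite unitmxE unitfE.
Qed.

Lemma minors_mulmx_gauss_gt0 (R : realFieldType) (q : R) k n (A : 'M[R]_(k, n)) :
  0 < q < 1 -> minors_ge0 A -> row_free A -> minors_gt0 (A *m gauss_mx q n).
Proof.
move=> q01 pA fA g gi.
rewrite -mulmx_colsub.
have /row_free_minorP[f fi fn0] := fA.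
have rE (h : 'I_k -> 'I_n) : rowsub h (colsub g (gauss_mx q n)) = mxsub h g (gauss_mx q n).
  by apply/matrixP => a b; rewrite !mxE.
have [|_ pos] := @det_mulmx_ge0 _ _ _ A (colsub g (gauss_mx q n)).
  by move=> h hi; rewrite mulr_ge0 ?pA // rE ltW // gauss_mx_minor_gt0.
by apply: (pos _ fi); rewrite mulf_neq0 // rE gt_eqF // gauss_mx_minor_gt0.
Qed.

(** * Total nonnegativity and cyclic rotation *)

Section QuasiPeriodic.
Variable R : comNzRingType.

(* Columns are extended to all of nat by A(x + n) = e * A(x). *)
Definition qcol (e : R) r n (A : 'M[R]_(r, n.+1)) (x : nat) : 'cV[R]_r :=
  e ^+ (x %/ n.+1) *: col (inord (x %% n.+1)) A.

Definition qwin (e : R) r n (A : 'M[R]_(r, n.+1)) (x m : nat) : 'M[R]_(r, m) :=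
  \matrix_(i, t) qcol e A (x + t) i 0.

Definition qshift (e : R) r n (A : 'M[R]_(r, n.+1)) (y : nat) : 'M[R]_(r, n.+1) :=
  qwin e A y n.+1.

Lemma qcol_small e r n (A : 'M[R]_(r, n.+1)) (c : 'I_n.+1) : qcol e A c = col c A.
Proof. by rewrite /qcol divn_small ?modn_small // scale1r inord_val. Qed.

Lemma qcolDn e r n (A : 'M[R]_(r, n.+1)) x : qcol e A (x + n.+1) = e *: qcol e A x.
Proof. by rewrite /qcol modnDr divnDr ?divnn // addn1 exprS scalerA. Qed.

Lemma qcolDMn e r n (A : 'M[R]_(r, n.+1)) x d :
  qcol e A (x + d * n.+1) = e ^+ d *: qcol e A x.
Proof.
elim: d => [|d IHd]; first by rewrite addn0 scale1r.
by rewrite mulSnr addnA qcolDn IHd exprS scalerA.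
Qed.

Lemma qcol_shift e r n (A : 'M[R]_(r, n.+1)) y x :
  qcol e (qshift e A y) x = qcol e A (y + x).
Proof.
rewrite [in RHS](divn_eq x n.+1) [(_ * _ + _)%N]addnC addnA qcolDMn.
congr (_ *: _); apply/colP => i.
by rewrite !mxE inordK ?ltn_pmod.
Qed.

Lemma qshiftD e r n (A : 'M[R]_(r, n.+1)) y z :
  qshift e (qshift e A y) z = qshift e A (y + z).
Proof. by apply/matrixP => i c; rewrite [LHS]mxE [RHS]mxE qcol_shift addnA. Qed.

Lemma qshift0 e r n (A : 'M[R]_(r, n.+1)) : qshift e A 0 = A.
Proof. by apply/matrixP => i c; rewrite mxE qcol_small mxE. Qed.

Lemma mulmx_qcol e r s n (B : 'M[R]_(s, r)) (A : 'M[R]_(r, n.+1)) x :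
  qcol e (B *m A) x = B *m qcol e A x.
Proof. by rewrite /qcol -scalemxAr colE colE mulmxA. Qed.

End QuasiPeriodic.

Section Insertion.
Variable R : comNzRingType.

Definition ins k n (i : 'I_k.+1) (y : 'I_n) (p : 'I_k -> 'I_n) (s : 'I_k.+1) :=
  if unlift i s is Some j then p j else y.

Lemma ins_lift k n (i : 'I_k.+1) (y : 'I_n) p j : ins i y p (lift i j) = p j.
Proof. by rewrite /ins liftK. Qed.

Lemma ins_self k n (i : 'I_k.+1) (y : 'I_n) p : ins i y p i = y.
Proof. by rewrite /ins unlift_none. Qed.

Lemma incr_ins k n (i : 'I_k.+1) (y : 'I_n) (p : 'I_k -> 'I_n) :
  incr p -> (forall j : 'I_k, (j < i)%N -> (p j < y)%N) ->
  (forall j : 'I_k, (i <= j)%N -> (y < p j)%N) -> incr (ins i y p).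
Proof.
move=> pi lo hi a b.
case: (unliftP i a) => [a' ->|->]; case: (unliftP i b) => [b' ->|->];
  rewrite ?ins_lift ?ins_self ?ltnn //=; rewrite /bump.
- by move=> ltab; apply: pi; move: ltab; case: leqP; case: leqP => /=; lia.
- by move=> ltab; apply: lo; move: ltab; case: leqP => /=; lia.
- by move=> ltab; apply: hi; move: ltab; case: leqP => /=; lia.
Qed.

(* The functional v |-> det (v, columns of A along p). *)
Definition minor_form k n (A : 'M[R]_(k.+1, n)) (p : 'I_k -> 'I_n) : 'rV[R]_k.+1 :=
  \row_r ((-1) ^+ r * \det (row' r (colsub p A))).

Lemma det_ins k n (A : 'M[R]_(k.+1, n)) (i : 'I_k.+1) (y : 'I_n) p :
  \det (colsub (ins i y p) A) = (-1) ^+ i * (minor_form A p *m A) 0 y.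
Proof.
rewrite (expand_det_col _ i) mxE big_distrr /=; apply: eq_bigr => r _.
rewrite !mxE ins_self /cofactor exprD.
have -> : row' r (col' i (colsub (ins i y p) A)) = row' r (colsub p A).
  by apply/matrixP => a b; rewrite !mxE ins_lift.
by rewrite mulrC [(-1) ^+ r * _]mulrC -!mulrA.
Qed.

Lemma minor_form_self k n (A : 'M[R]_(k.+1, n)) p j :
  (minor_form A p *m A) 0 (p j) = 0.
Proof.
rewrite -[LHS]mul1r -(expr0 (-1)) -[0%N]/(nat_of_ord (ord0 : 'I_k.+1)) -det_ins.
apply: det_colsub_noninj; apply/injectivePn; exists ord0, (lift ord0 j) => //.
by rewrite ins_self ins_lift.
Qed.

End Insertion.

Section SignedMinors.
Variable R : realFieldType.

(* The final s stands for: up to a common sign. *)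
Definition minors_ge0s (k n : nat) (A : 'M[R]_(k, n)) :=
  forall g h : 'I_k -> 'I_n, incr g -> incr h ->
  0 <= \det (colsub g A) * \det (colsub h A).
Definition minors_gt0s (k n : nat) (A : 'M[R]_(k, n)) :=
  forall g h : 'I_k -> 'I_n, incr g -> incr h ->
  0 < \det (colsub g A) * \det (colsub h A).

(** Nonvanishing of the cyclically consecutive maximal minors. In terms of linear forms, the signs
    of the quasi-periodic extension do not matter and wrapped windows need no sorting. *)
Definition cyc_free (k n : nat) (A : 'M[R]_(k, n.+1)) :=
  forall (x : nat) (a : 'rV[R]_k),
  (forall t, (t < k)%N -> (a *m A) 0 (inord ((x + t) %% n.+1)) = 0) -> a = 0.

Lemma det_neq0P k (A : 'M[R]_k) :
  reflect (forall a : 'rV[R]_k, a *m A = 0 -> a = 0) (\det A != 0).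
Proof.
apply: (iffP idP) => [dA a aA|h].
  by apply/eqP; apply: contraNT dA => a0; apply/det0P; exists a.
by apply/negP => /det0P[v v0 /h vE]; rewrite vE eqxx in v0.
Qed.

(* Suppose that a <> 0 vanishes on a window of A around its deleted last column.
   The forms E q of the two windows with one endpoint removed are then nonzero
   multiples of a.  Their product has opposite signs in the last column and in
   the columns z outside the window, so a vanishes on all those z. *)
Lemma cyc_free_delete k n (A : 'M[R]_(k.+1, n.+2)) : (k <= n)%N ->
  minors_ge0s A -> cyc_free A ->
  cyc_free (colsub (widen_ord (leqnSn n.+1)) A).
Proof.
move=> lekn pA cA x0 a; set A' := colsub _ A.
pose y := (x0 %% n.+1)%N => h.
have {h} h t : (t < k.+1)%N -> (a *m A) 0 (inord ((y + t) %% n.+1)) = 0.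
  move=> ltt; have := h t ltt; rewrite -modnDml -/y mulmx_colsub mxE /= => <-.
  congr ((a *m A) _ _); apply: val_inj; rewrite /= !inordK ?ltn_pmod //.
  by rewrite ltnW // ltnS ltn_pmod.
have yn : (y < n.+1)%N by rewrite ltn_pmod.
case: (leqP (y + k.+1) n.+1) => [yk|yk].
  apply: (cA y) => t ltt; rewrite -[RHS](h t ltt).
  by rewrite !modn_small //; lia.
pose p := (n.+1 - y)%N.
have [p0 pk] : (0 < p)%N /\ (p <= k)%N by rewrite /p; lia.
have zhi c : (y <= c < n.+1)%N -> (a *m A) 0 (inord c) = 0.
  move=> cy; have := h (c - y)%N; rewrite subnKC; last by lia.
  by rewrite modn_small; [apply; lia|lia].
have zlo c : (c <= k - p)%N -> (a *m A) 0 (inord c) = 0.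
  move=> cy; have := h (c + p)%N; rewrite (_ : (y + (c + p) = c + n.+1)%N); last by rewrite /p; lia.
  by rewrite modnDr modn_small; [apply; lia|lia].
case: (eqVneq ((a *m A) 0 ord_max) 0) => [aN|aN].
  apply: (cA y) => t ltt.
  case: (ltngtP (y + t) n.+1) => yt.
  - by rewrite modn_small ?zhi //; lia.
  - rewrite (_ : (y + t = (t - p.+1) + n.+2)%N); last by rewrite /p; lia.
    rewrite modnDr modn_small; last by lia.
    by rewrite zlo //; lia.
  - rewrite yt modn_small // -[RHS]aN; congr ((a *m A) _ _).
    by apply: val_inj; rewrite /= inordK.
(* The first q and the last k - q remaining columns: together with [ord_max] they form a cyclic
   window of A. For q = k - p the column k - p of the given window is omitted, for q = k - p + 1 the
   column y. *)
pose f q (j : 'I_k) : 'I_n.+2 := inord (if (j < q)%N then j : nat else (j + (n.+1 - k))%N).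
have fE q (j : 'I_k) : f q j = (if (j < q)%N then j : nat else (j + (n.+1 - k))%N) :> nat.
  by rewrite inordK //; have := ltn_ord j; case: ifP; lia.
have fi q : incr (f q).
  by move=> i j ltij; rewrite !fE; have := ltn_ord j; do 2!case: ifP; lia.
have free q (b : 'rV_k.+1) : q \in [:: (k - p)%N; (k - p).+1] -> (b *m A) 0 ord_max = 0 ->
    (forall j, (b *m A) 0 (f q j) = 0) -> b = 0.
  move=> qE bN bf; apply: (cA (n.+2 - (k.+1 - q))%N) => t ltt.
  have qk : (q <= k)%N by move: qE; rewrite !inE => /orP[]/eqP ->; lia.
  have bf' (j : nat) (jk : (j < k)%N) : (b *m A) 0 (f q (Ordinal jk)) = 0 by apply: bf.
  case: (ltngtP (n.+2 - (k.+1 - q) + t)%N n.+1) => tE.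
  - rewrite modn_small; last by lia.
    have jk : (q + t < k)%N by lia.
    rewrite -[RHS](bf' _ jk); congr ((b *m A) _ _); apply: val_inj.
    by rewrite /= fE /= inordK; [case: ifP; lia|lia].
  - rewrite (_ : (_ + t = (t - (k.+1 - q)) + n.+2)%N); last by lia.
    rewrite modnDr modn_small; last by lia.
    have jk : (t - (k.+1 - q) < k)%N by lia.
    rewrite -[RHS](bf' _ jk); congr ((b *m A) _ _); apply: val_inj.
    by rewrite /= fE /= inordK; [case: ifP; lia|lia].
  - rewrite tE modn_small // -[RHS]bN; congr ((b *m A) _ _).
    by apply: val_inj; rewrite /= inordK.
have af q j : q \in [:: (k - p)%N; (k - p).+1] -> (a *m A) 0 (f q j) = 0.
  move=> qE; rewrite /f; have := ltn_ord j; case: ifP => jq jk.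
    by rewrite zlo //; move: qE; rewrite !inE => /orP[]/eqP qE; lia.
  by rewrite zhi //; move: qE; rewrite !inE => /orP[]/eqP qE; rewrite /p in qE pk p0 *; lia.
pose E q := minor_form A (f q).
have Ea q : q \in [:: (k - p)%N; (k - p).+1] ->
    exists2 c, c != 0 & E q = c *: a.
  move=> qE; exists ((E q *m A) 0 ord_max / (a *m A) 0 ord_max); last first.
    apply/eqP; rewrite -subr_eq0; apply/eqP; apply: (free q) => //.
      by rewrite mulmxBl -scalemxAl mxE [X in _ + X]mxE [X in _ - X]mxE divfK ?subrr.
    move=> j; rewrite mulmxBl -scalemxAl mxE [X in _ + X]mxE [X in _ - X]mxE.
    by rewrite af // mulr0 minor_form_self subrr.
  rewrite mulf_neq0 ?invr_eq0 //.
  have : \det (colsub (ins ord_max ord_max (f q)) A) != 0.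
    apply/det_neq0P => b; rewrite mulmx_colsub => /rowP bA.
    apply: (free q) => //.
      by have := bA ord_max; rewrite !mxE ins_self.
    by move=> j; have := bA (lift ord_max j); rewrite !mxE ins_lift.
  by rewrite det_ins; apply: contraNneq => ->; rewrite mulr0.
have qE0 : (k - p)%N \in [:: (k - p)%N; (k - p).+1] by rewrite inE eqxx.
have qE1 : (k - p).+1 \in [:: (k - p)%N; (k - p).+1] by rewrite !inE eqxx orbT.
have [c c0 cE] := Ea _ qE0; have [c' c'0 c'E] := Ea _ qE1.
have sc (b : R) i : (b *: (a *m A)) 0 i = b * (a *m A) 0 i by rewrite mxE.
have cc' : 0 < c * c'.
  rewrite lt_def mulf_neq0 //=.
  have aN2 : 0 < (a *m A) 0 ord_max ^+ 2 by rewrite exprn_even_gt0.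
  rewrite -(pmulr_lge0 _ aN2).
  suff -> : c * c' * (a *m A) 0 ord_max ^+ 2 =
      \det (colsub (ins ord_max ord_max (f (k - p)%N)) A) *
      \det (colsub (ins ord_max ord_max (f (k - p).+1)) A).
    by apply: pA; apply: incr_ins => // j; rewrite ?fE;
      have := ltn_ord j; rewrite /=; case: ifP; lia.
  rewrite !det_ins -/(E _) -/(E _) cE c'E -!scalemxAl.
  rewrite !sc [RHS]mulrACA -expr2 sqrr_sign mul1r.
  by rewrite expr2 mulrACA.
(* Column z is inserted at position k - p in one minor and at k - p + 1 in the other, whereas
   [ord_max] is inserted at the end of both; hence the opposite sign. *)
have amid (z : nat) : (k - p < z < n.+1 - p)%N -> (a *m A) 0 (inord z) = 0.
  move=> zE; apply/eqP; rewrite -sqrf_eq0 eq_le sqr_ge0 andbT -(pmulr_rle0 _ cc').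
  have i0k : (k - p < k.+1)%N by lia.
  have i1k : ((k - p).+1 < k.+1)%N by lia.
  rewrite -oppr_ge0.
  suff -> : - (c * c' * (a *m A) 0 (inord z) ^+ 2) =
      \det (colsub (ins (Ordinal i0k) (inord z) (f (k - p)%N)) A) *
      \det (colsub (ins (Ordinal i1k) (inord z) (f (k - p).+1)) A).
    apply: pA; apply: incr_ins => // j; rewrite ?fE inordK /=; try lia;
      have := ltn_ord j; case: ifP; lia.
  rewrite !det_ins -/(E _) -/(E _) cE c'E -!scalemxAl.
  have sgE : (-1) ^+ (k - p) * (-1) ^+ (k - p).+1 = -1 :> R.
    by rewrite exprS mulrCA -expr2 sqrr_sign mulr1.
  by rewrite !sc [RHS]mulrACA sgE mulN1r expr2 mulrACA.
apply: (cA 0%N) => t ltt; rewrite add0n modn_small; last by lia.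
case: (leqP t (k - p)) => [|tlo]; first exact: zlo.
case: (ltnP t (n.+1 - p)) => [thi|thi]; first by apply: amid; lia.
by apply: zhi; rewrite /p in thi; lia.
Qed.
End SignedMinors.

(** Moving the first of k + 1 columns to the end is a cycle of sign (-1)^k, which the factor in the
    last column compensates. *)
Lemma det_cycle_cols (R : comNzRingType) k (M M' : 'M[R]_k.+1) :
  (forall i j, M' i (widen_ord (leqnSn k) j) = M i (lift ord0 j)) ->
  (forall i, M' i ord_max = (-1) ^+ k * M i ord0) -> \det M' = \det M.
Proof.
move=> ML M0; rewrite (expand_det_col M' ord_max) (expand_det_col M ord0).
apply: eq_bigr => i _; rewrite M0 /cofactor.
have -> : row' i (col' ord_max M') = row' i (col' ord0 M).
  apply/matrixP => a b; rewrite !mxE -ML; congr (M' _ _).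
  by apply: val_inj; rewrite /= /bump leqNgt ltn_ord.
rewrite addn0 exprD /=.
set s := (-1) ^+ k; have ss : s * s = 1 by rewrite -expr2 sqrr_sign.
set x := M i ord0; set z := (-1) ^+ i; set d := \det _.
have -> : s * x * (z * s * d) = (s * s) * (x * (z * d)) by ring.
by rewrite ss mul1r.
Qed.

Section Rotation.
Variables (k n : nat).

(** The image of g is that of h moved one step cyclically. When h reaches the last column, the
    wrapped column becomes the first one, and the positions rotate too in order to keep both maps
    increasing. *)
Definition rot_rel (g h : 'I_k.+1 -> 'I_n.+1) :=
  (forall s, g s = (h s).+1 :> nat) \/
  [/\ h ord_max = ord_max, g ord0 = ord0 &
      forall s, g (lift ord0 s) = (h (widen_ord (leqnSn k) s)).+1 :> nat].

Lemma qshift1E (R : comNzRingType) e r (A : 'M[R]_(r, n.+1)) i (c : 'I_n.+1) (d : 'I_n.+1) :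
  d = c.+1 :> nat -> qshift e A 1 i c = A i d.
Proof.
by move=> dE; rewrite !mxE add1n -dE divn_small ?modn_small // inord_val mul1r.
Qed.

Lemma qshift1_max (R : comNzRingType) e r (A : 'M[R]_(r, n.+1)) i :
  qshift e A 1 i ord_max = e * A i ord0.
Proof.
rewrite !mxE /= add1n divnn modnn expr1; congr (_ * A _ _).
by apply: val_inj; rewrite /= inordK.
Qed.

Lemma det_rot (R : comNzRingType) (A : 'M[R]_(k.+1, n.+1)) g h : rot_rel g h ->
  \det (colsub h (qshift ((-1) ^+ k) A 1)) = \det (colsub g A).
Proof.
case=> [gh|[hM g0 gh]].
  by congr (\det _); apply/matrixP => i j; rewrite mxE (qshift1E _ _ _ (gh j)) mxE.
apply: det_cycle_cols => [i j|i].
  by rewrite mxE (qshift1E _ _ _ (gh j)) mxE.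
by rewrite mxE hM qshift1_max mxE g0.
Qed.

Lemma rot_rel_exl (h : 'I_k.+1 -> 'I_n.+1) : incr h ->
  exists2 g, incr g & rot_rel g h.
Proof.
move=> hi; case: (ltngtP (h ord_max) n) => hM; last first.
- have hlt (j : 'I_k) : ((h (widen_ord (leqnSn k) j)).+1 < n.+1)%N.
    by rewrite ltnS; apply: (leq_trans (hi _ ord_max _)); rewrite ?hM /=.
  exists (fun s => if unlift ord0 s is Some j then
            inord (h (widen_ord (leqnSn k) j)).+1 else ord0).
    move=> a b; case: (unliftP ord0 a) => [a' ->|->];
      case: (unliftP ord0 b) => [b' ->|->]; rewrite ?liftK ?unlift_none //=.
      by rewrite !inordK // /bump /= !add1n !ltnS => ltab; apply: hi.
    by rewrite inordK.
  right; split; first exact: val_inj.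
    by rewrite unlift_none.
  by move=> s; rewrite liftK inordK.
- by have := ltn_ord (h ord_max); lia.
have hlt s : ((h s).+1 < n.+1)%N.
  rewrite ltnS; apply: leq_ltn_trans hM.
  case: (ltngtP s (@ord_max k)) => [/hi/ltnW //||/val_inj -> //].
  by rewrite /= ltnNge -ltnS ltn_ord.
exists (fun s => inord (h s).+1); last by left => s; rewrite inordK.
by move=> a b /hi ltab; rewrite !inordK.
Qed.

Lemma rot_rel_exr (g : 'I_k.+1 -> 'I_n.+1) : incr g ->
  exists2 h, incr h & rot_rel g h.
Proof.
move=> gi; case: (posnP (g ord0)) => g0; last first.
  have gs s : (0 < g s)%N.
    by case: (unliftP ord0 s) => [j ->|-> //]; apply: leq_ltn_trans (gi ord0 _ _).
  have lt s : ((g s).-1 < n.+1)%N by have := ltn_ord (g s); lia.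
  exists (fun s => inord (g s).-1); last first.
    by left => s; rewrite inordK // prednK.
  by move=> a b /gi ltab; rewrite !inordK //; have := gs a; lia.
have gs (s : 'I_k) : (0 < g (lift ord0 s))%N.
  by apply: leq_ltn_trans (gi ord0 _ _).
have lt s : ((g s).-1 < n.+1)%N by have := ltn_ord (g s); lia.
exists (fun s => if unlift ord_max s is Some j then
            inord (g (lift ord0 j)).-1 else ord_max).
  move=> a b; case: (unliftP ord_max a) => [a' ->|->];
    case: (unliftP ord_max b) => [b' ->|->]; rewrite ?liftK ?unlift_none //=.
  - rewrite !inordK // /bump /= !(leqNgt k) !ltn_ord !add0n => ltab.
    have := gs a'; have : (g (lift ord0 a') < g (lift ord0 b'))%N by apply: gi.
    by lia.
  - by rewrite inordK //; have := ltn_ord (g (lift ord0 a')); have := gs a'; lia.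
  - by rewrite /bump; have := ltn_ord b'; case: leqP => /=; lia.
  - by rewrite ltnn.
right; split; first by rewrite unlift_none.
  exact: val_inj.
move=> s; have -> : widen_ord (leqnSn k) s = lift ord_max s.
  by apply: val_inj; rewrite /= /bump leqNgt ltn_ord.
by rewrite liftK inordK // prednK.
Qed.

Lemma rot_rel_avoid (g h : 'I_k.+1 -> 'I_n.+1) (y z : 'I_n.+1) : rot_rel g h ->
  (forall s, g s != y) -> (y = z.+1 :> nat \/ (y = ord0 /\ z = ord_max)) ->
  forall s, h s != z.
Proof.
case=> [gh|[hM g0 gh]] gy yz s.
  case: yz => [yz|[y0 zM]].
    by have := gy s; rewrite -!val_eqE /= gh yz eqSS.
  by rewrite -val_eqE zM /=; have := ltn_ord (g s); rewrite gh; lia.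
case: (unliftP ord_max s) => [j ->|->]; last first.
  rewrite hM -val_eqE /=; case: yz => [yz|[y0 zM]].
    by have := ltn_ord y; rewrite yz; lia.
  by have := gy ord0; rewrite g0 y0 eqxx.
have -> : lift ord_max j = widen_ord (leqnSn k) j.
  by apply: val_inj; rewrite /= /bump leqNgt ltn_ord.
case: yz => [yz|[y0 zM]].
  by have := gy (lift ord0 j); rewrite -!val_eqE /= gh yz eqSS.
by have := ltn_ord (g (lift ord0 j)); rewrite gh -val_eqE zM /=; lia.
Qed.

End Rotation.

Section RotationMinors.
Variable R : realFieldType.

(* The sign (-1)^(k-1) makes Gr_{>=0}(k, n) invariant under rotation. *)
Definition rsign k : R := (-1) ^+ k.+1.

Lemma rsignS k : rsign k.+1 = (-1) ^+ k.
Proof. by rewrite /rsign !exprS !mulrA mulrNN !mul1r. Qed.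

Lemma rsign_sqr k : rsign k * rsign k = 1.
Proof. by rewrite /rsign -expr2 sqrr_sign. Qed.

Lemma rsign_neq0 k : rsign k != 0.
Proof. by rewrite signr_eq0. Qed.

Lemma minor_qshift k n y (g : 'I_k -> 'I_n.+1) : incr g ->
  exists2 h : 'I_k -> 'I_n.+1, incr h & forall A : 'M[R]_(k, n.+1),
    \det (colsub g (qshift (rsign k) A y)) = \det (colsub h A).
Proof.
case: k g => [|k] g gi.
  by exists g => // A; rewrite !det_mx00.
rewrite rsignS; elim: y g gi => [|y IHy] g gi.
  by exists g => // A; rewrite qshift0.
have [g' g'i gg'] := rot_rel_exl gi.
have [h hi hE] := IHy _ g'i; exists h => // A.
by rewrite -hE -(addn1 y) -qshiftD (det_rot _ gg').
Qed.

Lemma minors_ge0_qshift k n (A : 'M[R]_(k, n.+1)) y :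
  minors_ge0 A -> minors_ge0 (qshift (rsign k) A y).
Proof. by move=> pA g /(@minor_qshift _ _ y)[h hi ->]; apply: pA. Qed.

Lemma minors_gt0_qshift k n (A : 'M[R]_(k, n.+1)) y :
  minors_gt0 A -> minors_gt0 (qshift (rsign k) A y).
Proof. by move=> pA g /(@minor_qshift _ _ y)[h hi ->]; apply: pA. Qed.

Lemma minors_ge0s_qshift k n (A : 'M[R]_(k, n.+1)) y :
  minors_ge0s A -> minors_ge0s (qshift (rsign k) A y).
Proof.
move=> pA g g' /(@minor_qshift _ _ y)[h hi ->] /(@minor_qshift _ _ y)[h' h'i ->].
exact: pA.
Qed.

Lemma qcol_eq0P k n (A : 'M[R]_(k, n.+1)) (a : 'rV[R]_k) e x : e != 0 ->
  (a *m qcol e A x = 0) <-> (a *m A) 0 (inord (x %% n.+1)) = 0.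
Proof.
move=> e0; rewrite /qcol -scalemxAr; split=> [/eqP|h].
  rewrite scaler_eq0 expf_eq0 (negbTE e0) andbF /= => /eqP/matrixP/(_ 0 0).
  by rewrite colE mulmxA -colE !mxE.
by apply/matrixP => i j; rewrite colE mulmxA -colE !ord1 2!mxE h mxE mulr0.
Qed.

Lemma cyc_freeE k n (A : 'M[R]_(k, n.+1)) e : e != 0 ->
  cyc_free A <-> forall x (a : 'rV_k),
    (forall t, (t < k)%N -> a *m qcol e A (x + t) = 0) -> a = 0.
Proof.
move=> e0; split=> h x a ha; apply: (h x a) => t /ha.
  by rewrite (qcol_eq0P _ _ _ e0).
by move=> ?; apply/(qcol_eq0P _ _ _ e0).
Qed.

Lemma cyc_free_qshift k n (A : 'M[R]_(k, n.+1)) e y : e != 0 ->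
  cyc_free A -> cyc_free (qshift e A y).
Proof.
move=> e0 /(cyc_freeE _ e0) cA; apply/(cyc_freeE _ e0) => x a ha.
by apply: (cA (y + x)%N) => t /ha; rewrite qcol_shift addnA.
Qed.

Lemma minors_ge0s_colsub k n n' (A : 'M[R]_(k, n)) (f : 'I_n' -> 'I_n) :
  incr f -> minors_ge0s A -> minors_ge0s (colsub f A).
Proof.
move=> fi pA g h gi hi; rewrite -!colsub_comp.
by apply: pA => i j ltij; apply: fi; [apply: gi|apply: hi].
Qed.

(** Rotation carries the omitted column [y] down to the first column and then once more, onto the
    last one. *)
Lemma minors_neq0_avoid k n (A : 'M[R]_(k.+1, n.+1)) y (g : 'I_k.+1 -> 'I_n.+1) :
  (forall (B : 'M[R]_(k.+1, n.+1)) h, minors_ge0s B -> cyc_free B -> incr h ->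
    (forall s, h s != ord_max) -> \det (colsub h B) != 0) ->
  minors_ge0s A -> cyc_free A -> incr g -> (forall s, g s != y) ->
  \det (colsub g A) != 0.
Proof.
move=> last_case; move yE : (nat_of_ord y) => yn.
elim: yn y yE A g => [|yn IHy] y yE A g pA cA gi gy;
  have [h hi gh] := rot_rel_exr gi; rewrite -(det_rot _ gh) -rsignS.
  apply: last_case => //; first exact: minors_ge0s_qshift.
    by apply: cyc_free_qshift; rewrite ?rsign_neq0.
  by apply: (rot_rel_avoid gh gy); right; split=> //; apply: val_inj.
have yn1 : (yn < n.+1)%N by rewrite -ltnS -yE ltnW // ltnS ltn_ord.
apply: (IHy (Ordinal yn1)) => //; first exact: minors_ge0s_qshift.
  by apply: cyc_free_qshift; rewrite ?rsign_neq0.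
by apply: (rot_rel_avoid gh gy); left.
Qed.

Lemma incr_full n (g : 'I_n -> 'I_n) : incr g -> g =1 id.
Proof.
case: n g => [|n] g gi; first by case.
have lo : forall s : 'I_n.+1, (s <= g s)%N.
  move=> s; move: {2}(nat_of_ord s) (erefl (nat_of_ord s)) => m.
  elim: m s => [|m IHm] s sE; first by rewrite sE.
  have m1 : (m < n.+1)%N by rewrite -ltnS -sE ltnW // ltnS ltn_ord.
  by rewrite sE; apply: leq_ltn_trans (IHm (Ordinal m1) erefl) (gi _ _ _); rewrite /= sE.
move=> s; apply/val_inj/eqP; rewrite eqn_leq lo andbT /=.
have hi m : forall s : 'I_n.+1, (s + m = n)%N -> (g s + m <= n)%N.
  elim: m => [|m IHm] {}s sE; first by rewrite addn0 -ltnS.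
  have s1 : (s.+1 < n.+1)%N by lia.
  have s1n : (s.+1 + m = n)%N by lia.
  have := IHm (Ordinal s1) s1n.
  by have : (g s < g (Ordinal s1))%N by [apply: gi]; lia.
have sn : (s <= n)%N by rewrite -ltnS.
by have := hi (n - s)%N s (subnKC sn); lia.
Qed.

(* Deleting a column, which may be taken to be the last one by rotation,
   preserves both hypotheses. *)
Lemma minors_neq0 k n (A : 'M[R]_(k, n.+1)) : minors_ge0s A -> cyc_free A ->
  forall g, incr g -> \det (colsub g A) != 0.
Proof.
case: k A => [|k] A; first by move=> _ _ g _; rewrite det_mx00 oner_eq0.
elim: n A => [|n IHn] A pA cA g gi.
  have lek : (k.+1 <= 1)%N.
    by have := leq_card _ (incr_inj gi); rewrite !card_ord.
  case: k lek A pA cA g gi => // _ A pA cA g gi.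
  apply/det_neq0P => a; rewrite mulmx_colsub => /matrixP aA.
  apply: (cA 0%N) => t; rewrite ltnS leqn0 => /eqP ->.
  have := aA 0 0; rewrite !mxE => aA0; rewrite -[RHS]aA0.
  by apply: eq_bigr => i _; rewrite !ord1.
have [lekn|] := leqP k n; last first.
  move=> ltnk; have ekn : k = n.+1.
    by have := leq_card _ (incr_inj gi); rewrite !card_ord; lia.
  subst k; apply/det_neq0P => a; rewrite mulmx_colsub => /matrixP aA.
  apply: (cA 0%N) => t ltt; rewrite add0n modn_small //.
  have := aA 0 (inord t); rewrite !mxE => aA0; rewrite -[RHS]aA0.
  by apply: eq_bigr => i _; rewrite (incr_full gi).
have last_case (B : 'M[R]_(k.+1, n.+2)) h : minors_ge0s B -> cyc_free B -> incr h ->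
    (forall s, h s != ord_max) -> \det (colsub h B) != 0.
  move=> pB cB hi hM.
  have hlt s : (h s < n.+1)%N.
    by have := hM s; rewrite -val_eqE /=; have := ltn_ord (h s); lia.
  pose h' s : 'I_n.+1 := Ordinal (hlt s).
  have -> : colsub h B = colsub h' (colsub (widen_ord (leqnSn n.+1)) B).
    by apply/matrixP => i j; rewrite !mxE; congr (B _ _); apply: val_inj.
  apply: IHn => [||i j /hi //]; last exact: cyc_free_delete.
  exact: minors_ge0s_colsub.
have [y gy] : exists y, forall s, g s != y.
  have : exists y, y \notin codom g.
    apply/existsP; rewrite -[X in is_true X]negbK negb_exists; apply/negP => /forallP gall.
    have : (#|'I_n.+2| <= #|'I_k.+1|)%N.
      apply: (@leq_trans (size (codom g))); last by rewrite size_codom.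
      apply: leq_trans (card_size _); apply: subset_leq_card.
      by apply/fintype.subsetP => y _; have := gall y; rewrite negbK.
    by rewrite !card_ord; lia.
  by case=> y yg; exists y => s; apply: contraNneq yg => <-; apply: codom_f.
exact: minors_neq0_avoid last_case pA cA gi gy.
Qed.

End RotationMinors.

(** * Paths of matrices *)

Section PolynomialPaths.
Variable R : rcfType.
Implicit Types p : {poly R}.

(** Induction on the degree: split off one root and compare it with the least root of the quotient
    in [0, 1], if there is one. *)
Lemma least_root p : p != 0 -> (exists2 x, 0 <= x <= 1 & root p x) ->
  exists x, [/\ 0 <= x <= 1, root p x & forall y, 0 <= y < x -> ~~ root p y].
Proof.
move: {2}(size p) (leqnn (size p)) => s.
elim: s p => [|s IHs] p; first by rewrite leqn0 size_poly_eq0 => /eqP ->; rewrite eqxx.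
move=> sp p0 [x x01 px].
have [q qE] := factor_theorem p x px.
have q0 : q != 0 by apply: contraNneq p0 => q0; rewrite qE q0 mul0r.
have sq : (size q <= s)%N.
  by move: sp; rewrite qE size_Mmonic ?monicXsubC // size_XsubC addn2.
have rootE y : root p y = root q y || (y == x).
  by rewrite qE rootM root_XsubC.
case: (pselect (exists2 y, 0 <= y <= 1 & root q y)) => [|noq].
  case/(IHs _ sq q0) => y [y01 qy ymin].
  case: (lerP y x) => [leyx|ltxy].
    exists y; split; rewrite ?rootE ?qy // => z /andP[z0 zy].
    by rewrite rootE negb_or ymin ?z0 //= lt_eqF // (lt_le_trans zy).
  exists x; split=> // z /andP[z0 zx].
  by rewrite rootE negb_or lt_eqF // andbT ymin // z0 (lt_trans zx).
exists x; split=> // z /andP[z0 zx]; rewrite rootE negb_or lt_eqF // andbT.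
apply/negP => qz; apply: noq; exists z => //; rewrite z0 ltW // (lt_le_trans zx) //.
by case/andP: x01.
Qed.

Lemma poly_gt0_noroot p (a b : R) : a <= b -> 0 < p.[a] ->
  (forall y, a <= y <= b -> ~~ root p y) -> 0 < p.[b].
Proof.
move=> leab pa nr; rewrite ltNge; apply/negP => pb.
have [||x xab rx] := @poly_ivt _ (- p) a b.
- exact: leab.
- by rewrite !hornerN oppr_le0 oppr_ge0 (ltW pa) pb.
by move: rx; rewrite rootN (negbTE (nr x _)).
Qed.

Lemma poly_ge0_noroot p (a b : R) : a <= b -> 0 < p.[a] ->
  (forall y, a <= y < b -> ~~ root p y) -> 0 <= p.[b].
Proof.
move=> leab pa nr; rewrite leNgt; apply/negP => pb.
have := @poly_gt0_noroot p a b leab pa; rewrite ltNge (ltW pb) /= => /(_ _)/negP[] //.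
move=> y /andP[ya]; rewrite le_eqVlt => /predU1P[->|yb]; last by rewrite nr // ya.
by rewrite rootE lt_eqF.
Qed.

Definition evmx r n (t : R) (A : 'M[{poly R}]_(r, n)) : 'M[R]_(r, n) :=
  map_mx (horner_eval t) A.

Lemma det_evmx k n (t : R) (A : 'M[{poly R}]_(k, n)) (g : 'I_k -> 'I_n) :
  \det (colsub g (evmx t A)) = (\det (colsub g A)).[t].
Proof. by rewrite -map_mxsub det_map_mx. Qed.

(* Along the path the strict sign pattern can only be lost at a point where
   all the minors still have weakly the same sign, hence nowhere. *)
Lemma minors_gt0s_path k n (A : 'M[{poly R}]_(k, n.+1)) :
  (forall t : R, 0 <= t <= 1 -> cyc_free (evmx t A)) ->
  minors_gt0s (evmx 0 A) -> minors_gt0s (evmx 1 A).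
Proof.
move=> cA pA.
(* The least root of [F] in [0, 1] is the first parameter at which some maximal minor vanishes. *)
pose F := \prod_(g : {ffun 'I_k -> 'I_n.+1} |
   [forall i : 'I_k, forall j : 'I_k, (i < j)%N ==> (g i < g j)%N]) \det (colsub g A).
have incrE (g : {ffun 'I_k -> 'I_n.+1}) :
    [forall i : 'I_k, forall j : 'I_k, (i < j)%N ==> (g i < g j)%N] -> incr g.
  by move=> /forallP h i j ltij; have /forallP/(_ j)/implyP := h i; apply.
have rootF t : root F t ->
    exists2 g : 'I_k -> 'I_n.+1, incr g & \det (colsub g (evmx t A)) = 0.
  rewrite rootE horner_prod prodf_seq_eq0 => /hasP[g _ /andP[/incrE gi /eqP g0]].
  by exists g; rewrite // det_evmx.
have Froot t (g : 'I_k -> 'I_n.+1) : incr g -> \det (colsub g (evmx t A)) = 0 -> root F t.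
  move=> gi g0; rewrite rootE horner_prod (bigD1 [ffun i => g i]) /=; last first.
    by apply/forallP => i; apply/forallP => j; apply/implyP => ltij; rewrite !ffunE gi.
  suff -> : (\det (colsub [ffun i => g i] A)).[t] = 0 by rewrite mul0r.
  rewrite -det_evmx -[RHS]g0; congr (\det _).
  by apply/matrixP => i j; rewrite !mxE ffunE.
pose f (g h : 'I_k -> 'I_n.+1) := \det (colsub g A) * \det (colsub h A).
have fE g h t : (f g h).[t] = \det (colsub g (evmx t A)) * \det (colsub h (evmx t A)).
  by rewrite hornerM !det_evmx.
have froot g h t : incr g -> incr h -> root (f g h) t -> root F t.
  move=> gi hi; rewrite rootE fE mulf_eq0 => /orP[]/eqP; exact: Froot.
have noroot t : 0 <= t <= 1 -> ~~ root F t.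
  move=> t01; apply/negP => Ft.
  have F0 : F != 0.
    apply/eqP => F0; have /rootF[g gi g0] : root F 0 by rewrite F0 root0.
    by have := pA g g gi gi; rewrite g0 mul0r ltxx.
  have [|x [x01 Fx xmin]] := least_root F0; first by exists t.
  have [g gi] := rootF x Fx; apply/eqP.
  (* Before x all products of two minors are positive, hence at x they are nonnegative; with
     [cyc_free] this excludes a vanishing minor. *)
  apply: (minors_neq0 _ (cA x x01)) => // h h' hi h'i.
  rewrite -fE; apply: (@poly_ge0_noroot _ 0); first by case/andP: x01.
    by rewrite fE pA.
  by move=> y yx; apply: contra (xmin y yx); apply: froot.
move=> g h gi hi; rewrite -fE; apply: (@poly_gt0_noroot _ 0); first exact: ler01.
  by rewrite fE pA.
by move=> y /noroot; apply: contra; apply: froot.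
Qed.

Lemma minors_ge0s_limit k n (A : 'M[{poly R}]_(k, n.+1)) :
  (forall t : R, 0 < t <= 1 -> minors_gt0s (evmx t A)) -> minors_ge0s (evmx 0 A).
Proof.
move=> pA g h gi hi; rewrite !det_evmx -hornerM; set f := _ * _.
have fpos t : 0 < t <= 1 -> 0 < f.[t].
  by move=> /pA/(_ g h gi hi); rewrite !det_evmx -hornerM.
rewrite leNgt; apply/negP => f0.
have := @poly_gt0_noroot (- f) 0 1 ler01; rewrite !hornerN !oppr_gt0 => /(_ f0).
rewrite ltNge ltW ?fpos ?ltr01 ?lexx // => /(_ _)/notF; apply=> y /andP[y0 y1].
rewrite rootN rootE; move: y0; rewrite le_eqVlt => /predU1P[<-|y0].
  by rewrite lt_eqF.
by rewrite gt_eqF // fpos // y0.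
Qed.

End PolynomialPaths.

(** * The twist of a pair (V, Z) *)

Lemma incr_ub r n (g : 'I_r -> 'I_n) (s : 'I_r) : incr g -> (g s + (r - s) <= n)%N.
Proof.
move=> gi; move dE : (r - s)%N => d; elim: d s dE => [|d IHd] s dE.
  by rewrite addn0 ltnW.
case: d IHd dE => [|d] IHd dE; first by rewrite addn1.
have s1 : (s.+1 < r)%N by lia.
have dE1 : (r - s.+1 = d.+1)%N by lia.
have := IHd (Ordinal s1) dE1.
by have : (g s < g (Ordinal s1))%N by [apply: gi]; lia.
Qed.

Section Twist.
Variable R : comNzRingType.
Variables (k m n : nat) (e : R).
Implicit Types (V : 'M[R]_(k, n.+1)) (Z : 'M[R]_(k + m, n.+1)).

(* In terms of Y = V Z^T, the column x of the twist is, up to the factor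
   det (pivot_mx V Z x), the point where span (Z(x), ..., Z(x + m)) meets Y,
   normalized by its coefficient at Z(x + m). *)
Definition pivot_mx V Z x : 'M[R]_(k + m) := row_mx (Z *m V^T) (qwin e Z x m).

(** The adjugate in place of the inverse keeps the entries polynomial in V and Z, so the twist can
    be formed over [{poly R}] along a path. *)
Definition twcol V Z x : 'cV[R]_k :=
  usubmx (\adj (pivot_mx V Z x) *m qcol e Z (x + m)).

Definition twmx V Z x0 : 'M[R]_(k, n.+1) := \matrix_(i, c) twcol V Z (x0 + c) i 0.

(** Cramer's rule without division. *)
Lemma twcol_solve V Z x s (a : 'cV_k) (b : 'cV_m) :
  pivot_mx V Z x *m col_mx a b = s *: qcol e Z (x + m) ->
  \det (pivot_mx V Z x) *: a = s *: twcol V Z x.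
Proof.
move=> h; have : \adj (pivot_mx V Z x) *m (pivot_mx V Z x *m col_mx a b) =
    s *: (\adj (pivot_mx V Z x) *m qcol e Z (x + m)) by rewrite h scalemxAr.
rewrite mulmxA mul_adj_mx mul_scalar_mx => /(congr1 usubmx).
have usZ (c : R) (v : 'cV[R]_(k + m)) : usubmx (c *: v) = c *: usubmx v.
  by apply/matrixP => i j; rewrite !mxE.
by rewrite !usZ col_mxKu.
Qed.

(** Dual to Cramer's rule: [z] lifts the form [a] and vanishes on the m pivot columns of Z; the
    twist column evaluates [a] through the value of [z] at the next column. *)
Lemma twcol_form V Z x (a : 'rV_k) (z : 'rV_(k + m)) :
  z *m pivot_mx V Z x = row_mx a 0 ->
  a *m twcol V Z x = \det (pivot_mx V Z x) *: (z *m qcol e Z (x + m)).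
Proof.
move=> zN; set v := \adj (pivot_mx V Z x) *m qcol e Z (x + m).
have : row_mx a 0 *m v = \det (pivot_mx V Z x) *: (z *m qcol e Z (x + m)).
  by rewrite -zN /v mulmxA -(mulmxA z) mul_mx_adj mul_mx_scalar scalemxAl.
by rewrite -{1}[v]vsubmxK mul_row_col mul0mx addr0.
Qed.

Lemma pivot_mxDn V Z x : pivot_mx V Z (x + n.+1) = row_mx (Z *m V^T) (e *: qwin e Z x m).
Proof.
congr row_mx; apply/matrixP => i t; rewrite !mxE addnAC.
by rewrite modnDr divnDr ?divnn // addn1 exprS -mulrA.
Qed.

(** The summand that wraps around picks up the sign [e] twice. *)
Lemma qshift_gram k1 k2 (A : 'M[R]_(k1, n.+1)) (B : 'M[R]_(k2, n.+1)) y : e * e = 1 ->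
  qshift e A y *m (qshift e B y)^T = A *m B^T.
Proof.
move=> ee; elim: y => [|y IHy]; first by rewrite !qshift0.
rewrite -(addn1 y) -!qshiftD -IHy; move: (qshift e A y) (qshift e B y) => A' B'.
apply/matrixP => i j; rewrite !mxE big_ord_recr [RHS]big_ord_recl /= addrC.
congr (_ + _).
  by rewrite [_^T _ _]mxE !qshift1_max mulrACA ee mul1r mxE.
apply: eq_bigr => c _.
have cE : lift ord0 c = (widen_ord (leqnSn n) c).+1 :> nat by [].
by rewrite [_^T _ _]mxE !(qshift1E _ _ _ cE) mxE.
Qed.

End Twist.

Section TwistPositivity.
Variable R : realFieldType.
Variables (k m n : nat).
Implicit Types (V : 'M[R]_(k, n.+1)) (Z : 'M[R]_(k + m, n.+1)).

Definition last_cols : 'M[R]_(n.+1, m) := \matrix_(c, t) ((c : nat) == n.+1 - m + t)%N%:R.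

(** If [g] selects all the last m rows, the matrix is block triangular and leaves a minor of V.
    Otherwise the row of some unit column is not selected, and that column restricts to zero. *)
Lemma det_rowsub_last V (g : 'I_(k + m) -> 'I_n.+1) : (m <= n.+1)%N -> incr g ->
  \det (rowsub g (row_mx V^T last_cols)) = 0 \/
  exists2 f : 'I_k -> 'I_n.+1, incr f &
    \det (rowsub g (row_mx V^T last_cols)) = \det (colsub f V).
Proof.
move=> lemn gi.
case: (boolP [forall t : 'I_m, g (rshift k t) == (n.+1 - m + t)%N :> nat]) => [/forallP gl|].
  right; exists (g \o lshift m); first by move=> i j ltij; apply: gi.
  have -> : rowsub g (row_mx V^T last_cols) =
    block_mx (colsub (g \o lshift m) V)^T 0 (colsub (g \o @rshift k m) V)^T 1%:M.
    apply/matrixP => i j; rewrite mxE; case: (split_ordP i) => i' ->;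
      case: (split_ordP j) => j' ->.
    - by rewrite row_mxEl block_mxEul !mxE.
    - rewrite row_mxEr block_mxEur !mxE; case: eqP => // gE.
      have : (g (lshift m i') < g (rshift k j'))%N.
        by apply: gi => /=; have := ltn_ord i'; lia.
      by rewrite gE (eqP (gl j')) ltnn.
    - by rewrite row_mxEl block_mxEdl !mxE.
    - by rewrite row_mxEr block_mxEdr !mxE (eqP (gl i')) eqn_add2l.
  by rewrite det_lblock det1 mulr1 det_tr.
rewrite negb_forall => /existsP[t0 Pt0]; left.
(* For the largest misplaced t, row n + 1 - m + t is skipped by [g]: the values up to that position
   are too small, and the later ones are exactly in place. *)
have := @arg_maxnP _ t0 (fun t => g (rshift k t) != (n.+1 - m + t)%N :> nat)
  (fun t : 'I_m => nat_of_ord t) Pt0.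
case=> t tn tmax.
have t_lt : (g (rshift k t) < n.+1 - m + t)%N.
  have := incr_ub (rshift k t) gi; rewrite /= => h.
  by rewrite ltn_neqAle tn /=; have := ltn_ord t; lia.
rewrite -det_tr (expand_det_row _ (rshift k t)) big1 // => s _.
rewrite [X in X * _](_ : _ = 0) ?mul0r //.
rewrite mxE [rowsub _ _ _ _]mxE row_mxEr mxE; case: eqP => // gE.
case: (leqP s (rshift k t)) => [lest|ltts].
  suff : (g s <= g (rshift k t))%N by lia.
  by case: ltngtP lest => // [/gi/ltnW //|/val_inj -> //].
have := ltts; case: (split_ordP s) => s' sE; first by rewrite sE /= ; have := ltn_ord s'; lia.
rewrite sE /= ltn_add2l => ltts'.
case: (boolP (g (rshift k s') == (n.+1 - m + s')%N :> nat)) => [/eqP gs'|/tmax]; last by lia.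
by move: gE; rewrite sE gs'; lia.
Qed.

Lemma det_rowsub_last_eq V (f : 'I_k -> 'I_n.+1) : (m <= n.+1)%N -> incr f ->
  (forall s, f s < n.+1 - m)%N ->
  exists2 g : 'I_(k + m) -> 'I_n.+1, incr g &
    \det (rowsub g (row_mx V^T last_cols)) = \det (colsub f V).
Proof.
move=> lemn fi flt.
pose r (t : 'I_m) : 'I_n.+1 := inord (n.+1 - m + t).
have rE t : r t = (n.+1 - m + t)%N :> nat by rewrite inordK //; have := ltn_ord t; lia.
pose g s := match split s with inl i => f i | inr t => r t end.
have gl i : g (lshift m i) = f i by rewrite /g (unsplitK (inl _ i)).
have gr t : g (rshift k t) = r t by rewrite /g (unsplitK (inr _ t)).
exists g.
  move=> i j; case: (split_ordP i) => i' ->; case: (split_ordP j) => j' ->;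
    rewrite ?gl ?gr ?rE /=.
  - exact: fi.
  - by move=> _; have := flt i'; lia.
  - by have := ltn_ord j'; lia.
  - by rewrite !ltn_add2l.
have -> : rowsub g (row_mx V^T last_cols) =
    block_mx (colsub f V)^T 0 (colsub r V)^T 1%:M.
  apply/matrixP => i j; rewrite mxE; case: (split_ordP i) => i' ->;
      case: (split_ordP j) => j' ->; rewrite ?gl ?gr.
  - by rewrite row_mxEl block_mxEul !mxE.
  - rewrite row_mxEr block_mxEur !mxE; case: eqP => // gE.
    by have := flt i'; lia.
  - by rewrite row_mxEl block_mxEdl !mxE.
  - by rewrite row_mxEr block_mxEdr !mxE rE eqn_add2l.
by rewrite det_lblock det1 mulr1 det_tr.
Qed.

Hypothesis m_even : ~~ odd m.

Lemma rsignD : rsign R (k + m) = rsign R k.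
Proof. by rewrite /rsign -addSn exprD -(signr_odd _ m) (negbTE m_even) mulr1. Qed.

End TwistPositivity.

Section PivotPositivity.
Variable R : realFieldType.
Variables (k m n : nat).
Hypothesis m_even : ~~ odd m.
Hypothesis le_kmn : (k + m <= n.+1)%N.
Implicit Types (V : 'M[R]_(k, n.+1)) (Z : 'M[R]_(k + m, n.+1)).
Local Notation e := (rsign R k).

(* Rotate so that the window is made of the last m columns. *)
Lemma det_pivotE V Z x :
  \det (pivot_mx e V Z x) =
  \det (qshift e Z (x + m) *m row_mx (qshift e V (x + m))^T (last_cols R m n)).
Proof.
have lemn : (m <= n.+1)%N by lia.
have -> : pivot_mx e V Z x =
    (qshift e Z (x + m) *m row_mx (qshift e V (x + m))^T (last_cols R m n)) *m
    block_mx 1%:M 0 0 e%:M.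
  rewrite mul_mx_row qshift_gram ?rsign_sqr // /pivot_mx mul_row_block.
  rewrite mulmx1 !mulmx0 addr0 add0r; congr row_mx.
  rewrite mul_mx_scalar; apply/matrixP => i t; rewrite mxE [RHS]mxE [X in _ * X]mxE.
  have ct : (n.+1 - m + t < n.+1)%N by have := ltn_ord t; lia.
  rewrite (bigD1 (Ordinal ct)) //= big1 ?addr0; last first.
    move=> c; rewrite -val_eqE /= => /negbTE cE.
    by rewrite [last_cols _ _ _ _ _]mxE cE mulr0.
  rewrite [last_cols _ _ _ _ _]mxE eqxx mulr1 [qshift _ _ _ _ _]mxE /=.
  rewrite (_ : (x + m + (n.+1 - m + t) = x + t + n.+1)%N); last by lia.
  by rewrite qcolDn [X in _ * X]mxE mulrA rsign_sqr mul1r.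
rewrite det_mulmx det_ublock det1 mul1r det_scalar.
by rewrite /rsign -exprM mulnC exprM -(signr_odd _ m) (negbTE m_even) expr0 expr1n mulr1.
Qed.

Let minor_last_ge0 V (g : 'I_(k + m) -> 'I_n.+1) : minors_ge0 V -> incr g ->
  0 <= \det (rowsub g (row_mx V^T (last_cols R m n))).
Proof.
have lemn : (m <= n.+1)%N by lia.
by move=> pV gi; have [->|[f fi ->]] := det_rowsub_last V lemn gi; rewrite ?pV.
Qed.

Lemma det_pivot_ge0 V Z x : minors_ge0 V -> minors_ge0 Z ->
  0 <= \det (pivot_mx e V Z x).
Proof.
move=> pV pZ; rewrite det_pivotE.
have [|pos _] := @det_mulmx_ge0 _ _ _ (qshift e Z (x + m))
  (row_mx (qshift e V (x + m))^T (last_cols R m n)) => // g gi.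
rewrite mulr_ge0 ?minor_last_ge0 //; last exact: minors_ge0_qshift.
by rewrite -(rsignD R k m_even); apply: minors_ge0_qshift.
Qed.

(** The rotation places the pivot window on the last m columns, so the condition provides a nonzero
    minor of V avoiding that window, hence a nonzero Cauchy-Binet term. *)
Lemma det_pivot_gt0 V Z x : minors_ge0 V -> minors_gt0 Z ->
  (exists2 f : 'I_k -> 'I_n.+1, incr f & (forall s, f s < n.+1 - m)%N /\
     \det (colsub f (qshift e V (x + m))) != 0) ->
  0 < \det (pivot_mx e V Z x).
Proof.
move=> pV pZ [f fi [flt fn0]]; rewrite det_pivotE.
have lemn : (m <= n.+1)%N by lia.
have pZ' : minors_gt0 (qshift e Z (x + m)).
  by rewrite -(rsignD R k m_even); apply: minors_gt0_qshift.
have [|_ pos] := @det_mulmx_ge0 _ _ _ (qshift e Z (x + m))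
  (row_mx (qshift e V (x + m))^T (last_cols R m n)).
  move=> g gi; rewrite mulr_ge0 ?minor_last_ge0 //; last exact: minors_ge0_qshift.
  by rewrite ltW // pZ'.
have [g gi gE] := det_rowsub_last_eq (qshift e V (x + m)) lemn fi flt.
by apply: (pos g) => //; rewrite gE mulf_neq0 // gt_eqF // pZ'.
Qed.

Lemma det_pivot_tp_gt0 V Z x : minors_gt0 V -> minors_gt0 Z ->
  0 < \det (pivot_mx e V Z x).
Proof.
move=> pV pZ; apply: det_pivot_gt0 => //; first exact: minors_gt0W.
have fi : incr (fun s : 'I_k => inord s : 'I_n.+1).
  by move=> i j ltij; rewrite !inordK //; have := ltn_ord i; have := ltn_ord j; lia.
exists (fun s => inord s) => //; split.
  by move=> s; rewrite inordK; have := ltn_ord s; lia.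
by rewrite gt_eqF // minors_gt0_qshift.
Qed.

End PivotPositivity.

(** * Consecutive minors of the twist *)

Section TwistFree.
Variable R : realFieldType.

Lemma minors_gt0_cyc_free k' n (A : 'M[R]_(k', n.+1)) : (k' <= n.+1)%N ->
  minors_gt0 A -> cyc_free A.
Proof.
move=> lekn pA; apply/(cyc_freeE _ (rsign_neq0 R k')) => x a ha.
have fi : incr (fun s : 'I_k' => inord s : 'I_n.+1).
  by move=> i j ltij; rewrite !inordK //; have := ltn_ord i; have := ltn_ord j; lia.
have := minors_gt0_qshift x pA fi; move/lt0r_neq0/det_neq0P; apply.
apply/rowP => t; rewrite mulmx_colsub mxE [RHS]mxE.
have /matrixP/(_ 0 0) := ha t (ltn_ord t); rewrite !mxE => hE; rewrite -[RHS]hE.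
apply: eq_bigr => i _; congr (_ * _); rewrite !mxE inordK //.
by have := ltn_ord t; lia.
Qed.

Variables (k m n : nat).
Implicit Types (V : 'M[R]_(k, n.+1)) (Z : 'M[R]_(k + m, n.+1)).
Local Notation e := (rsign R k).

(** One period further, the pivot columns of Z and the next column are merely multiplied by [e], so
    the same lifted form tests both twist columns. *)
Lemma twcol_eq0_mod V Z x d (a : 'rV_k) :
  (forall x, \det (pivot_mx e V Z x) != 0) ->
  a *m twcol e V Z x = 0 -> a *m twcol e V Z (x + d * n.+1) = 0.
Proof.
move=> N0; elim: d => [|d IHd]; first by rewrite addn0.
move=> /IHd{IHd}; rewrite mulSnr addnA; move: (x + _)%N => {}x aT.
pose z := row_mx a 0 *m invmx (pivot_mx e V Z (x + n.+1)).
have zE : z *m pivot_mx e V Z (x + n.+1) = row_mx a 0.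
  by rewrite mulmxKV // unitmxE unitfE.
have zE' : z *m pivot_mx e V Z x = row_mx a 0.
  move: (zE); rewrite pivot_mxDn !mul_mx_row => /eq_row_mx[-> /eqP].
  by rewrite -scalemxAr scaler_eq0 (negbTE (rsign_neq0 R k)) /= => /eqP ->.
move: aT; rewrite (twcol_form zE) (twcol_form zE') addnAC qcolDn -[z *m (_ *: qcol _ _ _)]scalemxAr.
by move=> /eqP; rewrite scaler_eq0 (negbTE (N0 _)) /= => /eqP ->; rewrite !scaler0.
Qed.

(** Let z be the lift of [a] that vanishes on m consecutive columns of Z. If [a] kills the
    corresponding twist column, then z also kills the next column of Z and is the lift for the next
    window as well. After k such steps z kills k + m consecutive columns of Z. *)
Lemma twmx_cyc_free V Z x0 : (forall x, \det (pivot_mx e V Z x) != 0) ->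
  cyc_free Z -> cyc_free (twmx e V Z x0).
Proof.
move=> N0 cZ x a ha.
have {}ha t : (t < k)%N -> a *m twcol e V Z (x0 + x + t) = 0.
  move=> ltt; have := ha t ltt => aT.
  rewrite -addnA (divn_eq (x + t) n.+1) [(_ * _ + _)%N]addnC addnA.
  apply: twcol_eq0_mod => //; apply/matrixP => i j; rewrite !ord1 [RHS]mxE -[RHS]aT.
  rewrite mxE [RHS]mxE; apply: eq_bigr => s _; congr (_ * _).
  by rewrite [RHS]mxE inordK ?ltn_pmod.
pose z := row_mx a 0 *m invmx (pivot_mx e V Z (x0 + x)).
have zE : z *m pivot_mx e V Z (x0 + x) = row_mx a 0.
  by rewrite mulmxKV // unitmxE unitfE.
have [zY zwin] : z *m (Z *m V^T) = a /\ z *m qwin e Z (x0 + x) m = 0.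
  by apply: eq_row_mx; rewrite -mul_mx_row.
have zcol y : (z *m qcol e Z y) = 0 <-> (z *m qcol e Z y) 0 0 = 0.
  by split=> [->|h]; [rewrite mxE|apply/matrixP => i j; rewrite !ord1 h mxE].
have zwE y t : (z *m qwin e Z y m) 0 t = (z *m qcol e Z (y + t)) 0 0.
  by rewrite mxE [RHS]mxE; apply: eq_bigr => s _; congr (_ * _); rewrite mxE.
have zwinE y : (forall t, (t < m)%N -> z *m qcol e Z (y + t) = 0) -> z *m qwin e Z y m = 0.
  move=> h; apply/matrixP => i t; rewrite ord1 [RHS]mxE zwE.
  exact/zcol/h.
have zvan t : (t < k + m)%N -> z *m qcol e Z (x0 + x + t) = 0.
  elim/ltn_ind: t => t IHt ltt; case: (ltnP t m) => tm.
    by apply/zcol; rewrite -[t]/(nat_of_ord (Ordinal tm)) -zwE zwin mxE.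
  have zE' : z *m pivot_mx e V Z (x0 + x + (t - m)) = row_mx a 0.
    rewrite mul_mx_row zY zwinE // => s lts.
    by rewrite -addnA; apply: IHt; lia.
  have := ha (t - m)%N; rewrite (twcol_form zE') -(addnA _ (t - m)%N m) subnK // => /(_ _)/eqP.
  by rewrite scaler_eq0 (negbTE (N0 _)) /= => h; apply/eqP/h; lia.
have z0 : z = 0.
  by apply: (((cyc_freeE _ (rsign_neq0 R k)).1 cZ) (x0 + x)%N) => t; apply: zvan.
by rewrite -zY z0 mul0mx.
Qed.

End TwistFree.

(** * The cyclically symmetric point *)

Section BinaryForms.
Variable R : comNzRingType.

(** Value at (s, u) of the binary form of degree d whose dehomogenization is p. *)
Definition form_eval (d : nat) (p : {poly R}) (s u : R) : R :=
  \sum_(b < d.+1) p`_b * (s ^+ (d - b) * u ^+ b).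

Lemma form_eval_linear d (p : {poly R}) (c1 c2 s u : R) : (size p <= d.+1)%N ->
  form_eval d.+1 ((c1%:P + c2 *: 'X) * p) s u = (c1 * s + c2 * u) * form_eval d p s u.
Proof.
move=> sp; rewrite mulrDl /form_eval.
under eq_bigr => b _ do rewrite coefD coefCM -scalerAl coefZ coefXM mulrDl.
rewrite big_split /= big_ord_recr /= [p`_d.+1]nth_default // mulr0 mul0r addr0.
rewrite [X in _ + X]big_ord_recl /= mulr0 mul0r add0r mulrDl; congr (_ + _).
  rewrite big_distrr /=; apply: eq_bigr => b _.
  have bd : (b <= d)%N by rewrite -ltnS.
  by rewrite subSn // exprS; ring.
rewrite big_distrr /=; apply: eq_bigr => b _.
by rewrite /bump /= add1n subSS exprS; ring.
Qed.

Lemma form_subst (c1 c2 c3 c4 : R) d a : (a <= d)%N ->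
  exists2 p : {poly R}, (size p <= d.+1)%N & forall s u,
    (c1 * s + c2 * u) ^+ (d - a) * (c3 * s + c4 * u) ^+ a = form_eval d p s u.
Proof.
have sz (b1 b2 : R) (p : {poly R}) r : (size p <= r)%N ->
    (size ((b1%:P + b2 *: 'X) * p)%R <= r.+1)%N.
  move=> sp; apply: leq_trans (size_polyMleq _ _) _.
  suff : (size (b1%:P + b2 *: 'X)%R <= 2)%N by lia.
  apply: leq_trans (size_polyD _ _) _; rewrite geq_max; apply/andP; split.
    exact: leq_trans (size_polyC_leq1 _) _.
  by apply: leq_trans (size_scale_leq _ _) _; rewrite size_polyX.
elim: d a => [|d IHd] a.
  rewrite leqn0 => /eqP ->; exists 1; first by rewrite size_poly1.
  by move=> s u; rewrite /form_eval big_ord1 coef1 !mulr1.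
case: a => [_|a].
  have [p sp pE] := IHd 0%N (leq0n _).
  exists ((c1%:P + c2 *: 'X) * p) => [|s u]; first exact: sz.
  by rewrite form_eval_linear // -pE subn0 subn0 exprS !mulr1.
rewrite ltnS => /IHd[p sp pE].
exists ((c3%:P + c4 *: 'X) * p) => [|s u]; first exact: sz.
by rewrite form_eval_linear // -pE subSS exprS; ring.
Qed.

End BinaryForms.

Lemma gram_unit (R : realFieldType) k n (A : 'M[R]_(k, n)) :
  row_free A -> A *m A^T \in unitmx.
Proof.
move=> fA; rewrite unitmxE unitfE; apply/det_neq0P => a aAA.
have : (a *m A) *m (a *m A)^T = 0.
  by rewrite trmx_mul mulmxA -(mulmxA a) aAA mul0mx.
move/matrixP/(_ 0 0); rewrite !mxE => /eqP.
rewrite psumr_eq0 => [/allP h|i _]; last by rewrite [_^T _ _]mxE -expr2 sqr_ge0.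
have : a *m A = 0.
  apply/rowP => i; rewrite [RHS]mxE.
  have := h i (mem_index_enum _); rewrite [_^T _ _]mxE -expr2 sqrf_eq0 => /eqP.
  by [].
by move/eqP; rewrite mulmx_free_eq0 // => /eqP.
Qed.

Section CyclicPoint.
Variables (R : realType) (n : nat).

(* The row span of cyc_mx k consists of the binary forms of degree k - 1
   evaluated at (sin, - cos) of equally spaced angles, hence is invariant under
   rotation.  The angles lie in ]0, pi[, where sin can be divided out. *)
Definition cyc_angle (x : nat) : R := (x%:R *+ 2 + 1) / (n.+1%:R *+ 2) * pi.
Definition cyc_vec k (x : nat) : 'cV[R]_k :=
  \col_a (sin (cyc_angle x) ^+ (k.-1 - a) * (- cos (cyc_angle x)) ^+ a).
Definition cyc_mx k : 'M[R]_(k, n.+1) := \matrix_(a, c) cyc_vec k c a 0.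

Lemma cyc_angleS x : cyc_angle x.+1 = cyc_angle x + pi / n.+1%:R.
Proof.
have N0 : (n.+1%:R : R) != 0 by rewrite pnatr_eq0.
by rewrite /cyc_angle -natr1; field; rewrite addrC natr1.
Qed.

Lemma cyc_angleDn x : cyc_angle (x + n.+1) = cyc_angle x + pi.
Proof.
have N0 : (n.+1%:R : R) != 0 by rewrite pnatr_eq0.
by rewrite /cyc_angle natrD; field; rewrite addrC natr1.
Qed.

Lemma cyc_angle_lt x y : (x < y)%N -> cyc_angle x < cyc_angle y.
Proof.
move=> ltxy; rewrite ltr_pM2r ?pi_gt0 // ltr_pM2r; last first.
  by rewrite invr_gt0 pmulrn_lgt0 // ltr0n.
by rewrite ltrD2r ltrMn2r /= ltr_nat.
Qed.

Lemma cyc_angle_gt0 x : 0 < cyc_angle x.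
Proof.
rewrite mulr_gt0 ?pi_gt0 // divr_gt0 //; last by rewrite pmulrn_lgt0 // ltr0n.
by rewrite ltr_wpDl // mulrn_wge0.
Qed.

Lemma cyc_angle_ltpi x : (x < n.+1)%N -> cyc_angle x < pi.
Proof.
move=> ltx; rewrite -[ltRHS]mul1r ltr_pM2r ?pi_gt0 // ltr_pdivrMr; last first.
  by rewrite pmulrn_lgt0 // ltr0n.
have : (x.+1%:R : R) <= n.+1%:R by rewrite ler_nat.
by rewrite -(natr1 x) mul1r !mulr2n; lra.
Qed.

Lemma sin_cyc_angle_gt0 x : (x < n.+1)%N -> 0 < sin (cyc_angle x).
Proof. by move=> ltx; apply: sin_gt0_pi; rewrite cyc_angle_gt0 cyc_angle_ltpi. Qed.

(** Dividing each column by the top power of its sine leaves a Vandermonde matrix in the values of -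
    cot, which increases on ]0, pi[. *)
Lemma cyc_mx_minors_gt0 k : minors_gt0 (cyc_mx k).
Proof.
move=> g gi; case: k g gi => [|k] g gi; first by rewrite det_mx00.
pose s (j : 'I_k.+1) := sin (cyc_angle (g j)).
pose u (j : 'I_k.+1) := - cos (cyc_angle (g j)).
have s0 j : 0 < s j by apply: sin_cyc_angle_gt0.
have -> : colsub g (cyc_mx k.+1) =
    Vandermonde k.+1 (\row_j (u j / s j)) *m diag_mx (\row_j s j ^+ k).
  apply/matrixP => a j; rewrite mul_mx_diag !mxE -/(s j) -/(u j) /=.
  have ak : (a <= k)%N by rewrite -ltnS.
  have -> : s j ^+ k = s j ^+ (k - a) * s j ^+ a by rewrite -exprD subnK.
  by rewrite expr_div_n mulrC [s j ^+ _ * s j ^+ _]mulrC mulrA divfK // expf_neq0 // gt_eqF.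
rewrite det_mulmx det_Vandermonde det_diag mulr_gt0 //; last first.
  by apply: prodr_gt0 => j _; rewrite mxE exprn_gt0.
apply: prodr_gt0 => i _; apply: prodr_gt0 => j ltij; rewrite !mxE.
have -> : u j / s j - u i / s i = sin (cyc_angle (g j) - cyc_angle (g i)) / (s i * s j).
  by rewrite sinB -/(s i) -/(s j) /u; field; rewrite !gt_eqF.
rewrite divr_gt0 ?mulr_gt0 //; apply: sin_gt0_pi.
rewrite subr_gt0 cyc_angle_lt ?gi //=.
by rewrite ltrBlDr ltr_wpDr ?cyc_angle_ltpi // ltW // cyc_angle_gt0.
Qed.

(** A full period adds pi to the angle and so negates both arguments of a form of degree k - 1. *)
Lemma qcol_cyc_mx k x : qcol (rsign R k) (cyc_mx k) x = cyc_vec k x.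
Proof.
have base c : (c < n.+1)%N -> qcol (rsign R k) (cyc_mx k) c = cyc_vec k c.
  move=> ltc; rewrite -[c]/(nat_of_ord (Ordinal ltc)) qcol_small.
  by apply/colP => a; rewrite !mxE.
rewrite (divn_eq x n.+1) addnC qcolDMn base ?ltn_pmod //.
elim: (x %/ n.+1)%N => [|d IHd]; first by rewrite scale1r addn0.
rewrite exprS -scalerA IHd mulSnr addnA; move: (_ + d * _)%N => {IHd d}y.
apply/colP => a; rewrite !mxE cyc_angleDn sinDpi cosDpi opprK.
have ak : (a < k)%N by [].
rewrite /rsign -[in (-1) ^+ k.+1](prednK (n := k)); last by lia.
rewrite !exprS mulrA mulrNN mul1r mul1r.
set t := sin _; set u := cos _.
rewrite -(mulN1r t) -{2}(opprK u) -(mulN1r (- u)) !exprMn mulrACA -exprD.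
by rewrite subnK //; lia.
Qed.

Lemma cyc_vec_rot k : exists C : 'M[R]_k, forall x, cyc_vec k x.+1 = C *m cyc_vec k x.
Proof.
pose dl : R := pi / n.+1%:R.
have /choice[p pE] : forall a : 'I_k, exists p : {poly R}, forall s u,
    (cos dl * s + (- sin dl) * u) ^+ (k.-1 - a) * (sin dl * s + cos dl * u) ^+ a =
    form_eval k.-1 p s u.
  move=> a; have ak : (a <= k.-1)%N by have := ltn_ord a; lia.
  by have [p _ pE] := form_subst (cos dl) (- sin dl) (sin dl) (cos dl) ak; exists p.
exists (\matrix_(a, b) (p a)`_b) => x; apply/colP => a; rewrite !mxE.
have k0 : (0 < k)%N by apply: leq_ltn_trans (ltn_ord a).
set s := sin (cyc_angle x); set u := - cos (cyc_angle x).
have -> : sin (cyc_angle x.+1) = cos dl * s + (- sin dl) * u.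
  by rewrite cyc_angleS sinD /u -/dl -/s; ring.
have -> : - cos (cyc_angle x.+1) = sin dl * s + cos dl * u.
  by rewrite cyc_angleS cosD /u -/dl -/s; ring.
rewrite pE /form_eval.
rewrite -(big_mkord xpredT (fun b => (p a)`_b * (s ^+ (k.-1 - b) * u ^+ b))) prednK //.
by rewrite big_mkord; apply: eq_bigr => b _; rewrite !mxE.
Qed.

End CyclicPoint.

Lemma minors_gt0_row_free (R : realFieldType) k n (A : 'M[R]_(k, n)) : (k <= n)%N ->
  minors_gt0 A -> row_free A.
Proof.
move=> lekn pA; apply/row_free_minorP; exists (widen_ord lekn).
  by move=> i j.
by rewrite gt_eqF // pA // => i j.
Qed.

Section CyclicTwist.
Variables (R : realType) (k m n : nat).
Hypothesis m_even : ~~ odd m.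
Hypothesis le_kmn : (k.+1 + m <= n.+1)%N.
Local Notation e := (rsign R k.+1).
Local Notation V := (cyc_mx R n k.+1).
Local Notation Z := (cyc_mx R n (k.+1 + m)).
Local Notation P x := (pivot_mx e V Z x).

Let P_gt0 x : 0 < \det (P x).
Proof. by apply: det_pivot_tp_gt0 => //; apply: cyc_mx_minors_gt0. Qed.

Let P_unit x : P x \in unitmx.
Proof. by rewrite unitmxE unitfE gt_eqF. Qed.

Let tau x : 'cV_k.+1 := usubmx (invmx (P x) *m qcol e Z (x + m)).

Let twcolE x : twcol e V Z x = \det (P x) *: tau x.
Proof.
rewrite -[twcol _ _ _ _]scale1r; apply/esym.
apply: (twcol_solve (b := dsubmx (invmx (P x) *m qcol e Z (x + m)))).
by rewrite scale1r vsubmxK mulmxA mulmxV // mul1mx.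
Qed.

Let tau_unique x a b : P x *m col_mx a b = qcol e Z (x + m) -> tau x = a.
Proof. by rewrite /tau => <-; rewrite mulKmx // col_mxKu. Qed.

Let qcolV x : qcol e V x = cyc_vec R n k.+1 x.
Proof. exact: qcol_cyc_mx. Qed.

Let qcolZ x : qcol e Z x = cyc_vec R n (k.+1 + m) x.
Proof. by rewrite -(rsignD R k.+1 m_even) qcol_cyc_mx. Qed.

Let G := V *m V^T.

Let G_unit : G \in unitmx.
Proof. by apply/gram_unit/minors_gt0_row_free; [lia|exact: cyc_mx_minors_gt0]. Qed.

Section Rotated.
Variables (C : 'M[R]_k.+1) (D : 'M[R]_(k.+1 + m)).
Hypothesis CE : forall x, cyc_vec R n k.+1 x.+1 = C *m cyc_vec R n k.+1 x.
Hypothesis DE : forall x, cyc_vec R n (k.+1 + m) x.+1 = D *m cyc_vec R n (k.+1 + m) x.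

Let qshiftV : qshift e V 1 = C *m V.
Proof.
apply/matrixP => i c; rewrite mxE qcolV add1n CE -qcolV qcol_small.
by rewrite colE mulmxA -colE mxE.
Qed.

Let qshiftZ : qshift e Z 1 = D *m Z.
Proof.
apply/matrixP => i c; rewrite mxE qcolZ add1n DE -qcolZ qcol_small.
by rewrite colE mulmxA -colE mxE.
Qed.

Let GC : C *m G *m C^T = G.
Proof.
rewrite -[RHS](qshift_gram V V 1 (rsign_sqr R k.+1)) qshiftV trmx_mul.
by rewrite !mulmxA.
Qed.

Let ZC : D *m (Z *m V^T) *m C^T = Z *m V^T.
Proof.
rewrite -[RHS](qshift_gram Z V 1 (rsign_sqr R k.+1)) qshiftV qshiftZ trmx_mul.
by rewrite !mulmxA.
Qed.

Let C_unit : C \in unitmx.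
Proof.
by have := G_unit; rewrite -GC -mulmxA unitmx_mul => /andP[].
Qed.

(** Rotating the pivot system moves [tau] by the inverse transpose of C; since C G C^T = G,
    multiplication by the Gram matrix turns this into C itself. *)
Let tauS x : G *m tau x.+1 = C *m (G *m tau x).
Proof.
set v := invmx (P x) *m qcol e Z (x + m).
have Pv : P x *m v = qcol e Z (x + m) by rewrite /v mulmxA mulmxV // mul1mx.
have -> : tau x.+1 = invmx C^T *m tau x.
  apply: (tau_unique (b := dsubmx v)).
  have -> : qcol e Z (x.+1 + m) = D *m qcol e Z (x + m).
    by rewrite !qcolZ -[(x.+1 + m)%N]/((x + m).+1) DE.
  rewrite -Pv -[v in RHS]vsubmxK /pivot_mx !mul_row_col mulmxDr !mulmxA.
  congr (_ + _).
    rewrite -[in LHS]ZC -!mulmxA [C^T *m _]mulmxA mulmxV ?unitmx_tr // mul1mx.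
    by rewrite !mulmxA.
  congr (_ *m _); apply/matrixP => i t; rewrite mxE qcolZ -[(x.+1 + t)%N]/((x + t).+1) DE -qcolZ.
  by rewrite mxE [RHS]mxE; apply: eq_bigr => s _; congr (_ * _); rewrite [RHS]mxE.
apply: (canRL (mulKVmx C_unit)); rewrite mulmxA.
have -> : invmx C *m G = G *m C^T.
  by rewrite -[in LHS]GC -!mulmxA mulKmx.
by rewrite mulmxA -(mulmxA G) mulmxV ?unitmx_tr // mulmx1.
Qed.

(** The vectors [G *m tau x] obey the same recursion as the columns of V, so both sequences differ
    by one fixed matrix B commuting with C. Thus T is V up to a left factor and positive column
    factors. *)
Lemma twmx_cyc_gt0s_aux x0 : minors_gt0s (twmx e V Z x0).
Proof.
pose W := qwin e V 0 k.+1.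
have W_unit : W \in unitmx.
  rewrite unitmxE unitfE; apply/det_neq0P => a aW.
  have cV : cyc_free V by apply: minors_gt0_cyc_free; [lia|exact: cyc_mx_minors_gt0].
  apply: (((cyc_freeE _ (rsign_neq0 R k.+1)).1 cV) 0%N) => t ltt.
  have aW0 : (a *m W) 0 (Ordinal ltt) = 0 by rewrite aW mxE.
  apply/matrixP => i j; rewrite !ord1 [RHS]mxE -[RHS]aW0.
  by rewrite [RHS]mxE [LHS]mxE; apply: eq_bigr => s _; congr (_ * _); rewrite [RHS]mxE.
(* Coordinates of [G *m tau x0] on the columns V(0), ..., V(k). As V(i) is [C ^+ i] applied to V(0),
   they define B as a polynomial in C matching the two sequences at their start. *)
pose c : 'cV_k.+1 := invmx W *m (G *m tau x0).
pose B := \sum_(i < k.+1) c i 0 *: C ^+ i.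
have CX i x : C ^+ i *m qcol e V x = qcol e V (x + i).
  elim: i => [|i IHi]; first by rewrite addn0 mul1mx.
  by rewrite exprS -mulmxE -mulmxA IHi !qcolV -CE addnS.
have tauE j : G *m tau (x0 + j) = B *m qcol e V j.
  elim: j => [|j IHj].
    rewrite addn0 mulmx_suml.
    transitivity (W *m c); first by rewrite /c mulKVmx.
    apply/colP => i; rewrite mxE summxE; apply: eq_bigr => t _.
    by rewrite -scalemxAl CX [RHS]mxE mulrC; congr (_ * _); rewrite mxE.
  rewrite addnS tauS IHj !mulmx_suml mulmx_sumr; apply: eq_bigr => t _.
  by rewrite -!scalemxAl -scalemxAr !CX !qcolV -CE addSn.
have twE : twmx e V Z x0 =
    invmx G *m B *m V *m diag_mx (\row_(j < n.+1) \det (P (x0 + j))).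
  apply/matrixP => i j; rewrite mul_mx_diag [LHS]mxE [RHS]mxE twcolE [LHS]mxE.
  rewrite [X in _ = _ * X]mxE mulrC; congr (_ * _).
  have -> : tau (x0 + j) = invmx G *m B *m col j V.
    by rewrite -mulmxA -(qcol_small e) -tauE mulKmx.
  by rewrite colE mulmxA -colE mxE.
have detE (g : 'I_k.+1 -> 'I_n.+1) : \det (colsub g (twmx e V Z x0)) =
    \det (invmx G *m B) * (\det (colsub g V) * \prod_s \det (P (x0 + g s))).
  have -> : colsub g (twmx e V Z x0) = invmx G *m B *m
      (colsub g V *m diag_mx (\row_s \det (P (x0 + g s)))).
    apply/matrixP => i j; rewrite twE mxE mulmxA !mul_mx_diag [LHS]mxE [RHS]mxE.
    by rewrite mulmx_colsub !mxE.
  by rewrite !det_mulmx det_diag; congr (_ * (_ * _)); apply: eq_bigr => s _; rewrite mxE.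
move=> g h gi hi; rewrite !detE mulrACA mulr_gt0 //; last first.
  by apply: mulr_gt0; apply: mulr_gt0; rewrite ?cyc_mx_minors_gt0 //; apply: prodr_gt0.
(* A left kernel vector of this factor would kill all columns of T, against the nonvanishing of its
   consecutive minors. *)
suff : \det (invmx G *m B) != 0 by rewrite -expr2 exprn_even_gt0.
apply/det_neq0P => a aB.
have cT : cyc_free (twmx e V Z x0).
  apply: twmx_cyc_free => // [x|]; first by rewrite gt_eqF.
  by apply: minors_gt0_cyc_free => //; apply: cyc_mx_minors_gt0.
by apply: (cT 0%N) => t _; rewrite twE !mulmxA -(mulmxA a) aB !mul0mx mxE.
Qed.

End Rotated.

Lemma twmx_cyc_gt0s x0 : minors_gt0s (twmx e V Z x0).
Proof.
have [C CE] := cyc_vec_rot R n k.+1; have [D DE] := cyc_vec_rot R n (k.+1 + m).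
exact: twmx_cyc_gt0s_aux CE DE x0.
Qed.

End CyclicTwist.

(** * Total positivity of the twist *)

Section MapTwist.
Variables (R S : comNzRingType) (f : {rmorphism R -> S}).

Lemma map_qcol e r n (A : 'M[R]_(r, n.+1)) x :
  map_mx f (qcol e A x) = qcol (f e) (map_mx f A) x.
Proof. by rewrite /qcol map_mxZ rmorphXn map_col. Qed.

Lemma map_qwin e r n (A : 'M[R]_(r, n.+1)) x m :
  map_mx f (qwin e A x m) = qwin (f e) (map_mx f A) x m.
Proof. by apply/matrixP => i t; rewrite [LHS]mxE !mxE rmorphM rmorphXn. Qed.

Lemma map_twmx e k m n (V : 'M[R]_(k, n.+1)) (Z : 'M[R]_(k + m, n.+1)) x0 :
  map_mx f (twmx e V Z x0) = twmx (f e) (map_mx f V) (map_mx f Z) x0.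
Proof.
apply/matrixP => i c; rewrite [LHS]mxE [twmx _ _ _ _ _ _]mxE [RHS]mxE /twcol /pivot_mx.
transitivity (map_mx f (usubmx (\adj (row_mx (Z *m V^T) (qwin e Z (x0 + c) m)) *m
   qcol e Z (x0 + c + m))) i 0); first by rewrite [RHS]mxE.
by rewrite map_usubmx map_mxM map_mx_adj map_row_mx map_mxM map_trmx map_qwin map_qcol.
Qed.

End MapTwist.

(** * Polynomial paths of totally positive matrices *)

Section Flow.
Variable R : rcfType.

Lemma horner_gauss_mx n (p : {poly R}) t :
  evmx t (gauss_mx p n) = gauss_mx p.[t] n.
Proof. by apply/matrixP => i j; rewrite !mxE /horner_eval horner_exp. Qed.

(** The factor 1/2 keeps the kernel parameter strictly below 1 at the end t = 1 of the path. *)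
Definition half_X : {poly R} := (2%:R^-1)%:P * 'X.

Lemma half_XE t : half_X.[t] = 2%:R^-1 * t.
Proof. by rewrite /half_X !hornerE. Qed.

Lemma half_X_bounds t : 0 < t <= 1 -> 0 < half_X.[t] < 1.
Proof. by rewrite half_XE => /andP[t0 t1]; apply/andP; split; lra. Qed.

Definition gauss_path k n (A : 'M[R]_(k, n)) : 'M[{poly R}]_(k, n) :=
  map_mx polyC A *m gauss_mx half_X n.

Lemma evmxM a b c t (A : 'M[{poly R}]_(a, b)) (B : 'M[{poly R}]_(b, c)) :
  evmx t (A *m B) = evmx t A *m evmx t B.
Proof. exact: map_mxM. Qed.

Lemma evmx_polyC a b t (A : 'M[R]_(a, b)) : evmx t (map_mx polyC A) = A.
Proof. by apply/matrixP => i j; rewrite !mxE /horner_eval hornerC. Qed.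

Lemma gauss_pathE k n (A : 'M[R]_(k, n)) t :
  evmx t (gauss_path A) = A *m gauss_mx half_X.[t] n.
Proof. by rewrite evmxM evmx_polyC horner_gauss_mx. Qed.

Lemma gauss_path0 k n (A : 'M[R]_(k, n)) : evmx 0 (gauss_path A) = A.
Proof. by rewrite gauss_pathE half_XE mulr0 gauss_mx0 mulmx1. Qed.

Lemma gauss_path_gt0 k n (A : 'M[R]_(k, n)) t : 0 < t <= 1 ->
  minors_ge0 A -> row_free A -> minors_gt0 (evmx t (gauss_path A)).
Proof.
by move=> /half_X_bounds t01 pA fA; rewrite gauss_pathE; apply: minors_mulmx_gauss_gt0.
Qed.

Section Contract.
Variables (k n : nat) (lekn : (k <= n)%N) (A : 'M[R]_(k, n)).
Hypothesis pA : minors_gt0 A.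

Definition first_cols : 'M[R]_k := colsub (widen_ord lekn) A.
Definition reduced_mx : 'M[R]_(k, n) := invmx first_cols *m A.

Let w_incr : incr (widen_ord lekn).
Proof. by move=> i j. Qed.

Lemma first_cols_gt0 : 0 < \det first_cols.
Proof. exact: pA. Qed.

Lemma first_cols_unit : first_cols \in unitmx.
Proof. by rewrite unitmxE unitfE gt_eqF // first_cols_gt0. Qed.

Let reduced_first a (i : 'I_k) : reduced_mx a (widen_ord lekn i) = (a == i)%:R.
Proof.
have : colsub (widen_ord lekn) reduced_mx = 1%:M.
  by rewrite -mulmx_colsub mulVmx // first_cols_unit.
by move/matrixP/(_ a i); rewrite !mxE.
Qed.

Let reduced_gt0 : minors_gt0 reduced_mx.
Proof.
move=> g gi; rewrite -mulmx_colsub det_mulmx mulr_gt0 ?pA //.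
by rewrite det_inv invr_gt0 first_cols_gt0.
Qed.

(* [1 | C] is contracted to [1 | 0] by conjugating with diagonal matrices,
   while being mollified by a Gaussian kernel. *)
Definition contraction : 'M[{poly R}]_(k, n) :=
  \matrix_(a, i) (if (i < k)%N then ((a : nat) == i)%:R
                  else (reduced_mx a i)%:P * (1 - 'X) ^+ (i - a)).

Definition contract_path : 'M[{poly R}]_(k, n) := contraction *m gauss_mx half_X n.

Lemma contractionE t a i : evmx t contraction a i =
  if (i < k)%N then ((a : nat) == i)%:R else reduced_mx a i * (1 - t) ^+ (i - a).
Proof.
rewrite !mxE /horner_eval; case: ifP => _.
  by rewrite -polyC_natr hornerC.
by rewrite hornerM hornerC horner_exp !hornerE.
Qed.

Lemma contraction_gt0 t : t < 1 -> minors_gt0 (evmx t contraction).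
Proof.
move=> t1 g gi; have e0 : 0 < 1 - t by rewrite subr_gt0.
have -> : colsub g (evmx t contraction) =
    diag_mx (\row_a ((1 - t) ^- a)) *m colsub g reduced_mx *m
    diag_mx (\row_s (1 - t) ^+ g s).
  apply/matrixP => a s; rewrite [LHS]mxE contractionE mul_mx_diag [RHS]mxE mul_diag_mx.
  rewrite [X in _ = X * _]mxE [X in _ = X * _ * _]mxE [X in _ = _ * X * _]mxE.
  rewrite [X in _ = _ * X]mxE.
  have en0 p : (1 - t) ^+ p != 0 by rewrite expf_neq0 // gt_eqF.
  case: ifP => gsk.
    have -> : g s = widen_ord lekn (Ordinal gsk) by apply: val_inj.
    rewrite reduced_first -val_eqE /=; case: eqP => [->|_].
      by rewrite mulr1 mulVf.
    by rewrite mulr0 mul0r.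
  have ags : (a <= g s)%N by have := ltn_ord a; lia.
  rewrite -[in RHS](subnK ags) exprD [RHS]mulrAC mulrC; congr (_ * _).
  by rewrite mulrCA mulVf // mulr1.
rewrite !det_mulmx !det_diag mulr_gt0 //; first rewrite mulr_gt0 //.
- by apply: prodr_gt0 => a _; rewrite mxE invr_gt0 exprn_gt0.
- exact: reduced_gt0.
- by apply: prodr_gt0 => s _; rewrite mxE exprn_gt0.
Qed.

Lemma contraction_ge0 t : t <= 1 -> minors_ge0 (evmx t contraction).
Proof.
rewrite le_eqVlt => /predU1P[->|t1]; last exact/minors_gt0W/contraction_gt0.
move=> g gi; rewrite det_evmx; apply: (@poly_ge0_noroot _ _ 0); first exact: ler01.
  by rewrite -det_evmx contraction_gt0 // ltr01.
move=> y /andP[_ y1]; rewrite rootE gt_eqF // -det_evmx.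
exact: contraction_gt0.
Qed.

Lemma contraction_free t : row_free (evmx t contraction).
Proof.
apply/row_free_minorP; exists (widen_ord lekn) => //.
have -> : colsub (widen_ord lekn) (evmx t contraction) = 1%:M.
  by apply/matrixP => a i; rewrite mxE contractionE /= ltn_ord mxE.
by rewrite det1 oner_eq0.
Qed.

Lemma contract_path0 : evmx 0 contract_path = reduced_mx.
Proof.
rewrite evmxM horner_gauss_mx half_XE mulr0 gauss_mx0 mulmx1.
apply/matrixP => a i; rewrite contractionE subr0 expr1n mulr1; case: ifP => // ik.
have -> : i = widen_ord lekn (Ordinal ik) by apply: val_inj.
by rewrite reduced_first.
Qed.

(** The endpoint is independent of [A], so any two contraction paths can be joined there. *)
Lemma contract_path1 : evmx 1 contract_path =
  (\matrix_(a, i) ((a : nat) == i)%:R) *m gauss_mx half_X.[1] n.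
Proof.
rewrite evmxM horner_gauss_mx; congr (_ *m _).
apply/matrixP => a i; rewrite contractionE [RHS]mxE subrr; case: ifP => // /negbT.
rewrite -leqNgt => ki; have ai : (a < i)%N := leq_trans (ltn_ord a) ki.
by rewrite expr0n subn_eq0 leqNgt ai mulr0 (ltn_eqF ai).
Qed.

(** In general the contraction alone loses strictness at t = 1; the kernel restores it for t > 0. At
    t = 0 the kernel is the identity and the reduced matrix is already totally positive. *)
Lemma contract_path_gt0 t : 0 <= t <= 1 -> minors_gt0 (evmx t contract_path).
Proof.
move=> /andP[]; rewrite le_eqVlt => /predU1P[<- _|t0 t1].
  by rewrite contract_path0; apply: reduced_gt0.
rewrite evmxM horner_gauss_mx; apply: minors_mulmx_gauss_gt0.
- by rewrite half_X_bounds // t0.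
- exact: contraction_ge0.
- exact: contraction_free.
Qed.

End Contract.
End Flow.

Section TwistMinors.
Variables (R : rcfType) (k m n : nat).
Hypothesis m_even : ~~ odd m.
Hypothesis le_kmn : (k + m <= n.+1)%N.
Implicit Types (V : 'M[R]_(k, n.+1)) (Z : 'M[R]_(k + m, n.+1)).
Local Notation e := (rsign R k).

Lemma evmx_twmx t (V : 'M[{poly R}]_(k, n.+1)) (Z : 'M[{poly R}]_(k + m, n.+1)) x0 :
  evmx t (twmx (rsign _ k)%:P V Z x0) = twmx e (evmx t V) (evmx t Z) x0.
Proof. by rewrite /evmx map_twmx /= /horner_eval hornerC. Qed.

Lemma twmx_path (V : 'M[{poly R}]_(k, n.+1)) (Z : 'M[{poly R}]_(k + m, n.+1)) x0 :
  (forall t : R, 0 <= t <= 1 -> minors_gt0 (evmx t V) /\ minors_gt0 (evmx t Z)) ->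
  minors_gt0s (twmx e (evmx 0 V) (evmx 0 Z) x0) ->
  minors_gt0s (twmx e (evmx 1 V) (evmx 1 Z) x0).
Proof.
move=> pVZ; rewrite -!evmx_twmx; apply: minors_gt0s_path => t /pVZ[pV pZ].
rewrite evmx_twmx; apply: twmx_cyc_free => [x|].
  by rewrite gt_eqF // det_pivot_tp_gt0.
exact: minors_gt0_cyc_free.
Qed.

(** The solution of the pivot system changes by the inverse transpose of B and its determinant by
    the scalar factor. Up to row operations the twist thus depends only on the row spans, which
    allows row reduction before contracting. *)
Lemma twmx_mul (B : 'M[R]_k) (D : 'M[R]_(k + m)) V Z x0 :
  B \in unitmx -> D \in unitmx -> minors_gt0 V -> minors_gt0 Z ->
  twmx e (B *m V) (D *m Z) x0 =
  (\det D * \det B) *: invmx B^T *m twmx e V Z x0.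
Proof.
move=> uB uD pV pZ.
have twE x : twcol e (B *m V) (D *m Z) x =
    (\det D * \det B) *: invmx B^T *m twcol e V Z x.
  have P0 : \det (pivot_mx e V Z x) != 0 by rewrite gt_eqF // det_pivot_tp_gt0.
  have uP : pivot_mx e V Z x \in unitmx by rewrite unitmxE unitfE.
  have PE : pivot_mx e (B *m V) (D *m Z) x =
      D *m pivot_mx e V Z x *m block_mx B^T 0 0 1%:M.
    rewrite /pivot_mx mul_mx_row mul_row_block !mulmx0 addr0 add0r mulmx1.
    rewrite trmx_mul !mulmxA; congr row_mx.
    apply/matrixP => i t; rewrite mxE mulmx_qcol mxE [RHS]mxE.
    by apply: eq_bigr => s _; rewrite [qwin _ _ _ _ _ _]mxE.
  set v := invmx (pivot_mx e V Z x) *m qcol e Z (x + m).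
  have vE : pivot_mx e V Z x *m v = qcol e Z (x + m) by rewrite mulmxA mulmxV ?mul1mx.
  have h1 : \det (pivot_mx e V Z x) *: usubmx v = twcol e V Z x.
    rewrite -[RHS]scale1r; apply: (twcol_solve (b := dsubmx v)).
    by rewrite vsubmxK vE scale1r.
  have h2 : \det (pivot_mx e (B *m V) (D *m Z) x) *: (invmx B^T *m usubmx v) =
      twcol e (B *m V) (D *m Z) x.
    rewrite -[RHS]scale1r; apply: (twcol_solve (b := dsubmx v)).
    rewrite PE -(mulmxA (D *m _)) mul_block_col !mul0mx addr0 add0r mul1mx.
    rewrite mulmxA mulmxV ?unitmx_tr //.
    by rewrite mul1mx vsubmxK -mulmxA vE mulmx_qcol scale1r.
  rewrite -h2 PE !det_mulmx det_ublock det1 mulr1 det_tr -h1.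
  rewrite -!scalemxAr -!scalemxAl scalerA; congr (_ *: _).
  by rewrite -mulrA mulrCA mulrC.
apply/matrixP => i c; rewrite [LHS]mxE twE mxE [RHS]mxE.
by apply: eq_bigr => s _; rewrite [twmx _ _ _ _ _ _]mxE.
Qed.

Lemma minors_gt0s_mul k' n' (B : 'M[R]_k') (A : 'M[R]_(k', n')) : B \in unitmx ->
  minors_gt0s (B *m A) <-> minors_gt0s A.
Proof.
move=> uB; have B0 : 0 < \det B * \det B.
  by rewrite -expr2 exprn_even_gt0 // -unitfE -unitmxE.
by split=> pA g h gi hi; have := pA g h gi hi;
  rewrite -!mulmx_colsub !det_mulmx mulrACA (pmulr_rgt0 _ B0).
Qed.

Lemma twmx_mul_gt0s (B : 'M[R]_k) (D : 'M[R]_(k + m)) V Z x0 :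
  B \in unitmx -> D \in unitmx -> minors_gt0 V -> minors_gt0 Z ->
  minors_gt0s (twmx e (B *m V) (D *m Z) x0) <-> minors_gt0s (twmx e V Z x0).
Proof.
move=> uB uD pV pZ; rewrite twmx_mul //; apply: minors_gt0s_mul.
rewrite unitmxZ ?unitmx_inv ?unitmx_tr //.
by rewrite unitrM -!unitmxE uB uD.
Qed.

Definition flip_path r (A : 'M[{poly R}]_(r, n.+1)) : 'M[{poly R}]_(r, n.+1) :=
  map_mx (fun p => p \Po (1 - 'X)) A.

Lemma flip_pathE r (A : 'M[{poly R}]_(r, n.+1)) t : evmx t (flip_path A) = evmx (1 - t) A.
Proof.
apply/matrixP => i j; rewrite !mxE /horner_eval horner_comp.
by rewrite !hornerE.
Qed.

(** Both pairs are row reduced and contracted to the same point; positivity travels along the first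
    path and back along the second one reversed. *)
Lemma twmx_connected V Z V' Z' x0 :
  minors_gt0 V -> minors_gt0 Z -> minors_gt0 V' -> minors_gt0 Z' ->
  minors_gt0s (twmx e V Z x0) -> minors_gt0s (twmx e V' Z' x0).
Proof.
move=> pV pZ pV' pZ'.
have lek : (k <= n.+1)%N by apply: leq_trans le_kmn; rewrite leq_addr.
have uV : invmx (first_cols lek V) \in unitmx by rewrite unitmx_inv first_cols_unit.
have uV' : invmx (first_cols lek V') \in unitmx by rewrite unitmx_inv first_cols_unit.
have uZ : invmx (first_cols le_kmn Z) \in unitmx by rewrite unitmx_inv first_cols_unit.
have uZ' : invmx (first_cols le_kmn Z') \in unitmx by rewrite unitmx_inv first_cols_unit.
have c0 r (lern : (r <= n.+1)%N) (A : 'M[R]_(r, n.+1)) : minors_gt0 A ->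
    evmx 0 (contract_path lern A) = invmx (first_cols lern A) *m A.
  exact: contract_path0.
have c1 r (lern : (r <= n.+1)%N) (A B : 'M[R]_(r, n.+1)) : minors_gt0 A -> minors_gt0 B ->
    evmx 1 (contract_path lern A) = evmx 1 (contract_path lern B).
  by move=> pA pB; rewrite !contract_path1.
move=> /(twmx_mul_gt0s x0 uV uZ pV pZ).2; rewrite -(c0 _ lek) // -(c0 _ le_kmn) // => h.
have {h} := @twmx_path (contract_path lek V) (contract_path le_kmn Z) x0 _ h.
rewrite (c1 _ lek V V') // (c1 _ le_kmn Z Z') // => h.
apply/(twmx_mul_gt0s x0 uV' uZ' pV' pZ').1.
have := @twmx_path (flip_path (contract_path lek V'))
  (flip_path (contract_path le_kmn Z')) x0.
rewrite !flip_pathE subr0 subrr -(c0 _ lek) // -(c0 _ le_kmn) //; apply.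
  move=> t /andP[t0 t1]; rewrite !flip_pathE.
  by split; apply: contract_path_gt0 => //; apply/andP; split; lra.
by apply: h => t t01; split; apply: contract_path_gt0.
Qed.

End TwistMinors.

Section TwistMain.
Variables (R : realType) (k m n : nat).
Hypothesis m_even : ~~ odd m.
Hypothesis le_kmn : (k + m <= n.+1)%N.
Implicit Types (V : 'M[R]_(k, n.+1)) (Z : 'M[R]_(k + m, n.+1)).
Local Notation e := (rsign R k).

Lemma twmx_gt0s V Z x0 : minors_gt0 V -> minors_gt0 Z -> minors_gt0s (twmx e V Z x0).
Proof.
case: k V Z le_kmn => [|k'] V Z lekm pV pZ.
  by move=> g h gi hi; rewrite !det_mx00 mulr1 ltr01.
apply: (twmx_connected m_even lekm _ _ pV pZ (twmx_cyc_gt0s R m_even lekm x0));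
  exact: cyc_mx_minors_gt0.
Qed.

Lemma twmx_ge0s V Z x0 : minors_ge0 V -> row_free V -> minors_ge0 Z -> row_free Z ->
  minors_ge0s (twmx e V Z x0).
Proof.
move=> pV fV pZ fZ.
have := @minors_ge0s_limit _ _ _ (twmx (rsign _ k)%:P (gauss_path V) (gauss_path Z) x0).
rewrite evmx_twmx !gauss_path0; apply => t t01; rewrite evmx_twmx.
by apply: twmx_gt0s; apply: gauss_path_gt0.
Qed.

(** The limit supplies the weak signs for a nonnegative V; nonzero pivots supply the consecutive
    minors that make them strict. *)
Lemma twmx_strict V Z x0 : minors_ge0 V -> row_free V -> minors_gt0 Z ->
  (forall x, \det (pivot_mx e V Z x) != 0) -> minors_gt0s (twmx e V Z x0).
Proof.
move=> pV fV pZ N0 g h gi hi.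
have pT : minors_ge0s (twmx e V Z x0).
  by apply: twmx_ge0s => //; [exact: minors_gt0W|exact: minors_gt0_row_free].
have cT : cyc_free (twmx e V Z x0).
  by apply: twmx_cyc_free => //; apply: minors_gt0_cyc_free.
by rewrite lt_def pT // andbT mulf_neq0 //; apply: minors_neq0.
Qed.

End TwistMain.

(** * Complementary minors *)

Lemma lift_permP n (s : 'S_n.+1) : exists s' : 'S_n, s = lift_perm ord0 (s ord0) s'.
Proof.
have ex i : {j | s (lift ord0 i) = lift (s ord0) j}.
  have : s ord0 != s (lift ord0 i) by rewrite (inj_eq perm_inj) neq_lift.
  by case/unlift_some => j jE _; exists j.
pose f i := sval (ex i); have fE i : s (lift ord0 i) = lift (s ord0) (f i) := svalP (ex i).
have finj : injective f.
  move=> i j fij; apply: (@lift_inj _ ord0); apply: (@perm_inj _ s).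
  by rewrite !fE fij.
exists (perm finj); apply/permP => i; case: (unliftP ord0 i) => [j ->|->].
  by rewrite lift_perm_lift permE fE.
by rewrite lift_perm_id.
Qed.

(** Induction on q: the first value accounts for s(0) inversions, and after its removal each other
    selected value drops by one together with its position, which preserves the parity of their
    sum. *)
Lemma odd_shuffle q k (s : 'S_(q + k)) :
  incr (s \o lshift k) -> incr (s \o @rshift q k) ->
  odd_perm s = odd (\sum_(t < q) (s (lshift k t) + t)).
Proof.
elim: q s => [|q IHq] s ls rs.
  rewrite big_ord0 /=; suff -> : s = 1%g by rewrite odd_perm1.
  apply/permP => i; rewrite perm1.
  have r0 (j : 'I_k) : rshift 0 j = j by apply: val_inj.
  have si : incr (fun j : 'I_k => s j : 'I_k).
    by move=> a b ltab; have := rs a b ltab; rewrite /= !r0.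
  exact: (incr_full si).
have [s' sE] := lift_permP (s : 'S_(q + k).+1).
have l0 : lshift k (@ord0 q) = (@ord0 (q + k)) by apply: val_inj.
have lS (t : 'I_q) : lshift k (lift ord0 t) = lift (@ord0 (q + k)) (lshift k t).
  by apply: val_inj.
have rS (t : 'I_k) : rshift q.+1 t = lift (@ord0 (q + k)) (rshift q t).
  by apply: val_inj.
set j0 := s ord0 in sE.
have sL (i : 'I_(q + k)) : s (lift ord0 i) = lift j0 (s' i).
  by rewrite [in LHS]sE lift_perm_lift.
have mono (a b : 'I_(q + k)) : (lift j0 a < lift j0 b)%N = (a < b)%N.
  by rewrite /= /bump; case: leqP; case: leqP => /=; lia.
have sl (t : 'I_q) : s (lift ord0 (lshift k t)) = (s' (lshift k t)).+1 :> nat.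
  have : (s (lshift k ord0) < s (lshift k (lift ord0 t)))%N by apply: ls.
  by rewrite l0 lS -/j0 sL /= /bump; case: leqP => /=; lia.
rewrite big_ord_recl /= l0 -/j0 addn0.
under eq_bigr => t _ do rewrite lS sl /bump /= add1n addSnnS.
have -> : odd_perm s = odd j0 (+) odd_perm s' by rewrite sE odd_lift_perm.
rewrite (IHq s'); first last.
- by move=> a b ltab; have := rs a b ltab; rewrite /= !rS !sL mono.
- move=> a b ltab; have := ls (lift ord0 a) (lift ord0 b).
  by rewrite /= !lS !sL mono; apply.
rewrite oddD; congr (_ (+) _).
elim/big_ind2: _ => // [x1 x2 y1 y2 h1 h2|t _]; first by rewrite !oddD h1 h2.
by rewrite !addnS /= negbK.
Qed.

Definition altmx (R : nzRingType) r n (A : 'M[R]_(r, n)) : 'M[R]_(r, n) :=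
  \matrix_(i, c) ((-1) ^+ c * A i c).

Lemma altmxK (R : comNzRingType) r n : involutive (@altmx R r n).
Proof. by move=> A; apply/matrixP => i c; rewrite !mxE mulrA -expr2 sqrr_sign mul1r. Qed.

Lemma altmx_gram (R : comNzRingType) r s n (A : 'M[R]_(r, n)) (B : 'M[R]_(s, n)) :
  altmx A *m (altmx B)^T = A *m B^T.
Proof.
apply/matrixP => i j; rewrite !mxE; apply: eq_bigr => c _.
by rewrite !mxE mulrACA -expr2 sqrr_sign mul1r.
Qed.

Lemma mulmx_alt (R : comNzRingType) r s n (A : 'M[R]_(r, n)) (B : 'M[R]_(s, r)) :
  B *m altmx A = altmx (B *m A).
Proof.
apply/matrixP => i j; rewrite !mxE big_distrr /=; apply: eq_bigr => c _.
by rewrite !mxE mulrCA.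
Qed.

Lemma det_colsub_alt (R : comNzRingType) q n (A : 'M[R]_(q, n)) (g : 'I_q -> 'I_n) :
  \det (colsub g (altmx A)) = (-1) ^+ (\sum_t g t)%N * \det (colsub g A).
Proof.
have -> : colsub g (altmx A) = colsub g A *m diag_mx (\row_t (-1) ^+ g t).
  by apply/matrixP => i j; rewrite mul_mx_diag !mxE mulrC.
rewrite det_mulmx det_diag mulrC -prodrXr; congr (_ * _).
by apply: eq_bigr => t _; rewrite mxE.
Qed.

Lemma incr_complement q k (g : 'I_q -> 'I_(q + k)) : incr g ->
  exists2 s : 'S_(q + k), s \o lshift k =1 g & incr (s \o @rshift q k).
Proof.
move=> gi; pose D := ~: [set g t | t in 'I_q].
have cD : #|D| = k.
  rewrite cardsCs finset.setCK card_ord card_imset ?card_ord ?addKn //.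
  exact: incr_inj.
pose h0 (t : 'I_k) : 'I_(q + k) := enum_val (cast_ord (esym cD) t).
have h0inj : injective h0 by move=> a b /enum_val_inj/cast_ord_inj.
have [u hi] := injective_sort h0inj.
have hD t : h0 t \in D by apply: enum_valP.
pose f i := match split i with inl t => g t | inr t => h0 (u t) end.
have fl t : f (lshift k t) = g t by rewrite /f (unsplitK (inl _ t)).
have fr t : f (rshift q t) = h0 (u t) by rewrite /f (unsplitK (inr _ t)).
have gD t : g t \notin D by rewrite inE negbK imset_f.
have finj : injective f.
  move=> i j; case: (split_ordP i) => i' ->; case: (split_ordP j) => j' ->; rewrite ?fl ?fr.
  - by move=> /(incr_inj gi) ->.
  - by move=> gh; have := gD i'; rewrite gh hD.
  - by move=> gh; have := gD j'; rewrite -gh hD.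
  - by move=> /h0inj/perm_inj ->.
exists (perm finj) => [t|a b ltab]; rewrite /= !permE ?fl ?fr //.
exact: hi.
Qed.

(** Jacobi's identity. The row spaces are orthogonal complements, so the square matrix [X] is
    invertible; the sign of the shuffle by the complementary index set is absorbed by [altmx]. *)
Lemma complementary_minors (R : realFieldType) q k n
    (A : 'M[R]_(k, n)) (B : 'M[R]_(q, n)) : (q + k)%N = n ->
  row_free A -> row_free B -> A *m B^T = 0 ->
  exists2 c : R, c != 0 & forall g : 'I_q -> 'I_n, incr g ->
    exists2 h : 'I_k -> 'I_n, incr h &
      \det (colsub g (altmx B)) = c * \det (colsub h A).
Proof.
move=> nE; subst n => fA fB AB.
have BA : B *m A^T = 0 by apply: trmx_inj; rewrite trmx_mul trmxK AB trmx0.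
have uA := gram_unit fA; have uB := gram_unit fB.
pose X := row_mx B^T A^T.
have X0 : \det X != 0.
  suff : \det (col_mx B A *m X) != 0 by rewrite det_mulmx mulf_eq0 negb_or => /andP[].
  rewrite mul_col_row AB BA det_ublock mulf_neq0 // -unitfE -unitmxE //.
pose c := (-1) ^+ (\sum_(t < q) t)%N * (\det X / \det (A *m A^T)).
exists c; first by rewrite !mulf_neq0 ?signr_eq0 ?invr_eq0 // -unitfE -unitmxE.
move=> g gi; have [s sg si] := incr_complement gi.
exists (s \o @rshift q k) => //.
rewrite det_colsub_alt.
have gE : colsub g B = colsub (s \o lshift k) B.
  by apply/matrixP => i j; rewrite !mxE -sg.
pose B1 := colsub (s \o lshift k) B; pose A1 := colsub (s \o lshift k) A.
pose A2 := colsub (s \o @rshift q k) A; pose B2 := colsub (s \o @rshift q k) B.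
have AE : colsub s A = row_mx A1 A2.
  by apply/matrixP => i j; rewrite mxE; case: (split_ordP j) => j' ->;
    rewrite ?row_mxEl ?row_mxEr mxE.
have BE : colsub s B = row_mx B1 B2.
  by apply/matrixP => i j; rewrite mxE; case: (split_ordP j) => j' ->;
    rewrite ?row_mxEl ?row_mxEr mxE.
have gram r1 r2 (C : 'M[R]_(r1, _)) (D : 'M[R]_(r2, _)) :
    colsub s C *m (colsub s D)^T = C *m D^T.
  apply/matrixP => i j; rewrite !mxE [RHS](reindex_inj (@perm_inj _ s)) /=.
  by apply: eq_bigr => t _; rewrite !mxE.
have sX : rowsub s X = row_mx (colsub s B)^T (colsub s A)^T.
  by apply/matrixP => i j; rewrite mxE; case: (split_ordP j) => j' ->;
    rewrite ?row_mxEl ?row_mxEr !mxE.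
(* Multiplication by the block matrix with rows (1, 0) and (A1, A2) makes the permuted [X] block
   triangular; compare determinants. *)
have key : \det A2 * ((-1) ^+ s * \det X) = \det B1 * \det (A *m A^T).
  have -> : (-1) ^+ s * \det X = \det (rowsub s X).
    by rewrite -row_permEsub row_permE det_mulmx det_perm.
  have -> : \det A2 = \det (block_mx (1%:M : 'M_q) 0 A1 A2).
    by rewrite det_lblock det1 mul1r.
  rewrite -det_mulmx.
  have -> : block_mx (1%:M : 'M_q) 0 A1 A2 *m rowsub s X =
      block_mx B1^T A1^T 0 (A *m A^T).
    rewrite -[block_mx _ _ _ _ in LHS]/(col_mx (row_mx 1%:M 0) (row_mx A1 A2)).
    rewrite sX mul_col_row -AE !gram AB; congr block_mx.
      by rewrite BE tr_row_mx mul_row_col mul1mx mul0mx addr0.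
    by rewrite AE tr_row_mx mul_row_col mul1mx mul0mx addr0.
  by rewrite det_ublock det_tr.
have sgnE : (-1) ^+ (\sum_t g t)%N = (-1) ^+ (\sum_(t < q) t)%N * (-1) ^+ s :> R.
  rewrite odd_shuffle //; last by move=> a b /gi; rewrite /= -!sg.
  rewrite signr_odd big_split /= exprD mulrCA -expr2 sqrr_sign mulr1.
  by congr (_ ^+ _); apply: eq_bigr => t _; rewrite -sg.
rewrite gE sgnE /c -/B1 -/A2.
have dA0 : \det (A *m A^T) != 0 by rewrite -unitfE -unitmxE.
have -> : \det B1 = \det A2 * ((-1) ^+ s * \det X) / \det (A *m A^T).
  by rewrite key mulfK.
have ss : (-1) ^+ s * (-1) ^+ s = 1 :> R by rewrite -expr2 sqrr_sign.
set a := (-1) ^+ _; set b := (-1) ^+ s; set x := \det X; set y := \det A2; set z := _^-1.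
have -> : a * b * (y * (b * x) * z) = (b * b) * (a * (x * z) * y) by ring.
by rewrite ss mul1r.
Qed.

(** * The stacked twist map *)

Section SignRepresentative.
Variable R : realFieldType.

Lemma det_colsub_mulmx k n (A : 'M[R]_(k, n)) (D : 'M[R]_k) g :
  \det (colsub g (D *m A)) = \det D * \det (colsub g A).
Proof. by rewrite -mulmx_colsub det_mulmx. Qed.

(** Scaling one row by a nonzero maximal minor, if there is one, makes every minor nonnegative. *)
Lemma minors_ge0s_rep k n (A : 'M[R]_(k, n)) : minors_ge0s A ->
  exists2 D : 'M[R]_k, D \in unitmx & minors_ge0 (D *m A).
Proof.
move=> pA; case: k A pA => [|k] A pA.
  by exists 1%:M; rewrite ?unitmx1 // => g gi; rewrite det_mx00 ler01.
have [g0 h0] : exists s : R, s != 0 /\ forall g, incr g -> 0 <= s * \det (colsub g A).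
  case: (pselect (exists2 g : 'I_k.+1 -> 'I_n, incr g & \det (colsub g A) != 0)).
    move=> [g gi gn0]; exists (\det (colsub g A)); split=> // h hi; exact: pA.
  move=> no; exists 1; split=> [|g gi]; first exact: oner_neq0.
  rewrite mul1r; case: (eqVneq (\det (colsub g A)) 0) => [-> //|gn0].
  by case: no; exists g.
pose D : 'M[R]_k.+1 := diag_mx (\row_j if j == ord0 then g0 else 1).
have dD : \det D = g0.
  rewrite det_diag big_ord_recl mxE eqxx big1 ?mulr1 // => i _.
  by rewrite mxE eq_sym (negbTE (neq_lift _ _)).
exists D; first by rewrite unitmxE unitfE dD h0.1.
by move=> g gi; rewrite det_colsub_mulmx dD; apply: h0.2.
Qed.

Lemma minors_gt0s_rep k n (A : 'M[R]_(k, n)) : minors_gt0s A ->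
  exists2 D : 'M[R]_k, D \in unitmx & minors_gt0 (D *m A).
Proof.
move=> pA; have [|D uD pD] := @minors_ge0s_rep _ _ A.
  by move=> g h gi hi; apply/ltW/pA.
exists D => // g gi; rewrite lt_def pD // andbT det_colsub_mulmx.
rewrite mulf_neq0 //; first by rewrite -unitfE -unitmxE.
by apply/eqP => g0; have := pA g g gi gi; rewrite g0 mul0r ltxx.
Qed.

Lemma minors_gt0_gt0s k n (A : 'M[R]_(k, n)) : minors_gt0 A -> minors_gt0s A.
Proof. by move=> pA g h gi hi; rewrite mulr_gt0 ?pA. Qed.

Lemma minors_ge0_ge0s k n (A : 'M[R]_(k, n)) : minors_ge0 A -> minors_ge0s A.
Proof. by move=> pA g h gi hi; rewrite mulr_ge0 ?pA. Qed.

Lemma minors_scale_gt0s k n (A B : 'M[R]_(k, n)) (D : 'M[R]_k) (s : 'I_n -> R) :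
  (forall c, 0 < s c) -> D *m A *m diag_mx (\row_c s c) = B -> D \in unitmx ->
  (minors_ge0s B -> minors_ge0s A) /\ (minors_gt0s B -> minors_gt0s A).
Proof.
move=> s0 <- uD.
have detE g : \det (colsub g (D *m A *m diag_mx (\row_c s c))) =
    (\det D * \prod_t s (g t)) * \det (colsub g A).
  have -> : colsub g (D *m A *m diag_mx (\row_c s c)) =
      D *m (colsub g A *m diag_mx (\row_t s (g t))).
    apply/matrixP => i j; rewrite mulmxA !mul_mx_diag [LHS]mxE [LHS]mxE [RHS]mxE.
    rewrite mulmx_colsub; congr (_ * _); first by rewrite [RHS]mxE.
    by rewrite [LHS]mxE [RHS]mxE.
  rewrite !det_mulmx det_diag -mulrA; congr (_ * _); rewrite mulrC; congr (_ * _).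
  by apply: eq_bigr => t _; rewrite mxE.
have D0 : 0 < \det D * \det D by rewrite -expr2 exprn_even_gt0 // -unitfE -unitmxE.
have pos (g h : 'I_k -> 'I_n) :
    0 < \det D * (\prod_t s (g t)) * (\det D * (\prod_t s (h t))).
  by rewrite mulrACA mulr_gt0 // mulr_gt0 // prodr_gt0.
split=> p g h gi hi; have := p g h gi hi; rewrite !detE mulrACA.
  by rewrite (pmulr_rge0 _ (pos g h)).
by rewrite (pmulr_rgt0 _ (pos g h)).
Qed.

Lemma row_free_mull k n (D : 'M[R]_k) (A : 'M[R]_(k, n)) : D \in unitmx ->
  row_free (D *m A) = row_free A.
Proof. by move=> uD; rewrite /row_free eqmxMfull // row_full_unit. Qed.

End SignRepresentative.

Section Orthogonal.
Variable F : fieldType.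

Lemma perp_exists k q n (A : 'M[F]_(k, n)) : (q + k)%N = n -> row_free A ->
  exists2 B : 'M[F]_(q, n), row_free B & A *m B^T = 0.
Proof.
move=> qkn fA.
have rk : \rank (kermx A^T) = q.
  by rewrite mxrank_ker mxrank_tr (eqP fA) -qkn addnK.
move: (row_base_free (kermx A^T)) (eq_row_base (kermx A^T)).
move: (row_base (kermx A^T)); rewrite rk => B fB eB.
exists B => //; apply: trmx_inj; rewrite trmx_mul trmxK trmx0.
by apply/sub_kermxP; rewrite eB.
Qed.

Lemma perp_sub p q n r (A : 'M[F]_(p, n)) (B : 'M[F]_(q, n)) (v : 'M[F]_(r, n)) :
  (p + q)%N = n -> row_free A -> row_free B -> A *m B^T = 0 -> v *m B^T = 0 ->
  (v <= A)%MS.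
Proof.
move=> pqn fA fB AB vB.
have sAk : (A <= kermx B^T)%MS by apply/sub_kermxP.
have : (A == kermx B^T)%MS.
  by rewrite -(mxrank_leqif_eq sAk) mxrank_ker mxrank_tr (eqP fA) (eqP fB) -pqn addnK.
by move/eqmxP => ->; apply/sub_kermxP.
Qed.

Lemma perp_eqmx p q n (A : 'M[F]_(p, n)) (B : 'M[F]_(q, n)) :
  (p + q)%N = n -> row_free A -> row_free B -> A *m B^T = 0 -> (A :=: kermx B^T)%MS.
Proof.
move=> pqn fA fB AB.
have sAk : (A <= kermx B^T)%MS by apply/sub_kermxP.
apply/eqmxP.
by rewrite -(mxrank_leqif_eq sAk) mxrank_ker mxrank_tr (eqP fA) (eqP fB) -pqn addnK.
Qed.

Lemma eqmx_row_free_mull k n (A B : 'M[F]_(k, n)) : (A :=: B)%MS -> row_free B ->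
  exists2 D : 'M[F]_k, D \in unitmx & B = D *m A.
Proof.
move=> eAB fB; have /submxP[D DE] : (B <= A)%MS by rewrite eAB.
exists D => //; rewrite -row_free_unit -row_leq_rank -{1}(eqP fB) DE.
exact: mxrankM_maxl.
Qed.

End Orthogonal.

Lemma rank_factors (F : fieldType) d p (A : 'M[F]_(d, p)) (B : 'M[F]_(p, d)) :
  \det (A *m B) != 0 -> \rank A = d /\ \rank B = d.
Proof.
rewrite -unitfE -unitmxE => /mxrank_unit rAB.
have := mxrankM_maxl A B; have := mxrankM_maxr A B; rewrite rAB => hB hA.
by split; apply/eqP; rewrite eqn_leq ?rank_leq_row ?rank_leq_col ?hA ?hB.
Qed.

Section ColumnIndexing.
Variables (R : realType) (n : nat).
Local Notation N := n.+1.

(** Integer positions start at 1 and natural ones at 0; the sign 1 means plain periodicity. *)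
Lemma colz_nat p (A : 'M[R]_(p, N)) (x : nat) : colz A (x%:Z + 1) = qcol 1 A x.
Proof.
rewrite /colz addrK modz_nat absz_nat /qcol expr1n scale1r.
rewrite insubT ?ltn_pmod // => ltx; congr (col _ _).
by apply: val_inj; rewrite /= inordK.
Qed.

Lemma colz_period p (A : 'M[R]_(p, N)) (j d : int) : colz A (j + d * N%:Z) = colz A j.
Proof. by rewrite /colz (_ : j + d * N%:Z - 1 = d * N%:Z + (j - 1)) ?modzMDl //; ring. Qed.

Lemma signz_odd k : (-1) ^ (k%:Z - 1) = rsign R k.
Proof.
rewrite /rsign expfzDr ?oppr_eq0 ?oner_eq0 //= exprN1 invrN invr1 exprSr.
by rewrite -exprnP.
Qed.

Lemma colU_period k l (U : 'M[R]_(k + l, N)) (j : int) d :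
  colU U (j + d%:Z * N%:Z) = rsign R k ^+ d *: colU U j.
Proof.
rewrite /colU colz_period scalerA; congr (_ *: _).
rewrite (_ : j + d%:Z * N%:Z - 1 = d%:Z * N%:Z + (j - 1)); last by ring.
rewrite divzMDl // mulrDr expfzDr ?oppr_eq0 ?oner_eq0 //; congr (_ * _).
by rewrite -exprz_exp signz_odd exprnP.
Qed.

Lemma colU_nat k l (U : 'M[R]_(k + l, N)) (x : nat) :
  colU U (x%:Z + 1) = qcol (rsign R k) U x.
Proof.
rewrite /colU colz_nat /qcol expr1n scale1r addrK divz_nat.
by rewrite -exprz_exp signz_odd exprnP.
Qed.

Lemma colU_colz k l (U : 'M[R]_(k + l, N)) (j : int) :
  exists2 s : R, s != 0 & colU U j = s *: colz U j.
Proof.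
exists ((-1) ^ ((k%:Z - 1) * ((j - 1) %/ N%:Z)%Z)) => //.
by rewrite expfz_neq0 // oppr_eq0 oner_eq0.
Qed.

Lemma int_to_nat (j : int) : exists x d : nat, j + d%:Z * N%:Z = x%:Z + 1.
Proof.
pose d := (absz j).+1.
have h : 0 <= j + d%:Z * N%:Z - 1.
  have : d%:Z * 1 <= d%:Z * N%:Z by rewrite ler_wpM2l.
  by rewrite /d; lia.
by exists (absz (j + d%:Z * N%:Z - 1)%R), d; rewrite gez0_abs // subrK.
Qed.

Lemma colz_dsubmx p q (A : 'M[R]_(p + q, N)) j : colz (dsubmx A) j = dsubmx (colz A j).
Proof. by rewrite /colz; case: insub => [c|]; apply/matrixP => a b; rewrite !mxE. Qed.

Lemma colz_usubmx p q (A : 'M[R]_(p + q, N)) j : colz (usubmx A) j = usubmx (colz A j).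
Proof. by rewrite /colz; case: insub => [c|]; apply/matrixP => a b; rewrite !mxE. Qed.

Lemma dotvE p (x y : 'cV[R]_p) : dotv x y = (x^T *m y) 0 0.
Proof. by rewrite /dotv mxE; apply: eq_bigr => i _; rewrite mxE. Qed.

Lemma dotvZr p (x y : 'cV[R]_p) s : dotv x (s *: y) = s * dotv x y.
Proof. by rewrite !dotvE -scalemxAr mxE. Qed.

End ColumnIndexing.

Section TwistColumns.
Variables (R : realType) (k l n : nat) (U : 'M[R]_(k + l, n.+1)).

Definition Uwin (j : int) : 'M[R]_(k + l) := \matrix_(i, t) colU U (j - l%:Z + t%:Z) i 0.

Lemma Mat_circ_unit : (forall j, Uwin j \in unitmx) -> Mat_circ U.
Proof.
move=> uU j; set s := [seq _ | _ <- _].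
have sz : size s = (k + l)%N by rewrite size_map size_iota.
rewrite basisEfree subvf dimvf /dim /= muln1 sz leqnn !andbT.
have szb : size s == (k + l)%N by rewrite sz.
apply/(@freeP _ _ _ (Tuple szb)) => c /= c0 i.
have : Uwin j *m (\col_t c t) = 0.
  rewrite -[RHS]c0; apply/colP => a; rewrite mxE summxE.
  apply: eq_bigr => t _; rewrite (nth_map 0%N) ?size_iota // nth_iota // add0n.
  by rewrite !mxE mulrC.
move/(congr1 (mulmx (invmx (Uwin j)))); rewrite mulKmx // mulmx0.
by move/colP/(_ i); rewrite !mxE.
Qed.

Lemma Uwin_dotv j x (t : 'I_(k + l)) :
  ((Uwin j)^T *m x) t 0 = dotv x (colU U (j - l%:Z + t%:Z)).
Proof.
rewrite mxE /dotv; apply: eq_bigr => i _.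
by rewrite [_^T _ _]mxE [Uwin _ _ _]mxE mulrC.
Qed.

Lemma is_twist_colE j x : is_twist_col U j x <->
  (Uwin j)^T *m x = \col_t (if t == 0%N :> nat then (-1) ^ j else 0).
Proof.
split=> [h|/colP h i /andP[ij ik]].
  apply/colP => t; rewrite Uwin_dotv mxE h; last by have := ltn_ord t; lia.
  by congr (if _ then _ else _); apply/eqP/eqP; lia.
have ti : (absz (i - (j - l%:Z))%R < k + l)%N by lia.
have := h (Ordinal ti); rewrite Uwin_dotv mxE /=.
have -> : j - l%:Z + (absz (i - (j - l%:Z))%R)%:Z = i by lia.
by move=> ->; congr (if _ then _ else _); apply/eqP/eqP; lia.
Qed.

Hypothesis uU : forall j, Uwin j \in unitmx.

Lemma twist_col_exists_unique j : exists! x, is_twist_col U j x.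
Proof.
pose b : 'cV[R]_(k + l) := \col_t (if t == 0%N :> nat then (-1) ^ j else 0).
exists (invmx (Uwin j)^T *m b); split.
  by apply/is_twist_colE; rewrite mulmxA mulmxV ?unitmx_tr // mul1mx.
by move=> y /is_twist_colE yE; rewrite /b -yE mulmxA mulVmx ?unitmx_tr // mul1mx.
Qed.

Lemma twist_colP j : is_twist_col U j (twist_col U j).
Proof.
have [x [xP _]] := twist_col_exists_unique j.
by rewrite /twist_col; apply: (@xgetPex _ 0 [set x | is_twist_col U j x]%classic); exists x.
Qed.

Lemma colz_tau (c : 'I_n.+1) : colz (tau U) ((c : nat)%:Z + 1) = twist_col U ((c : nat)%:Z + 1).
Proof. by rewrite colz_nat qcol_small; apply/colP => i; rewrite !mxE. Qed.

Lemma int_residue (j : int) : exists (c : 'I_n.+1) (d : int),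
  j = (c : nat)%:Z + 1 + d * n.+1%:Z.
Proof.
have m0 : 0 <= ((j - 1) %% n.+1%:Z)%Z by rewrite modz_ge0.
have lt : (absz ((j - 1) %% n.+1%:Z)%Z < n.+1)%N.
  by rewrite -ltz_nat gez0_abs // ltz_pmod.
exists (Ordinal lt), ((j - 1) %/ n.+1%:Z)%Z.
rewrite /= gez0_abs //; have := divz_eq (j - 1) n.+1%:Z; lia.
Qed.

Lemma colz_tau_orth (j i : int) : j - l%:Z < i < j + k%:Z ->
  dotv (colz (tau U) j) (colz U i) = 0.
Proof.
have [c [d jE]] := int_residue j; rewrite jE colz_period colz_tau => ij.
rewrite -(colz_period _ i (- d)).
have [s s0 sE] := colU_colz U (i + - d * n.+1%:Z).
apply: (mulfI s0); rewrite mulr0 -dotvZr -sE.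
rewrite twist_colP; first by case: eqP => //; lia.
by lia.
Qed.

Lemma colz_tau_diag (j : int) : (0 < k + l)%N ->
  dotv (colz (tau U) j) (colz U (j - l%:Z)) != 0.
Proof.
move=> kl0; have [c [d jE]] := int_residue j; rewrite jE colz_period colz_tau.
rewrite -(colz_period _ _ (- d)).
rewrite (_ : _ + - d * n.+1%:Z = (c : nat)%:Z + 1 - l%:Z); last by ring.
have [s s0 sE] := colU_colz U ((c : nat)%:Z + 1 - l%:Z).
suff : s * dotv (twist_col U (c%:Z + 1)) (colz U (c%:Z + 1 - l%:Z)) != 0.
  by rewrite mulf_eq0 negb_or => /andP[].
rewrite -dotvZr -sE twist_colP; last by lia.
by rewrite eqxx expfz_neq0 // oppr_eq0 oner_eq0.
Qed.

Definition zwin p (A : 'M[R]_(p, n.+1)) (a : int) d : 'M[R]_(p, d) :=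
  \matrix_(i, t) colz A (a + (t : nat)%:Z) i 0.

(** The relations defining the twist make this pairing of two windows triangular with nonzero
    diagonal; in particular both windows have independent columns. *)
Lemma zwin_tau_det a d : (d <= k + l)%N ->
  \det ((zwin (tau U) a d)^T *m zwin U (a - l%:Z) d) != 0.
Proof.
move=> dkl; rewrite det_trig.
  apply/prodf_neq0 => t _.
  have -> : ((zwin (tau U) a d)^T *m zwin U (a - l%:Z) d) t t =
      dotv (colz (tau U) (a + t%:Z)) (colz U (a + t%:Z - l%:Z)).
    rewrite mxE /dotv; apply: eq_bigr => i _; rewrite [_^T _ _]mxE !mxE.
    by congr (_ * colz _ _ _ _); ring.
  by apply: colz_tau_diag; apply: leq_trans dkl; apply: leq_ltn_trans (ltn_ord t).
apply/is_trig_mxP => s t ltst.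
transitivity (dotv (colz (tau U) (a + s%:Z)) (colz U (a - l%:Z + t%:Z))).
  by rewrite mxE /dotv; apply: eq_bigr => i _; rewrite [_^T _ _]mxE !mxE.
by apply: colz_tau_orth; have := ltn_ord t; lia.
Qed.

(* tau U [a, a + d) spans the orthogonal complement of U [a + d - l, a + k). *)
Lemma rank_zwin_tau a d : (d <= k + l)%N ->
  (\rank (zwin (dsubmx (tau U)) a d) + k =
   d + \rank (zwin (usubmx U) (a + d%:Z - l%:Z) (k + l - d)))%N.
Proof.
move=> dkl; pose d' := (k + l - d)%N.
pose M := (zwin (tau U) a d)^T; pose C := zwin U (a + d%:Z - l%:Z) d'.
have d'kl : (d' <= k + l)%N by rewrite leq_subr.
have [rM _] := rank_factors (zwin_tau_det a dkl).
have [_ rC] := rank_factors (zwin_tau_det (a + d%:Z) d'kl).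
rewrite -/M -/C in rM rC.
have MC : M *m C = 0.
  apply/matrixP => s t; rewrite [RHS]mxE.
  transitivity (dotv (colz (tau U) (a + s%:Z)) (colz U (a + d%:Z - l%:Z + t%:Z))).
    by rewrite mxE /dotv; apply: eq_bigr => i _; rewrite [_^T _ _]mxE !mxE.
  by apply: colz_tau_orth; have := ltn_ord t; have := ltn_ord s; rewrite /d'; lia.
have MK : (M :=: kermx C)%MS.
  have sMK : (M <= kermx C)%MS by apply/sub_kermxP.
  apply/eqmxP; rewrite -(mxrank_leqif_eq sMK) mxrank_ker rC rM /d'.
  by apply/eqP; lia.
pose E : 'M[R]_(k + l, l) := col_mx 0 1%:M.
pose F : 'M[R]_(k, k + l) := row_mx 1%:M 0.
have FE : F *m E = 0 by rewrite mul_row_col mulmx0 mul0mx addr0.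
have rE : \rank E = l by rewrite rank_col_0mx mxrank1.
have rF : \rank F = k by rewrite rank_row_mx0 mxrank1.
have KE : (F :=: kermx E)%MS.
  have sFK : (F <= kermx E)%MS by apply/sub_kermxP.
  by apply/eqmxP; rewrite -(mxrank_leqif_eq sFK) mxrank_ker rE rF addnK.
have ME : (M *m E)^T = zwin (dsubmx (tau U)) a d.
  apply/matrixP => i t; rewrite mxE [RHS]mxE colz_dsubmx [RHS]mxE.
  rewrite -[M]hsubmxK mul_row_col mulmx0 add0r mulmx1 !mxE.
  by [].
have FC : F *m C = zwin (usubmx U) (a + d%:Z - l%:Z) d'.
  apply/matrixP => i t; rewrite [RHS]mxE colz_usubmx [RHS]mxE.
  by rewrite -[C]vsubmxK mul_row_col mul1mx mul0mx addr0 !mxE.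
rewrite -FC -ME mxrank_tr.
(* By rank-nullity the two ranks are d and k minus the dimension of the same space: M spans the
   kernel of C, and F that of E. *)
have h1 := mxrank_mul_ker M E; have h2 := mxrank_mul_ker F C.
have h3 : \rank (M :&: kermx E)%MS = \rank (F :&: kermx C)%MS.
  by rewrite (cap_eqmx MK (eqmx_sym KE)) capmxC.
move: h1 h2; rewrite rM rF h3.
by move: (\rank (M *m E)) (\rank (F *m C)) (\rank (F :&: kermx C)%MS) => x y z; lia.
Qed.

End TwistColumns.

(** * Affine permutations and positroid cells *)

Section AffinePermutations.
Local Open Scope classical_set_scope.

Lemma card_eq_seq (s : seq int) (A : set int) : uniq s ->
  (forall i, A i <-> i \in s) -> (A #= `I_(size s))%card.
Proof.
move=> us As; rewrite (_ : A = nth 0 s @` `I_(size s)).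
  apply: inj_card_eq => i j; rewrite !inE => li lj /eqP.
  by rewrite nth_uniq // => /eqP.
apply/seteqP; split=> [i /As si|_ [j lj <-]]; last exact/As/mem_nth.
by exists (index i s); rewrite ?nth_index //= index_mem.
Qed.

Lemma card_eq_seq_size (s : seq int) (A : set int) r : uniq s ->
  (forall i, A i <-> i \in s) -> (A #= `I_r)%card -> r = size s.
Proof.
move=> us As Ar; apply/card_eq_II; have := card_eq_seq us As.
by rewrite card_eq_sym => h; apply/card_esym/(card_eq_trans h).
Qed.

Definition zseq (L : int) (d : nat) : seq int := [seq L + t%:Z | t <- iota 0 d].

Lemma mem_zseq L d i : (i \in zseq L d) = (L <= i < L + d%:Z).
Proof.
apply/mapP/idP => [[t]|ij]; first by rewrite mem_iota => td ->; lia.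
by exists (absz (i - L)%R); rewrite ?mem_iota; lia.
Qed.

Lemma zseq_uniq L d : uniq (zseq L d).
Proof. by rewrite map_inj_uniq ?iota_uniq // => a b; lia. Qed.

Lemma zseqD L d1 d2 : zseq L (d1 + d2) = zseq L d1 ++ zseq (L + d1%:Z) d2.
Proof.
rewrite /zseq iotaD map_cat add0n; congr (_ ++ _).
rewrite -{1}(addn0 d1) iotaDl -map_comp; apply: eq_map => t /=; lia.
Qed.

Lemma size_zseq L d : size (zseq L d) = d.
Proof. by rewrite size_map size_iota. Qed.

Variables (n a b : nat) (f g : int -> int).
Local Notation N := n.+1.
Hypothesis fP : affine_perm N a b f.
Hypotheses (fg : cancel f g) (gf : cancel g f).

Let f_period i : f (i + N%:Z) = f i + N%:Z. Proof. by case: fP. Qed.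
Let f_bounds i : i - a%:Z <= f i <= i + b%:Z. Proof. by case: fP. Qed.

Let f_periodM i (d : int) : f (i + d * N%:Z) = f i + d * N%:Z.
Proof.
have nat_case (e : nat) j : f (j + e%:Z * N%:Z) = f j + e%:Z * N%:Z.
  elim: e => [|e IHe]; first by rewrite mul0r !addr0.
  rewrite (_ : j + e.+1%:Z * N%:Z = j + e%:Z * N%:Z + N%:Z); last by ring.
  by rewrite f_period IHe; ring.
case: d => e; first exact: nat_case.
have := nat_case e.+1 (i + Negz e * N%:Z); rewrite NegzE.
rewrite (_ : i + - e.+1%:Z * N%:Z + e.+1%:Z * N%:Z = i); last by ring.
by move=> ->; ring.
Qed.

Lemma affine_perm_inv : affine_perm N b a g.
Proof.
have g_bounds i : i - b%:Z <= g i <= i + a%:Z by have := f_bounds (g i); rewrite gf; lia.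
have g_periodM i (d : int) : g (i + d * N%:Z) = g i + d * N%:Z.
  by apply: (can_inj fg); rewrite f_periodM !gf.
split=> //; first by exists f.
  by move=> i; have := g_periodM i 1; rewrite mul1r.
pose h (i : int) := f i - i.
have h_per i d : h (i + d * N%:Z) = h i by rewrite /h f_periodM; ring.
have sumE (F : int -> int) : \sum_(1 <= i < N.+1) F i%:Z = \sum_(c < N) F ((c : nat)%:Z + 1).
  by rewrite big_add1 big_mkord; apply: eq_bigr => c _; congr F; rewrite -addn1 PoszD.
have sf : \sum_(c < N) h ((c : nat)%:Z + 1) = 0.
  by rewrite -(sumE h); case: fP.
rewrite (sumE (fun i => g i - i)).
have res (c : 'I_N) : exists c' : 'I_N, exists d : int,
    g ((c : nat)%:Z + 1) = (c' : nat)%:Z + 1 + d * N%:Z by apply: int_residue.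
(* [s] is the permutation of residues induced by g. The displacement of g at c is minus that of f at
   [s c], by periodicity, so the two sums are opposite. *)
have [s sE] := choice res.
have sinj : injective s.
  move=> c c' scc'; have [d dE] := sE c; have [d' d'E] := sE c'.
  have : (c : nat)%:Z + 1 = (c' : nat)%:Z + 1 + (d - d') * N%:Z.
    rewrite -[LHS]gf -[(c' : nat)%:Z + 1 in RHS]gf dE d'E !f_periodM scc'; ring.
  move=> cc'; apply: val_inj => /=.
  have := ltn_ord c; have := ltn_ord c'; move: (d - d') cc' => z cc' lc' lc.
  have /orP[/eqP z0|zn] : (z == 0) || (z != 0) by case: eqP.
    by move: cc'; rewrite z0; lia.
  have : N%:Z <= `|z * N%:Z| by rewrite normrM ler_peMl //; lia.
  lia.
rewrite -[RHS]oppr0 -[in RHS]sf [in RHS](reindex_inj sinj) /= -sumrN; apply: eq_bigr => c _.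
have [d dE] := sE c; rewrite -(h_per ((s c : nat)%:Z + 1) d) -dE /h gf; lia.
Qed.

(* The windows of f and of its inverse are compared through the positions i of
   [b' - b - (a + b), b' - b) with f(i) >= b' - b - a, of which there are a. *)
Lemma affine_window_inv (a' b' : int) (r : nat) : a' < b' -> b' - a' <= a%:Z + b%:Z ->
  ([set i : int | (i < b' - b%:Z) &&
     (b' - b%:Z <= f i + a%:Z < b' - b%:Z + N%:Z)] #= `I_a)%card ->
  ([set i : int | (i < b' - b%:Z) && (b' - b%:Z <= f i + a%:Z < a' + a%:Z)] #= `I_r)%card ->
  (a + b <= N)%N ->
  exists2 r' : nat, (r' + a = absz (b' - a')%R + r)%N &
  ([set i : int | (i < a') && (a' <= g i + b%:Z < b')] #= `I_r')%card.
Proof.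
move=> lt_ab le_ab cT cS abN.
pose d := absz (b' - a')%R; pose L := b' - b%:Z - (a + b)%:Z.
pose T := [seq i <- zseq L (a + b) | b' - b%:Z <= f i + a%:Z].
have dE : d%:Z = b' - a' by rewrite /d; lia.
have dab : (d <= a + b)%N by lia.
have aT : a = size T.
  apply: (card_eq_seq_size _ _ cT) => [|i]; first by rewrite filter_uniq ?zseq_uniq.
  rewrite mem_filter mem_zseq /L /=; have := f_bounds i; split; lia.
have rT : r = count (fun i => f i < a') T.
  rewrite -size_filter; apply: (card_eq_seq_size _ _ cS) => [|i].
    by rewrite !filter_uniq ?zseq_uniq.
  rewrite !mem_filter mem_zseq /L /=; have := f_bounds i; split; lia.
pose c3 := count (fun i => a' <= f i) (zseq (a' - b%:Z) d).
have c3T : count (predC (fun i => f i < a')) T = c3.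
  rewrite count_filter -(subnK dab) zseqD count_cat.
  rewrite (_ : L + (a + b - d)%N%:Z = a' - b%:Z); last by rewrite /L; lia.
  rewrite [X in (X + _)%N](_ : _ = 0%N) ?add0n; last first.
    rewrite -(count_pred0 (zseq L (a + b - d))); apply: eq_in_count => i.
    by rewrite mem_zseq /= /L => il; have := f_bounds i; lia.
  apply: eq_in_count => i; rewrite mem_zseq /= => il; have := f_bounds i; lia.
pose S := [seq i <- zseq (a' - b%:Z) d | f i < a'].
exists (size S).
  rewrite -[RHS]/((d + r)%N) size_filter {1}aT -(count_predC (fun i => f i < a') T) -rT c3T.
  have := count_predC (fun i => f i < a') (zseq (a' - b%:Z) d).
  rewrite size_zseq (@eq_count _ (predC _) (fun i => a' <= f i)) -/c3; first lia.
  by move=> i /=; rewrite -leNgt.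
rewrite -(size_map f); apply: card_eq_seq.
  by rewrite (map_inj_uniq (can_inj fg)) filter_uniq ?zseq_uniq.
move=> i /=; split=> [h|/mapP[j]].
  apply/mapP; exists (g i); rewrite ?gf // mem_filter mem_zseq gf; lia.
by rewrite mem_filter mem_zseq => h ->; rewrite fg; lia.
Qed.

End AffinePermutations.

Section CellWindows.
Variables (R : realType) (k l n : nat).
Local Notation N := n.+1.

Lemma mulmx_colz p q (D : 'M[R]_(p, q)) (A : 'M[R]_(q, N)) j :
  colz (D *m A) j = D *m colz A j.
Proof. by rewrite /colz; case: insub => [c|]; rewrite ?mulmx0 // !colE mulmxA. Qed.

Lemma mulmx_zwin p q (D : 'M[R]_(p, q)) (A : 'M[R]_(q, N)) j d :
  zwin (D *m A) j d = D *m zwin A j d.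
Proof.
apply/matrixP => i t; rewrite mxE mulmx_colz mxE [RHS]mxE.
by apply: eq_bigr => s _; rewrite [zwin _ _ _ _ _]mxE.
Qed.

Lemma rank_zwin_full p (A : 'M[R]_(p, N)) j : row_free A -> \rank (zwin A j N) = p.
Proof.
move=> fA; apply/eqP; rewrite eqn_leq rank_leq_row /=.
pose phi (c : 'I_N) : 'I_N := inord (absz (((c : nat)%:Z + 1 - j) %% N%:Z)%Z).
have AE : A = colsub phi (zwin A j N).
  apply/matrixP => i c; rewrite !mxE.
  have m0 : 0 <= (((c : nat)%:Z + 1 - j) %% N%:Z)%Z by rewrite modz_ge0.
  have lt : (absz (((c : nat)%:Z + 1 - j) %% N%:Z)%Z < N)%N.
    by rewrite -ltz_nat gez0_abs // ltz_pmod.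
  rewrite inordK // gez0_abs //.
  rewrite -(colz_period A _ (((c : nat)%:Z + 1 - j) %/ N%:Z)%Z).
  rewrite (_ : _ + _ = (c : nat)%:Z + 1); last first.
    by rewrite -addrA [X in j + X]addrC -divz_eq; ring.
  by rewrite colz_nat qcol_small mxE.
have := mxrankM_maxl (zwin A j N) (colsub phi 1%:M).
by rewrite mulmx_colsub mulmx1 -AE (eqP fA).
Qed.

Lemma cell_zwin r f (V : 'M[R]_(r, N)) j d : positroid_cell f V -> (0 < d)%N ->
  ([set i : int | ((i < j) && (j <= f i + r%:Z < j + d%:Z))%R]%classic
     #= `I_(\rank (zwin V j d)))%card.
Proof.
case=> _ _ cV d0; have := cV j (j + d%:Z); rewrite ltrDl ltz_nat => /(_ d0).
suff -> : \rank (col_window V j (j + d%:Z)) = \rank (zwin V j d) by [].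
by rewrite -[col_window _ _ _]/(zwin V j _) (_ : absz _ = d) //; lia.
Qed.

Lemma cell_full f (V : 'M[R]_(k, N)) j : positroid_cell f V ->
  ([set i : int | ((i < j) && (j <= f i + k%:Z < j + N%:Z))%R]%classic #= `I_k)%card.
Proof.
move=> cV; have := cell_zwin j cV (ltn0Sn n); rewrite rank_zwin_full //.
by case: cV => _ [].
Qed.

(** Since f(i) <= i + l, no i < j has f(i) + k beyond j + k + l - 1, so a window of k + l columns
    counts as much as a whole period. *)
Lemma cell_window_rank f (V : 'M[R]_(k, N)) j : (k + l <= N)%N ->
  affine_perm N k l f -> positroid_cell f V -> \rank (zwin V j (k + l)) = k.
Proof.
move=> klN [_ _ _ fb] cV; case: (posnP (k + l)) => [kl0|kl0].
  by apply/eqP; rewrite eqn_leq rank_leq_row; lia.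
apply/card_eq_II; have := cell_zwin j cV kl0.
rewrite card_eq_sym => h; apply: card_eq_trans h _.
rewrite (_ : [set i | _]%classic =
  [set i : int | ((i < j) && (j <= f i + k%:Z < j + N%:Z))%R]%classic); last first.
  by apply/seteqP; split=> i /=; have := fb i; lia.
exact: (cell_full j cV).
Qed.

Lemma qwin_row_free p (A : 'M[R]_(p, N)) x d : \rank (zwin A (x%:Z + 1) d) = p ->
  row_free (qwin (rsign R p) A x d).
Proof.
move=> rA.
have -> : qwin (rsign R p) A x d = zwin A (x%:Z + 1) d *m
    diag_mx (\row_t rsign R p ^+ ((x + t) %/ N)).
  apply/matrixP => i t; rewrite mul_mx_diag !mxE -[X in _ = _ * X]mulr1.
  rewrite (_ : x%:Z + 1 + (t : nat)%:Z = (x + t)%N%:Z + 1); last by rewrite PoszD; ring.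
  by rewrite colz_nat /qcol !mxE expr1n mul1r mulr1 mulrC.
rewrite /row_free mxrankMfree ?rA // row_free_unit unitmxE unitfE det_diag.
by apply/prodf_neq0 => t _; rewrite mxE expf_neq0 // rsign_neq0.
Qed.

Lemma gram_row_free p (A B : 'M[R]_(p, N)) : A *m A^T = B *m B^T ->
  row_free B -> row_free A.
Proof.
move=> AB /gram_unit; rewrite -AB => /mxrank_unit rA.
by rewrite -row_leq_rank -[leqLHS]rA mxrankM_maxl.
Qed.

Lemma qcol_alt p (Y : 'M[R]_(p, N)) s z :
  qcol s (altmx Y) z = (-1) ^+ z *: qcol ((-1) ^+ N * s) Y z.
Proof.
apply/colP => i; rewrite !mxE inordK ?ltn_pmod //.
rewrite exprMn -exprM mulrCA !mulrA; congr (_ * _ * _).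
rewrite {2}(divn_eq z N) (mulnC _ N) exprD mulrAC -expr2 sqrr_sign mul1r.
by [].
Qed.

Lemma altmx_row_free p (Y : 'M[R]_(p, N)) : row_free (altmx Y) = row_free Y.
Proof.
have half p' (Y' : 'M[R]_(p', N)) : row_free Y' -> row_free (altmx Y').
  by apply: gram_row_free; rewrite altmx_gram.
by apply/idP/idP => /half //; rewrite altmxK.
Qed.

End CellWindows.

(** * The stacked twist map in terms of the twist of a pair *)

Section TwistedPair.
Variables (R : realType) (k l m n : nat).
Local Notation N := n.+1.
Local Notation e := (rsign R k).
Hypothesis m_even : ~~ odd m.
Hypothesis nE : (k + l + m)%N = N.
Variables (V A : 'M[R]_(k, N)) (W : 'M[R]_(l, N)) (Z : 'M[R]_(k + m, N)).
Variable B : 'M[R]_k.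
Hypotheses (uB : B \in unitmx) (VE : V = B *m A).
Hypotheses (pA : minors_ge0 A) (fA : row_free A).
Hypotheses (pZ : minors_gt0 Z) (fW : row_free W) (ZW : Z *m W^T = 0).
Hypothesis rV : forall j, \rank (zwin V j (k + l)) = k.

Let kmN : (k + m <= N)%N. Proof. by lia. Qed.
Let lmN : (l + m <= N)%N. Proof. by lia. Qed.

Lemma free_Z : row_free Z. Proof. exact: minors_gt0_row_free. Qed.

(** As n = k + l + m, the columns outside the pivot window form a window of k + l columns, which has
    rank k by [rV] and so contains a nonzero minor. *)
Lemma pivot_AZ_gt0 x : 0 < \det (pivot_mx e A Z x).
Proof.
apply: det_pivot_gt0 => //.
have rA j : \rank (zwin A j (k + l)) = k.
  by rewrite -[RHS](rV j) VE mulmx_zwin eqmxMfull // row_full_unit.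
have /row_free_minorP[f fi fn0] := qwin_row_free (rA ((x + m)%N%:Z + 1)).
have klN : (k + l <= N)%N by lia.
exists (widen_ord klN \o f); first by move=> i j ltij; apply: fi.
split; first by move=> s /=; have := ltn_ord (f s); lia.
suff -> : colsub (widen_ord klN \o f) (qshift e A (x + m)) =
    colsub f (qwin e A (x + m) (k + l)) by [].
by apply/matrixP => i j; rewrite !mxE.
Qed.

Lemma pivot_AZ_kernel x (z : 'rV_(k + m)) : z *m (Z *m V^T) = 0 ->
  (forall t : 'I_m, z *m qcol e Z (x + t) = 0) -> z = 0.
Proof.
move=> zV zw; have /lt0r_neq0/det_neq0P := pivot_AZ_gt0 x; apply.
have zA : z *m (Z *m A^T) = 0.
  have := zV; rewrite VE trmx_mul !mulmxA => /(congr1 (mulmxr (invmx B^T))) /=.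
  by rewrite mulmxK ?unitmx_tr // mul0mx -!mulmxA.
rewrite mul_mx_row zA (_ : z *m qwin e Z x m = 0) ?row_mx0 //.
apply/matrixP => i t; rewrite ord1 [RHS]mxE.
transitivity ((z *m qcol e Z (x + t)) 0 0); last by rewrite zw mxE.
by rewrite mxE [RHS]mxE; apply: eq_bigr => s _; congr (_ * _); rewrite mxE.
Qed.

Local Notation U := (stack V W).

Lemma qshift_stack x : qshift e U x = col_mx (qshift e V x) (qshift e W x).
Proof.
apply/matrixP => i c; rewrite [LHS]mxE /stack /qcol [LHS]mxE [X in _ * X]mxE.
by case: (split_ordP i) => i' ->; rewrite ?col_mxEu ?col_mxEd [RHS]mxE [RHS]mxE [X in _ = _ * X]mxE.
Qed.

(** Pad a dependency among k + l consecutive columns with m zeros. The result is orthogonal to W,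
    hence lies in the row space of Z, is orthogonal to V, and vanishes on m consecutive positions;
    the nonzero pivot forces it to be zero. *)
Lemma qwin_stack_unit x : qwin e U x (k + l) \in unitmx.
Proof.
rewrite -unitmx_tr unitmxE unitfE; apply/det_neq0P => a aM.
pose E : 'M[R]_(N, k + l) := \matrix_(c, t) ((c : nat) == t)%:R.
have ME : qwin e U x (k + l) = qshift e U x *m E.
  apply/matrixP => i t; rewrite mxE [RHS]mxE.
  have tN : (t < N)%N by have := ltn_ord t; lia.
  rewrite (bigD1 (Ordinal tN)) //= big1 ?addr0; last first.
    by move=> c; rewrite -val_eqE /= => /negbTE ct; rewrite [E _ _]mxE ct mulr0.
  by rewrite [E _ _]mxE eqxx mulr1 [RHS]mxE.
pose v := a *m E^T.
have vU : v *m (qshift e U x)^T = 0 by rewrite /v -mulmxA -trmx_mul -ME.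
have [vV vW] : v *m (qshift e V x)^T = 0 /\ v *m (qshift e W x)^T = 0.
  by apply: eq_row_mx; rewrite -mul_mx_row -tr_col_mx -qshift_stack vU row_mx0.
have ee := rsign_sqr R k.
have ZWx : qshift e Z x *m (qshift e W x)^T = 0 by rewrite qshift_gram.
have fZx : row_free (qshift e Z x).
  by apply: (gram_row_free _ free_Z); rewrite qshift_gram.
have fWx : row_free (qshift e W x).
  by apply: (gram_row_free _ fW); rewrite qshift_gram.
have /submxP[z zE] : (v <= qshift e Z x)%MS.
  by apply: (perp_sub _ fZx fWx ZWx vW); lia.
have z0 : z = 0.
  apply: (@pivot_AZ_kernel (x + (k + l))).
    by move: vV; rewrite zE -mulmxA qshift_gram.
  move=> t; apply/matrixP => i j; rewrite !ord1 [RHS]mxE.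
  have tN : (k + l + t < N)%N by have := ltn_ord t; lia.
  transitivity (v 0 (Ordinal tN)).
    rewrite zE mxE [RHS]mxE; apply: eq_bigr => s _; congr (_ * _).
    by rewrite [RHS]mxE /=; congr (qcol _ _ _ _ _); lia.
  rewrite mxE big1 // => s _; rewrite !mxE /= (_ : (_ == _) = false) ?mulr0 //.
  by have := ltn_ord s; lia.
have v0 : v = 0 by rewrite zE z0 mul0mx.
have EE : E^T *m E = 1%:M.
  apply/matrixP => s t; rewrite !mxE.
  have sN : (s < N)%N by have := ltn_ord s; lia.
  rewrite (bigD1 (Ordinal sN)) //= big1 ?addr0; last first.
    by move=> c; rewrite -val_eqE /= => /negbTE cs; rewrite !mxE cs mul0r.
  by rewrite !mxE eqxx mul1r -val_eqE.
by rewrite -[a]mulmx1 -EE mulmxA -/v v0 mul0mx.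
Qed.

Lemma Uwin_stack_unit j : Uwin U j \in unitmx.
Proof.
have [x [d xE]] := int_to_nat n (j - l%:Z).
have : rsign R k ^+ d *: Uwin U j = qwin e U x (k + l).
  apply/matrixP => i t; rewrite mxE [Uwin _ _ _ _]mxE [RHS]mxE.
  transitivity ((rsign R k ^+ d *: colU U (j - l%:Z + t%:Z)) i 0); first by rewrite [RHS]mxE.
  rewrite -colU_period -colU_nat; congr (colU _ _ _ _).
  by rewrite addrAC xE PoszD; ring.
move=> h; have := qwin_stack_unit x; rewrite -h unitmxZ // unitfE.
by rewrite expf_neq0 // rsign_neq0.
Qed.

Local Notation Ut := (tau U).

(** Expand over one period the products of the twist column with the columns of U: the first is a
    sign, the next k + l - 1 vanish, and the last m are the unknown coefficients [b]. *)
Lemma tau_relation q (Y : 'M[R]_(q, N)) (c : 'I_N) : (0 < k + l)%N ->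
  exists b : 'cV_m, Y *m U^T *m col c Ut =
    (-1) ^+ c.+1 *: qcol e Y (N + k + c + m) + qwin e Y (N + k + c) m *m b.
Proof.
(* The period starts at j - l for j = c + 1, moved forward by N to stay in the natural numbers and
   rewritten from origin 1 to origin 0. *)
move=> kl0; pose X0 := (N - l + c)%N; set u := col c Ut.
pose p t := dotv u (qcol e U (X0 + t)).
have uE : u = twist_col U ((c : nat)%:Z + 1).
  by rewrite -colz_tau colz_nat qcol_small.
have pE t : (t < k + l)%N -> p t = e * (if t == 0%N then (-1) ^+ c.+1 else 0).
  move=> ltt; rewrite /p -colU_nat.
  rewrite (_ : (X0 + t)%N%:Z + 1 = ((c : nat)%:Z + 1 - l%:Z + t%:Z) + 1%N%:Z * N%:Z); last first.
    by rewrite /X0; lia.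
  rewrite colU_period expr1 dotvZr uE (twist_colP Uwin_stack_unit); last by lia.
  congr (_ * _); rewrite (_ : (_ == _) = (t == 0%N)); last by apply/eqP/eqP; lia.
  by rewrite exprnP; congr (if _ then _ ^ _ else _); lia.
exists (\col_t p (k + l + t)%N).
have -> : Y *m U^T *m u = qshift e Y X0 *m (qshift e U X0)^T *m u.
  by rewrite qshift_gram ?rsign_sqr.
apply/colP => i; rewrite -mulmxA mxE [RHS]mxE [X in _ = X + _]mxE [X in _ = _ + X]mxE.
have pU (c' : 'I_N) : ((qshift e U X0)^T *m u) c' 0 = p c'.
  rewrite /p dotvE mxE [RHS]mxE; apply: eq_bigr => s _.
  by rewrite [_^T _ _]mxE [_^T _ _]mxE [qshift _ _ _ _ _]mxE mulrC.
transitivity (\sum_(0 <= t < N) p t * qcol e Y (X0 + t) i 0).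
  by rewrite big_mkord; apply: eq_bigr => t _; rewrite pU [qshift _ _ _ _ _]mxE mulrC.
rewrite (big_cat_nat (n := (k + l)%N)) //=; last by lia.
congr (_ + _).
  rewrite big_ltn // [X in _ + X]big_nat_cond big1 ?addr0; last first.
    move=> t /andP[/andP[t0 tkl] _]; rewrite pE // (_ : (t == 0)%N = false) ?mulr0 ?mul0r //.
    by case: t t0 {tkl}.
  rewrite pE //= addn0 (_ : (N + k + c + m = X0 + N)%N); last by rewrite /X0; lia.
  by rewrite qcolDn [X in _ = _ * X]mxE; ring.
rewrite -{1}nE [X in \sum_(_ <= _ < X) _](addnC _ m) -{1}(add0n (k + l)%N) big_addn addnK.
rewrite big_mkord; apply: eq_bigr => t _; rewrite [(\col_t0 _) _ _]mxE [qwin _ _ _ _ _ _]mxE.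
rewrite mulrC (addnC t); congr (qcol _ _ _ _ _ * _).
by rewrite /X0; lia.
Qed.

Lemma col_Wt (c : 'I_N) : col c (usubmx Ut) = usubmx (col c Ut).
Proof. by apply/colP => i; rewrite !mxE. Qed.

Lemma col_Vt (c : 'I_N) : col c (dsubmx Ut) = dsubmx (col c Ut).
Proof. by apply/colP => i; rewrite !mxE. Qed.

Lemma mul_gram_stack q (Y : 'M[R]_(q, N)) (u : 'cV_(k + l)) :
  Y *m U^T *m u = Y *m V^T *m usubmx u + Y *m W^T *m dsubmx u.
Proof. by rewrite tr_col_mx mul_mx_row -{1}[u]vsubmxK mul_row_col. Qed.

(** With Y = Z the contribution of W drops out of the relation, and what remains is the pivot system
    of (A, Z). *)
Lemma Wt_twcol (c : 'I_N) :
  \det (pivot_mx e A Z (N + k + c)) *: (B^T *m col c (usubmx Ut)) =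
  (-1) ^+ c.+1 *: twcol e A Z (N + k + c).
Proof.
case: (posnP k) => [k0|k0].
  by apply/colP => i; have := ltn_ord i; lia.
have [|b bE] := @tau_relation _ Z c; first by lia.
apply: (twcol_solve (b := - b)).
rewrite mul_row_col mulmxN -[LHS]/(_ - _) -[RHS](addrK (qwin e Z (N + k + c) m *m b)) -bE.
have ZV : Z *m V^T = Z *m A^T *m B^T by rewrite VE trmx_mul mulmxA.
by congr (_ - _); rewrite mul_gram_stack ZW mul0mx addr0 ZV col_Wt !mulmxA.
Qed.

Lemma Wt_alt_gt0s : minors_gt0s (altmx (usubmx Ut)).
Proof.
have pT : minors_gt0s (twmx e A Z (N + k)).
  by apply: twmx_strict => // x; rewrite gt_eqF // pivot_AZ_gt0.
apply: (minors_scale_gt0s (D := B^T) (s := fun c => \det (pivot_mx e A Z (N + k + c)))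
  (B := (-1)%:M *m twmx e A Z (N + k)) _ _ _).2 => //.
- by move=> c; apply: pivot_AZ_gt0.
- apply/matrixP => i c; rewrite mul_mx_diag mul_scalar_mx [LHS]mxE [RHS]mxE.
  rewrite [X in _ * X]mxE mulmx_alt [altmx _ _ _]mxE [twmx _ _ _ _ _ _]mxE.
  have /colP/(_ i) := Wt_twcol c; rewrite mxE [RHS]mxE => h.
  have {}h : \det (pivot_mx e A Z (N + k + c)) * (B^T *m usubmx Ut) i c =
      (-1) ^+ c.+1 * twcol e A Z (N + k + c) i 0.
    by rewrite -h; congr (_ * _); rewrite colE mulmxA -colE [RHS]mxE.
  rewrite -mulrA [X in _ * X]mulrC h mulrA exprS mulrCA -expr2 sqrr_sign mulr1.
  by [].
- by rewrite unitmx_tr.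
- apply: (minors_gt0s_mul _ _).2 pT.
  by rewrite unitmxE det_scalar unitrX // unitrN1.
Qed.

Lemma rsign_compl : (-1) ^+ N * e = rsign R l.
Proof.
rewrite /rsign -exprD -nE (_ : (k + l + m + k.+1 = m + (k + k) + l.+1)%N); last by lia.
by rewrite exprD -signr_odd oddD (negbTE m_even) addnn odd_double mul1r.
Qed.

Variables (W1 : 'M[R]_(l, N)) (X : 'M[R]_(l + m, N)) (D : 'M[R]_l).
Hypotheses (uD : D \in unitmx) (WE : W = D *m altmx W1) (pW1 : minors_gt0 W1).
Hypotheses (pX : minors_ge0 X) (fX : row_free X) (XV : altmx X *m V^T = 0).
Local Notation e' := (rsign R l).

Lemma qcol_altX z : qcol e (altmx X) z = (-1) ^+ z *: qcol e' X z.
Proof. by rewrite qcol_alt rsign_compl. Qed.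

(** X is only nonnegative, so positivity of Cauchy-Binet terms does not suffice. A kernel vector
    would give an element of the row space of Z orthogonal to V and vanishing on m consecutive
    positions, which the pivot of (A, Z) excludes. *)
Lemma pivot_WX_gt0 x : 0 < \det (pivot_mx e' W1 X x).
Proof.
rewrite lt_def det_pivot_ge0 ?andbT //; last exact: minors_gt0W.
apply/det_neq0P => z; rewrite mul_mx_row => zP.
have [zW zw] : z *m (X *m W1^T) = 0 /\ z *m qwin e' X x m = 0.
  by apply: eq_row_mx; rewrite zP row_mx0.
pose v := z *m altmx X.
have vW : v *m W^T = 0.
  rewrite /v WE trmx_mul mulmxA -(mulmxA z) altmx_gram zW.
  by rewrite mul0mx.
have vV : v *m V^T = 0 by rewrite /v -mulmxA XV mulmx0.
have /submxP[y yE] : (v <= Z)%MS by apply: (perp_sub _ free_Z fW ZW vW); lia.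
have y0 : y = 0.
  apply: (@pivot_AZ_kernel x); first by rewrite mulmxA -yE.
  move=> t; rewrite -mulmx_qcol -yE mulmx_qcol qcol_altX -scalemxAr.
  apply/matrixP => i j; rewrite !ord1 mxE [RHS]mxE.
  have /matrixP/(_ 0 t) := zw; rewrite [RHS]mxE => zt.
  rewrite [X in _ * X](_ : _ = 0) ?mulr0 // -[RHS]zt mxE [RHS]mxE.
  by apply: eq_bigr => s _; congr (_ * _); rewrite [RHS]mxE.
have : v = 0 by rewrite yE y0 mul0mx.
by move/eqP; rewrite mulmx_free_eq0 ?altmx_row_free // => /eqP.
Qed.

(** With Y = [altmx X] the contribution of V drops out. The alternation at position N + k + c + m
    cancels the dependence of the sign on c, since m is even. *)
Lemma Vt_twcol (c : 'I_N) :
  \det (pivot_mx e' W1 X (N + k + c)) *: (D^T *m col c (dsubmx Ut)) =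
  (-1) ^+ (N + k + 1) *: twcol e' W1 X (N + k + c).
Proof.
case: (posnP l) => [l0|l0].
  by apply/colP => i; have := ltn_ord i; lia.
have [|b bE] := @tau_relation _ (altmx X) c; first by lia.
set y := (N + k + c)%N in bE *.
pose b' : 'cV_m := \col_t ((-1) ^+ (y + t) * b t 0).
apply: (twcol_solve (b := - b')).
have winE : qwin e (altmx X) y m *m b = qwin e' X y m *m b'.
  apply/colP => i; rewrite mxE [RHS]mxE; apply: eq_bigr => t _.
  rewrite [qwin _ _ _ _ _ _]mxE qcol_altX [X in X * _]mxE.
  by rewrite [X in _ = X * _]mxE [X in _ = _ * X]mxE [RHS]mulrCA mulrA.
have lhsE : altmx X *m U^T *m col c Ut = X *m W1^T *m (D^T *m col c (dsubmx Ut)).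
  rewrite mul_gram_stack XV mul0mx add0r.
  have -> : altmx X *m W^T = X *m W1^T *m D^T by rewrite WE trmx_mul mulmxA altmx_gram.
  by rewrite col_Vt !mulmxA.
rewrite mul_row_col mulmxN -[LHS]/(_ - _) -lhsE bE winE addrK.
rewrite qcol_altX scalerA -exprD; congr (_ *: _).
rewrite -signr_odd -[RHS]signr_odd; congr (_ ^+ (nat_of_bool _)).
rewrite (_ : (c.+1 + (y + m) = N + k + 1 + m + (c + c))%N); last by rewrite /y; lia.
by rewrite !oddD (negbTE m_even) addbb !addbF.
Qed.

Lemma Vt_ge0s : minors_ge0s (dsubmx Ut).
Proof.
have lek : (l + m <= N)%N by lia.
have pT : minors_ge0s (twmx e' W1 X (N + k)).
  apply: twmx_ge0s => //; first exact: minors_gt0W.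
  by apply: minors_gt0_row_free => //; lia.
apply: (minors_scale_gt0s (D := D^T) (s := fun c => \det (pivot_mx e' W1 X (N + k + c)))
  (B := ((-1) ^+ (N + k + 1))%:M *m twmx e' W1 X (N + k)) _ _ _).1.
- by move=> c; apply: pivot_WX_gt0.
- apply/matrixP => i c; rewrite mul_mx_diag mul_scalar_mx [LHS]mxE [RHS]mxE.
  rewrite [X in _ * X]mxE [twmx _ _ _ _ _ _]mxE.
  have /colP/(_ i) := Vt_twcol c; rewrite mxE [RHS]mxE => h.
  rewrite -h mulrC; congr (_ * _).
  by rewrite colE mulmxA -colE [RHS]mxE.
- by rewrite unitmx_tr.
- move=> g h gi hi; rewrite -!mulmx_colsub !det_mulmx mulrACA mulr_ge0 ?pT //.
  by rewrite -expr2 sqr_ge0.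
Qed.

End TwistedPair.

(** * The positroid cell of the twisted space and the conclusion *)

Lemma rank_zwin_le (R : realType) n p (A : 'M[R]_(p, n.+1)) j d :
  (\rank (zwin A j d) <= \rank A)%N.
Proof. by rewrite -[A in zwin A]mulmx1 mulmx_zwin mxrankM_maxl. Qed.

Lemma minors_gt0s_row_free (R : realFieldType) k n (A : 'M[R]_(k, n)) : (k <= n)%N ->
  minors_gt0s A -> row_free A.
Proof.
move=> lekn pA; apply/row_free_minorP; exists (widen_ord lekn); first by move=> i j.
have wi : incr (widen_ord lekn) by move=> i j.
by apply/eqP => d0; have := pA _ _ wi wi; rewrite d0 mul0r ltxx.
Qed.

Lemma complementary_minors_sign (R : realFieldType) q k n
    (A : 'M[R]_(k, n)) (B : 'M[R]_(q, n)) : (q + k)%N = n ->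
  row_free A -> row_free B -> A *m B^T = 0 ->
  (minors_ge0s A -> minors_ge0s (altmx B)) /\ (minors_gt0s A -> minors_gt0s (altmx B)).
Proof.
move=> qkn fA fB AB; have [c c0 cE] := complementary_minors qkn fA fB AB.
have cc : 0 < c * c by rewrite -expr2 exprn_even_gt0.
split=> pA g g' /cE[h hi ->] /cE[h' h'i ->]; rewrite mulrACA.
  by rewrite mulr_ge0 ?pA // ltW.
by rewrite mulr_gt0 ?pA.
Qed.

Lemma Gr_gt0_rep (R : realType) q n (A : 'M[R]_(q, n)) : row_free A ->
  minors_gt0s A -> Gr_gt0 A.
Proof.
move=> fA /minors_gt0s_rep[D uD pD]; split=> //; exists (D *m A); split=> //.
by apply: eqmxMfull; rewrite row_full_unit.
Qed.

Lemma Gr_ge0_rep (R : realType) q n (A : 'M[R]_(q, n)) : row_free A ->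
  minors_ge0s A -> Gr_ge0 A.
Proof.
move=> fA /minors_ge0s_rep[D uD pD]; split=> //; exists (D *m A); split=> //.
by apply: eqmxMfull; rewrite row_full_unit.
Qed.

Section Assembly.
Variables (R : realType) (k l m n : nat).
Local Notation N := n.+1.
Hypothesis nE : (k + l + m)%N = N.
Variables (V : 'M[R]_(k, N)) (W : 'M[R]_(l, N)).
Local Notation U := (stack V W).
Local Notation Vt := (dsubmx (tau U)).
Hypothesis uU : forall j, Uwin U j \in unitmx.
Hypothesis pVt : minors_ge0s Vt.

Let rank_Vt j d : (d <= k + l)%N ->
  (\rank (zwin Vt j d) + k = d + \rank (zwin V (j + d%:Z - l%:Z) (k + l - d)))%N.
Proof. by move=> dkl; rewrite rank_zwin_tau // col_mxKu. Qed.

Let rank_Vt_full j : \rank (zwin Vt j (k + l)) = l.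
Proof.
have := rank_Vt j (leqnn _); rewrite subnn.
have := rank_leq_col (zwin V (j + (k + l)%N%:Z - l%:Z) 0); lia.
Qed.

Lemma Vt_row_free : row_free Vt.
Proof. by rewrite -row_leq_rank -[leqLHS](rank_Vt_full 0) rank_zwin_le. Qed.

(** For windows of length d <= k + l, the ranks for [Vt] and V satisfy the same linear relation as
    the counts for g and f, so the two agree. *)
Lemma Vt_cell (f g : int -> int) : affine_perm N k l f -> positroid_cell f V ->
  cancel f g -> cancel g f -> positroid_cell g Vt.
Proof.
move=> fP cV fg gf; have gP := affine_perm_inv fP fg gf.
have [g1 g2 g3 gb] := gP.
have gb' i : i - l%:Z <= g i <= i + k%:Z := gb i.
split; first by split=> // i; have := gb i; lia.
  exact/(Gr_ge0_rep Vt_row_free).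
have short (a b : int) : a < b -> b - a <= k%:Z + l%:Z ->
    ([set i : int | ((i < a) && (a <= g i + l%:Z < b))%R]%classic
       #= `I_(\rank (zwin Vt a (absz (b - a)%R))))%card.
  move=> ltab leab; pose d := absz (b - a)%R.
  have dE : d%:Z = b - a by rewrite /d; lia.
  have dkl : (d <= k + l)%N by lia.
  pose r := \rank (zwin V (b - l%:Z) (k + l - d)).
  have cS : ([set i : int | ((i < b - l%:Z) &&
      (b - l%:Z <= f i + k%:Z < a + k%:Z))%R]%classic #= `I_r)%card.
    (* The cell condition speaks of nonempty windows only; for d = k + l both rank and count are
       zero. *)
    case: (posnP (k + l - d)) => [kld0|kld].
      have -> : r = 0%N.
        by apply/eqP; rewrite -leqn0 -[X in (_ <= X)%N]kld0; apply: rank_leq_col.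
      rewrite II0 (_ : [set i | _]%classic = set0) ?card_eqxx //.
      by apply/seteqP; split=> i //=; lia.
    have := cell_zwin (b - l%:Z) cV kld.
    by rewrite (_ : b - l%:Z + (k + l - d)%N%:Z = a + k%:Z) //; lia.
  have klN : (k + l <= N)%N by lia.
  have [r' r'E cr'] := affine_window_inv fP fg gf ltab leab (cell_full _ cV) cS klN.
  suff -> : \rank (zwin Vt a d) = r' by [].
  have := rank_Vt a dkl; rewrite (_ : a + d%:Z - l%:Z = b - l%:Z) -/r; last by lia.
  by move: r'E; rewrite -/d; move: (\rank _) => x; lia.
(* Beyond length k + l nothing changes: the rank has reached l, and g(i) <= i + k stops the
   count. *)
move=> a b ltab; rewrite -[\rank _]/(\rank (zwin Vt a (absz (b - a)%R))).
case: (lerP (b - a) (k%:Z + l%:Z)) => [|ltkl]; first exact: short.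
have -> : \rank (zwin Vt a (absz (b - a)%R)) = l.
  apply/eqP; rewrite eqn_leq rank_leq_row /= -[leqLHS](rank_Vt_full a).
  have klb : (k + l <= absz (b - a)%R)%N by lia.
  rewrite (_ : zwin Vt a (k + l) =
    colsub (widen_ord klb) (zwin Vt a (absz (b - a)%R))).
    by rewrite -[X in colsub _ X]mulmx1 -mulmx_colsub mxrankM_maxl.
  by apply/matrixP => i t; rewrite !mxE.
rewrite (_ : [set i | _]%classic =
  [set i : int | ((i < a) && (a <= g i + l%:Z < a + (k + l)%N%:Z))%R]%classic); last first.
  by apply/seteqP; split=> i /=; have := gb' i; lia.
case: (posnP (k + l)) => [kl0|kl0].
  have -> : l = 0%N by lia.
  rewrite II0 (_ : [set i | _]%classic = set0) ?card_eqxx //.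
  by apply/seteqP; split=> i //=; lia.
have ltakl : a < a + (k + l)%N%:Z by lia.
have := short a (a + (k + l)%N%:Z) ltakl; rewrite (_ : absz _ = (k + l)%N); last by lia.
by rewrite rank_Vt_full; apply; lia.
Qed.

End Assembly.

Theorem theorem4p7 (R : realType) (k l m n : nat)
    (n_ge2 : (2 <= n)%N) (m_even : ~~ odd m) (n_eq : (k + l + m)%N = n)
    (V : 'M[R]_(k, n)) (W : 'M[R]_(l, n))
    (hV : Gr_ge m V) (hW : Gr_perp_gt0 (k + m) W) :
  let Wt := (theta V W).1 in
  let Vt := (theta V W).2 in
  [/\ Mat_circ (stack V W) /\
      (forall j : int, exists! x : 'cV[R]_(k + l),
         is_twist_col (stack V W) j x),
      Gr_perp_gt0 (l + m) Wt /\ Gr_ge m Vt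
    & forall f g : int -> int, affine_perm n k l f -> positroid_cell f V ->
        cancel f g -> cancel g f -> positroid_cell g Vt].
Proof.
case: n n_ge2 n_eq V W hV hW => // n _ nE V W [f0 [f0P cV0]] [fW [Z0 [[fZ0 [Z [ZZ0 pZ]]] WZ0]]].
have {}f0P : affine_perm n.+1 k l f0 by rewrite (_ : l = n.+1 - k - m)%N //; lia.
have [_ [fV [A [AV pA]]] _] := cV0.
have [B uB VE] := eqmx_row_free_mull AV fV.
have fA : row_free A by rewrite -(row_free_mull _ uB) -VE.
have fZ : row_free Z by rewrite /row_free ZZ0.
have ZW : Z *m W^T = 0.
  have /submxP[T ->] : (Z <= Z0)%MS by rewrite ZZ0.
  apply: trmx_inj; rewrite -mulmxA trmx_mul trmx_mul trmxK.
  have /sub_kermxP -> : (W <= kermx Z0^T)%MS by rewrite WZ0.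
  by rewrite mul0mx trmx0.
have lkm : (l + (k + m))%N = n.+1 by lia.
(* Up to row operations [altmx W] is totally positive, as the complement of Z. In the same way the
   complement of V yields the nonnegative matrix used below as [X]. *)
have [D0 uD0 pW1] := minors_gt0s_rep
  ((complementary_minors_sign lkm fZ fW ZW).2 (minors_gt0_gt0s pZ)).
have WE : W = invmx D0 *m altmx (D0 *m altmx W).
  by rewrite -mulmx_alt altmxK mulKmx.
have lmk : (l + m + k)%N = n.+1 by lia.
have [X0 fX0 VX0] := perp_exists lmk fV.
have AX0 : A *m X0^T = 0.
  have /submxP[T ->] : (A <= V)%MS by rewrite AV.
  by rewrite -mulmxA VX0 mulmx0.
have [D2 uD2 pX] := minors_ge0s_rep
  ((complementary_minors_sign lmk fA fX0 AX0).1 (minors_ge0_ge0s pA)).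
have fX : row_free (D2 *m altmx X0) by rewrite row_free_mull // altmx_row_free.
have XV : altmx (D2 *m altmx X0) *m V^T = 0.
  rewrite -mulmx_alt altmxK -mulmxA; apply: trmx_inj.
  by rewrite trmx_mul trmx_mul trmxK VX0 mul0mx trmx0.
have klN : (k + l <= n.+1)%N by lia.
have rV j : \rank (zwin V j (k + l)) = k := cell_window_rank j klN f0P cV0.
have uU := Uwin_stack_unit m_even nE uB VE pA fA pZ fW ZW rV.
have uD : invmx D0 \in unitmx by rewrite unitmx_inv.
have pVt := Vt_ge0s m_even nE uB VE pA fA pZ fW ZW rV uD WE pW1 pX fX XV.
have pWt := Wt_alt_gt0s m_even nE uB VE pA fA pZ fW ZW rV.
have cell f g : affine_perm n.+1 k l f -> positroid_cell f V ->
    cancel f g -> cancel g f -> positroid_cell g (dsubmx (tau (stack V W))).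
  by move=> fP cV; apply: (Vt_cell nE uU pVt).
split=> //; first by split; [apply: Mat_circ_unit|move=> j; apply: twist_col_exists_unique].
split; last first.
  (* Inversion exchanges the bounds k and l, and n - l - m = k, so the inverse permutation witnesses
     membership in Gr_{>= m}. *)
  have [[g fg gf] _ _ _] := f0P; exists g; split; last exact: cell fg gf.
  by rewrite (_ : n.+1 - l - m = k)%N; [exact: (affine_perm_inv f0P fg gf)|lia].
have kN : (k <= n.+1)%N by lia.
have fWt : row_free (usubmx (tau (stack V W))).
  by rewrite -altmx_row_free; apply: minors_gt0s_row_free.
have [Zt fZt WZt] := perp_exists lmk fWt.
split=> //; exists Zt; split; last by apply: perp_eqmx => //; lia.
(* Complementary minors are applied to the two alternated matrices, which are still orthogonal;
   alternating twice returns [Zt]. *)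
apply: Gr_gt0_rep => //; rewrite -(altmxK Zt).
apply: (complementary_minors_sign lmk _ _ _).2 pWt; rewrite ?altmx_row_free //.
by rewrite altmx_gram.
Qed.
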